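(* Let $h_2(z)=\eta^2(z)\eta^2(2z)$, and let $\nu_\pm$ be the multiplier systems on $\Gamma^*(2)$ defined below. (a) For every integer $d>0$ with $d\equiv1\pmod4$ and each choice of sign there is a unique form $f_d^{\pm}=q^{-d/4}+\sum_{n>0,\ n\equiv3\bmod4}a_d^\pm(n)q^{n/4}\in M_2^!(\Gamma^*(2),\bar\nu_\pm)$. (b) For every integer $d>0$ with $d\equiv3\pmod4$ there are unique forms $f_d^{+}=q^{-d/4}+\sum_{n>0,\ n\equiv1\bmod4}a_d^+(n)q^{n/4}\in M_2^!(\Gamma^*(2),\nu_+)$ and $f_d^{-}=q^{-d/4}+\sum_{n\ge5,\ n\equiv1\bmod4}a_d^-(n)q^{n/4}\in M_2^!(\Gamma^*(2),\nu_-)$. (c) For every odd prime $p$ and every $n\ge1$ we have $f_1^+|T_2^{(4)}(p^n)=p^nf^+_{p^n}$. If $p^n\equiv1\pmod4$ then $f_1^-|T_2^{(4)}(p^n)=p^nf^-_{p^n}$. If $p^n\equiv3\pmod4$ then $f_1^-|T_2^{(4)}(p^n)=p^nf^-_{p^n}+a_1^-(p^n)\,h_2$.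
   Context: $q=e^{2\pi iz}$, $\eta(z)=q^{1/24}\prod_{n\ge1}(1-q^n)$. $\Gamma^*(2)$ is the Fricke group generated by $\Gamma_0(2)$ and $W_2=\begin{pmatrix}0&-1\\2&0\end{pmatrix}$ (equivalently by $\begin{pmatrix}1&1\\0&1\end{pmatrix}$ and $W_2$). $\nu_\pm$ is the character of $\Gamma^*(2)$ given by $\nu_\pm(\gamma)=i^{d(b-c/2)}$ for $\gamma=\begin{pmatrix}a&b\\c&d\end{pmatrix}\in\Gamma_0(2)$ (the multiplier system of $h_2$ on $\Gamma_0(2)$) and $\nu_\pm(W_2)=\pm1$; $\bar\nu_\pm$ is its complex conjugate. For $\gamma\in GL_2^+(\mathbb{Q})$, $f|_k\gamma(z)=(\det\gamma)^{k/2}(cz+d)^{-k}f(\gamma z)$. $M_k^!(\Gamma,\chi)$ is the space of holomorphic functions on the upper half-plane, meromorphic at the cusps, with $f|_k\gamma=\chi(\gamma)f$ for all $\gamma\in\Gamma$. For a prime $p$, $f|T_k^{(t)}(p)=p^{k/2-1}\left(\sum_{\lambda=0}^{p-1}f|_k\begin{pmatrix}1&t\lambda\\0&p\end{pmatrix}+f|_k\begin{pmatrix}p&0\\0&1\end{pmatrix}\right)$, acting on $f=\sum a(n)q^{n/t}$ by $\sum(a(pn)+p^{k-1}a(n/p))q^{n/t}$; $T_k^{(t)}(1)=\mathrm{id}$, $T_k^{(t)}(p^{n+1})=T_k^{(t)}(p^n)T_k^{(t)}(p)-p^{k-1}T_k^{(t)}(p^{n-1})$. In (c), $f^\pm_{p^n}$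 are the forms from (a) or (b) according to $p^n\bmod4$, and $a_1^-(m)$ is the coefficient of $q^{m/4}$ in $f_1^-$. *)

(* Defs.v *)
From Stdlib Require Import Reals ZArith Znumtheory ClassicalEpsilon.
From Coquelicot Require Import Coquelicot.

Open Scope R_scope.

Definition UHP (z : C) : Prop := 0 < Im z.

Definition cexp (z : C) : C := (exp (Re z) * cos (Im z), exp (Re z) * sin (Im z)).
Definition Ci : C := (0, 1).
Definition qpow (r : R) (z : C) : C := cexp ((RtoC (2 * PI * r) * Ci * z)%C).

(** 2x2 integer matrices [[a,b],[c,d]] (elements of GL_2^+(Q) used here
    all have integral representatives) *)
Record mat := Mat { ma : Z; mb : Z; mc : Z; md : Z }.
Definition mdet (m : mat) : Z := (ma m * md m - mb m * mc m)%Z.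
Definition mact (m : mat) (z : C) : C :=
  ((RtoC (IZR (ma m)) * z + RtoC (IZR (mb m))) / (RtoC (IZR (mc m)) * z + RtoC (IZR (md m))))%C.

Definition slash (k : nat) (m : mat) (f : C -> C) (z : C) : C :=
  (RtoC (sqrt (IZR (mdet m))) ^ k * / (RtoC (IZR (mc m)) * z + RtoC (IZR (md m))) ^ k
   * f (mact m z))%C.

Definition W2 : mat := Mat 0 (-1) 2 0.

(** Gamma_0(2) and the Fricke group Gamma^*(2) = Gamma_0(2) u Gamma_0(2) W2,
    represented by integral matrices: Gamma_0(2) W2 consists exactly of the
    integral matrices [[A,B],[C,D]] of determinant 2 with A, C, D even. *)
Definition in_Gamma0_2 (m : mat) : Prop := mdet m = 1%Z /\ Z.Even (mc m).
Definition in_GammaStar2 (m : mat) : Prop :=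
  in_Gamma0_2 m \/
  (mdet m = 2%Z /\ Z.Even (ma m) /\ Z.Even (mc m) /\ Z.Even (md m)).

Definition ipow (e : Z) : C :=
  match (e mod 4)%Z with
  | 0%Z => RtoC 1
  | 1%Z => Ci
  | 2%Z => RtoC (-1)
  | _ => Copp Ci
  end.

(** The character nu_eps (eps = +1 or -1) of Gamma^*(2):
    nu(gamma) = i^{d(b - c/2)} on Gamma_0(2), nu(W2) = eps, extended
    multiplicatively: for gamma' = [[a',b'],[c',d']] in Gamma_0(2),
    gamma' W2 = [[2b', -a'],[2d', -c']], so nu([[A,B],[C,D]]) =
    eps * i^{(C/2)(A/2 + D/2)} on the coset Gamma_0(2) W2. *)
Definition nu (eps : R) (m : mat) : C :=
  if Z.eqb (mdet m) 1 then ipow (md m * (mb m - mc m / 2))%Z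
  else (RtoC eps * ipow ((mc m / 2) * (ma m / 2 + md m / 2))%Z)%C.
Definition nubar (eps : R) (m : mat) : C := Cconj (nu eps m).

Definition mero_at_cusps (k : nat) (f : C -> C) : Prop :=
  forall g : mat, mdet g = 1%Z ->
  exists (M N : nat) (b : nat -> C), (0 < M)%nat /\
    forall z, UHP z ->
      is_series (fun n : nat => (b n * qpow ((INR n - INR N) / INR M) z)%C)
                (slash k g f z).

Definition weakly_holomorphic (k : nat) (Gam : mat -> Prop) (chi : mat -> C)
  (f : C -> C) : Prop :=
  (forall z, UHP z -> ex_derive (K := C_AbsRing) (V := C_NormedModule) f z) /\
  (forall g, Gam g -> forall z, UHP z -> slash k g f z = (chi g * f z)%C) /\
  mero_at_cusps k f.

Definition has_qexp (t : R) (f : C -> C) (c : Z -> C) : Prop :=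
  exists N : nat,
    (forall n : Z, (n < - Z.of_nat N)%Z -> c n = RtoC 0) /\
    forall z, UHP z ->
      is_series (fun m : nat => (c (Z.of_nat m - Z.of_nat N)%Z
                     * qpow ((INR m - INR N) / t) z)%C) (f z).

Definition qcoef (d r L : Z) (a : Z -> C) (n : Z) : C :=
  if Z.eqb n (- d) then RtoC 1
  else if andb (Z.leb L n) (Z.eqb (n mod 4) r) then a n else RtoC 0.

Definition is_form (d r L : Z) (chi : mat -> C) (f : C -> C) (a : Z -> C) : Prop :=
  weakly_holomorphic 2 in_GammaStar2 chi f /\ has_qexp 4 f (qcoef d r L a).

Definition is_fplus (d : Z) (f : C -> C) (a : Z -> C) : Prop :=
  if Z.eqb (d mod 4) 1 then is_form d 3 1 (nubar 1) f a
  else is_form d 1 1 (nu 1) f a.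
Definition is_fminus (d : Z) (f : C -> C) (a : Z -> C) : Prop :=
  if Z.eqb (d mod 4) 1 then is_form d 3 1 (nubar (-1)) f a
  else is_form d 1 5 (nu (-1)) f a.

Definition unique_on_UHP (P : (C -> C) -> Prop) : Prop :=
  exists f, P f /\ forall g, P g -> forall z, UHP z -> g z = f z.

Definition hecke_p (k : nat) (t p : Z) (f : C -> C) (z : C) : C :=
  (RtoC (Rpower (IZR p) (INR k / 2 - 1)) *
   (sum_n (G := C_AbelianMonoid)
      (fun l : nat => slash k (Mat 1 (t * Z.of_nat l) 0 p) f z) (Z.to_nat p - 1)
    + slash k (Mat p 0 0 1) f z))%C.

Fixpoint hecke_pn (k : nat) (t p : Z) (n : nat) (f : C -> C) {struct n} : C -> C :=
  match n with
  | O => f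
  | S n' =>
    match n' with
    | O => hecke_p k t p f
    | S n'' => fun z =>
        (hecke_p k t p (hecke_pn k t p n' f) z
         - RtoC (Rpower (IZR p) (INR k - 1)) * hecke_pn k t p n'' f z)%C
    end
  end.

Fixpoint eta_partial (z : C) (N : nat) : C :=
  match N with
  | O => RtoC 1
  | S N' => (eta_partial z N' * (RtoC 1 - qpow (INR N) z))%C
  end.
Definition eta_prod (z : C) : C :=
  epsilon (inhabits (RtoC 0))
    (fun w : C => filterlim (eta_partial z) eventually (locally w)).
Definition eta (z : C) : C := (qpow (1 / 24) z * eta_prod z)%C.

Definition h2 (z : C) : C := (eta z ^ 2 * eta (RtoC 2 * z) ^ 2)%C.

(* Main.v *)
(** Uniqueness. If [f] has weight 2 and sign [+-1] under [W2] and starts at [q^(3/4)] or later, then [y |f|] is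
    invariant under [z -> z + 1] and [z -> -1/(2z)]; these move every point to height at least [49/100], where the
    decay of [f] contradicts Cauchy's estimates unless [f = 0]. If [f] starts at [q^(1/4)] with sign [+1], the same
    argument in weight 4 gives [f^2 = c^2 h2^2], and [f] vanishes at the fixed point [i / sqrt 2] of [W2]
    whereas [h2] does not.

    Existence. With [u = eta(z)^2] and [v = eta(2z)^2], the forms [h2 = u v], [u^7/v^5 -+ 64 v^7/u^5] and
    [h2 (t - 4096/t)], [t = (u/v)^12], have the smallest poles; multiplication by [t + 4096/t] produces the others.
    They are modular because [W2] and [T] generate the Fricke group and [eta^2(-1/z) = -i z eta^2(z)], which follows
    by integrating the transformation law of the weight 2 Eisenstein series; the latter is obtained from the partial
    fractions of the cotangent by interchanging two summations.

    Hecke operators. [T(p)] commutes with [W2] because [l -> l'] with [32 l l' = -1 mod p] permutes the nonzero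
    residues, and on coefficients [T(p^(n+1)) = U^(n+1) + p V T(p^n)] shows that [f1 | T(p^n)] has principal
    part [p^n q^(-p^n/4)]; uniqueness identifies it. *)

Require Import Defs.
From Stdlib Require Import Reals ZArith Znumtheory Lra Lia ClassicalEpsilon.
From Coquelicot Require Import Coquelicot.
Local Open Scope C_scope.

(** * Complex sequences and series *)

Lemma RtoC_neq0 (x : R) : x <> 0%R -> RtoC x <> 0.
Proof. intros H E. apply H. now apply RtoC_inj. Qed.

Lemma RtoC_m1 : RtoC (-1) = - (1).
Proof. now rewrite <- RtoC_opp. Qed.

Lemma Cmult_reg_l (a b c : C) : a <> 0 -> a * b = a * c -> b = c.
Proof.
  intros Ha H. replace b with (/ a * (a * b)) by (field; assumption). rewrite H. now field.
Qed.

Lemma Cinv_neq0 (x : C) : x <> 0 -> / x <> 0.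
Proof. intros H E. apply C1_nz. rewrite <- (Cinv_l x H), E. ring. Qed.

Lemma Cminus_diag_uniq (x y : C) : x - y = 0 -> x = y.
Proof. intros H. replace x with (x - y + y) by ring. rewrite H. ring. Qed.

Lemma Cmod_minus_le (x y : C) : (Cmod (x - y) <= Cmod x + Cmod y)%R.
Proof. unfold Cminus. rewrite <- (Cmod_opp y). apply Cmod_triangle. Qed.

Lemma Cmod_minus_ge (x y : C) : (Cmod x - Cmod y <= Cmod (x - y))%R.
Proof.
  pose proof (Cmod_triangle (x - y) y) as H.
  replace (x - y + y) with x in H by ring. lra.
Qed.

Lemma im_le_Cmod (z : C) : (Rabs (Im z) <= Cmod z)%R.
Proof. eapply Rle_trans; [|apply Rmax_Cmod]. apply (Rmax_r (Rabs (fst z))). Qed.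

Lemma Cmod_INR n : Cmod (INR n) = INR n.
Proof. rewrite Cmod_R. apply Rabs_pos_eq, pos_INR. Qed.

Definition is_Clim_seq (u : nat -> C) (l : C) : Prop := filterlim u eventually (locally l).

Lemma is_Clim_seq_spec (u : nat -> C) (l : C) :
  is_Clim_seq u l <-> forall eps : posreal, eventually (fun n => (Cmod (u n - l) < eps)%R).
Proof. exact (filterlim_locally_ball_norm (U := C_NormedModule) u l). Qed.

(* Coquelicot equips [C] with two uniform structures, with the same neighbourhoods. *)
Lemma is_Clim_seq_AbsRing (u : nat -> C) (l : C) :
  is_Clim_seq u l <-> filterlim u eventually (locally (T := AbsRing_UniformSpace C_AbsRing) l).
Proof. split; intros H P HP; apply H, locally_C, HP. Qed.

Lemma is_Clim_seq_ext (u v : nat -> C) l : (forall n, u n = v n) -> is_Clim_seq u l -> is_Clim_seq v l.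
Proof. apply filterlim_ext. Qed.

Lemma is_Clim_seq_ext_loc (u v : nat -> C) l N :
  (forall n, (N <= n)%nat -> u n = v n) -> is_Clim_seq u l -> is_Clim_seq v l.
Proof. intros H. apply filterlim_ext_loc. now exists N. Qed.

Lemma is_Clim_seq_const (c : C) : is_Clim_seq (fun _ => c) c.
Proof. apply filterlim_const. Qed.

Lemma is_Clim_seq_unique (u : nat -> C) (l l' : C) : is_Clim_seq u l -> is_Clim_seq u l' -> l = l'.
Proof. exact (filterlim_locally_unique (V := C_NormedModule) u l l'). Qed.

Lemma is_Clim_seq_subseq (u : nat -> C) (phi : nat -> nat) l :
  filterlim phi eventually eventually -> is_Clim_seq u l -> is_Clim_seq (fun n => u (phi n)) l.
Proof. apply filterlim_comp. Qed.

Lemma is_Clim_seq_incr_n (u : nat -> C) k l : is_Clim_seq (fun n => u (k + n)%nat) l <-> is_Clim_seq u l.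
Proof.
  split; intros H.
  - intros P HP. destruct (H P HP) as [N HN]. exists (k + N)%nat. intros n Hn.
    replace n with (k + (n - k))%nat by lia. apply HN. lia.
  - apply (is_Clim_seq_subseq u (Nat.add k)); [|exact H]. apply eventually_subseq. intros; lia.
Qed.

Lemma is_Clim_seq_plus u v a b :
  is_Clim_seq u a -> is_Clim_seq v b -> is_Clim_seq (fun n => u n + v n) (a + b).
Proof. intros Hu Hv. exact (filterlim_comp_2 _ _ _ Hu Hv (filterlim_plus (V := C_NormedModule) a b)). Qed.

Lemma is_Clim_seq_mult u v a b :
  is_Clim_seq u a -> is_Clim_seq v b -> is_Clim_seq (fun n => u n * v n) (a * b).
Proof.
  rewrite !is_Clim_seq_AbsRing. intros Hu Hv.
  exact (filterlim_comp_2 _ _ _ Hu Hv (filterlim_mult (K := C_AbsRing) a b)).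
Qed.

Lemma is_Clim_seq_scal c u a : is_Clim_seq u a -> is_Clim_seq (fun n => c * u n) (c * a).
Proof. apply is_Clim_seq_mult, is_Clim_seq_const. Qed.

Lemma is_Clim_seq_opp u a : is_Clim_seq u a -> is_Clim_seq (fun n => - u n) (- a).
Proof.
  intros H. replace (- a) with (- (1) * a) by ring.
  eapply is_Clim_seq_ext; [|apply is_Clim_seq_scal, H]. intros n. simpl. ring.
Qed.

Lemma is_Clim_seq_minus u v a b :
  is_Clim_seq u a -> is_Clim_seq v b -> is_Clim_seq (fun n => u n - v n) (a - b).
Proof. intros Hu Hv. apply is_Clim_seq_plus; [|apply is_Clim_seq_opp]; assumption. Qed.

Lemma is_Clim_seq_RtoC (u : nat -> R) (l : R) : is_Clim_seq (fun n => RtoC (u n)) l <-> is_lim_seq u l.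
Proof.
  rewrite is_Clim_seq_spec, <- is_lim_seq_spec.
  split; intros H eps; destruct (H eps) as [N HN]; exists N; intros n Hn; specialize (HN n Hn);
    rewrite <- RtoC_minus, Cmod_R in *; exact HN.
Qed.

Lemma is_Clim_seq_squeeze (u : nat -> C) l (r : nat -> R) :
  (forall n, (Cmod (u n - l) <= r n)%R) -> is_lim_seq r 0 -> is_Clim_seq u l.
Proof.
  rewrite is_Clim_seq_spec, <- is_lim_seq_spec. intros H Hr eps.
  destruct (Hr eps) as [N HN]. exists N. intros n Hn. specialize (HN n Hn).
  rewrite Rminus_0_r in HN. eapply Rle_lt_trans; [apply H|]. eapply Rle_lt_trans; [apply Rle_abs|exact HN].
Qed.

Lemma is_Clim_seq_bounded (u : nat -> C) l :
  is_Clim_seq u l -> exists M : R, forall n, (Cmod (u n) <= M)%R.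
Proof.
  intros H. destruct (filterlim_bounded (V := C_NormedModule) u (ex_intro _ l H)) as [M HM]. now exists M.
Qed.

Lemma is_Clim_seq_Cmod_le (u : nat -> C) l M : (forall n, (Cmod (u n) <= M)%R) -> is_Clim_seq u l -> (Cmod l <= M)%R.
Proof.
  intros H Hu. apply (is_lim_seq_le (fun n => Cmod (u n)) (fun _ => M) (Cmod l) M H); [|apply is_lim_seq_const].
  exact (filterlim_comp _ _ _ u Cmod _ _ _ Hu (filterlim_norm (V := C_NormedModule) l)).
Qed.

Fixpoint Csum (f : nat -> C) (n : nat) : C :=
  match n with O => 0 | S m => Csum f m + f m end.

Lemma Csum_ext (f g : nat -> C) n :
  (forall k, (k < n)%nat -> f k = g k) -> Csum f n = Csum g n.
Proof.
  induction n as [|n IH]; intros H; simpl; [reflexivity|].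
  rewrite IH by (intros; apply H; lia). now rewrite H by lia.
Qed.

Lemma Csum_plus f g n : Csum (fun k => f k + g k) n = Csum f n + Csum g n.
Proof. induction n as [|n IH]; simpl; [ring|]. rewrite IH. ring. Qed.

Lemma Csum_minus f g n : Csum (fun k => f k - g k) n = Csum f n - Csum g n.
Proof. induction n as [|n IH]; simpl; [ring|]. rewrite IH. ring. Qed.

Lemma Csum_scal c f n : Csum (fun k => c * f k) n = c * Csum f n.
Proof. induction n as [|n IH]; simpl; [ring|]. rewrite IH. ring. Qed.

Lemma Csum_const c n : Csum (fun _ => c) n = INR n * c.
Proof.
  induction n as [|n IH]; simpl Csum; [simpl; ring|].
  rewrite IH, S_INR, RtoC_plus. ring.
Qed.

Lemma Csum_0 (f : nat -> C) n : (forall k, (k < n)%nat -> f k = 0) -> Csum f n = 0.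
Proof. intros H. rewrite (Csum_ext f (fun _ => 0)) by exact H. rewrite Csum_const. ring. Qed.

Lemma Csum_switch (F : nat -> nat -> C) m n :
  Csum (fun i => Csum (fun j => F i j) n) m = Csum (fun j => Csum (fun i => F i j) m) n.
Proof.
  induction m as [|m IH]; simpl.
  - symmetry. now apply Csum_0.
  - now rewrite IH, <- Csum_plus.
Qed.

Lemma Csum_split f m n : Csum f (m + n) = Csum f m + Csum (fun k => f (m + k)%nat) n.
Proof.
  induction n as [|n IH]; simpl; [rewrite Nat.add_0_r; ring|].
  rewrite Nat.add_succ_r. simpl. rewrite IH. ring.
Qed.

Lemma Csum_S_l f n : Csum f (S n) = f O + Csum (fun k => f (S k)) n.
Proof. change (S n) with (1 + n)%nat. rewrite Csum_split. simpl. ring. Qed.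

Lemma Csum_telescope f n : Csum (fun k => f (S k) - f k) n = f n - f O.
Proof. induction n as [|n IH]; simpl; [ring|]. rewrite IH. ring. Qed.

Lemma Csum_single (f : nat -> C) j n : (j < n)%nat -> (forall k, (k < n)%nat -> k <> j -> f k = 0) -> Csum f n = f j.
Proof.
  intros Hj H. replace n with (j + S (n - S j))%nat by lia.
  rewrite Csum_split, Csum_S_l, Nat.add_0_r.
  rewrite !Csum_0 by (intros; apply H; lia). ring.
Qed.

Lemma Csum_involution (g : nat -> C) (sg : nat -> nat) n :
  (forall l, (l < n)%nat -> (sg l < n)%nat /\ sg (sg l) = l) -> Csum (fun l => g (sg l)) n = Csum g n.
Proof.
  intros H. transitivity (Csum (fun l => Csum (fun j => if (j =? sg l)%nat then g j else 0) n) n).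
  - apply Csum_ext. intros l Hl. rewrite (Csum_single _ (sg l)).
    + now rewrite Nat.eqb_refl.
    + now apply H.
    + intros k _ Hk. now rewrite (proj2 (Nat.eqb_neq _ _) Hk).
  - rewrite Csum_switch. apply Csum_ext. intros j Hj. destruct (H j Hj) as [Hs Es].
    rewrite (Csum_single _ (sg j)).
    + now rewrite Es, Nat.eqb_refl.
    + assumption.
    + intros l Hl Hne. rewrite (proj2 (Nat.eqb_neq _ _)); [reflexivity|].
      intros ->. apply Hne. symmetry. now apply H.
Qed.

Lemma Re_Csum f n : Re (Csum f (S n)) = sum_n (fun k => Re (f k)) n.
Proof.
  induction n as [|n IH]; [rewrite sum_O; apply Rplus_0_l|]. rewrite sum_Sn, <- IH. reflexivity.
Qed.

Lemma Im_Csum f n : Im (Csum f (S n)) = sum_n (fun k => Im (f k)) n.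
Proof.
  induction n as [|n IH]; [rewrite sum_O; apply Rplus_0_l|]. rewrite sum_Sn, <- IH. reflexivity.
Qed.

Lemma Csum_RtoC (f : nat -> R) n : Csum (fun k => RtoC (f k)) (S n) = RtoC (sum_n f n).
Proof.
  induction n as [|n IH]; [rewrite sum_O; apply Cplus_0_l|].
  rewrite sum_Sn. change plus with Rplus. rewrite RtoC_plus, <- IH. reflexivity.
Qed.

Lemma Cmod_Csum_le (f : nat -> C) (A : nat -> R) n :
  (forall k, (k <= n)%nat -> (Cmod (f k) <= A k)%R) -> (Cmod (Csum f (S n)) <= sum_f_R0 A n)%R.
Proof.
  induction n as [|n IH]; intros H.
  - simpl. rewrite Cplus_0_l. now apply H.
  - change (Csum f (S (S n))) with (Csum f (S n) + f (S n)).
    eapply Rle_trans; [apply Cmod_triangle|].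
    apply Rplus_le_compat; [apply IH; intros; apply H; lia|now apply H].
Qed.

Lemma sum_n_Csum (f : nat -> C) n : sum_n f n = Csum f (S n).
Proof.
  induction n as [|n IH]; [rewrite sum_O; symmetry; apply Cplus_0_l|].
  rewrite sum_Sn, IH. reflexivity.
Qed.

Lemma is_series_Csum (f : nat -> C) (l : C) : is_series f l <-> is_Clim_seq (Csum f) l.
Proof.
  rewrite <- (is_Clim_seq_incr_n (Csum f) 1).
  split; apply filterlim_ext; intros n; [|symmetry]; apply sum_n_Csum.
Qed.

Lemma is_series_Cunique (f : nat -> C) (l l' : C) : is_series f l -> is_series f l' -> l = l'.
Proof. rewrite !is_series_Csum. apply is_Clim_seq_unique. Qed.

Lemma is_series_Cext (f g : nat -> C) (l : C) : (forall n, f n = g n) -> is_series f l -> is_series g l.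
Proof. intros E. apply is_series_ext. exact E. Qed.

Lemma is_series_Cplus (f g : nat -> C) (a b : C) :
  is_series f a -> is_series g b -> is_series (fun n => f n + g n) (a + b).
Proof. exact (is_series_plus f g a b). Qed.

Lemma is_series_Cscal (c : C) (f : nat -> C) (a : C) : is_series f a -> is_series (fun n => c * f n) (c * a).
Proof. exact (is_series_scal c f a). Qed.

Lemma is_series_Cminus (f g : nat -> C) (a b : C) :
  is_series f a -> is_series g b -> is_series (fun n => f n - g n) (a - b).
Proof. exact (is_series_minus f g a b). Qed.

Lemma is_series_incr_Csum (f : nat -> C) k (l : C) :
  is_series (fun n => f (k + n)%nat) l <-> is_series f (Csum f k + l).
Proof.
  rewrite !is_series_Csum, <- (is_Clim_seq_incr_n (Csum f) k). split; intros H.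
  - eapply is_Clim_seq_ext; [intros; symmetry; apply Csum_split|].
    apply is_Clim_seq_plus; [apply is_Clim_seq_const|exact H].
  - replace l with (Csum f k + l - Csum f k) by ring.
    eapply is_Clim_seq_ext; [|apply is_Clim_seq_minus; [exact H|apply (is_Clim_seq_const (Csum f k))]].
    intros n. simpl. rewrite Csum_split. ring.
Qed.

Lemma is_series_incr_0 (f : nat -> C) k (l : C) : (forall n, (n < k)%nat -> f n = 0) ->
  is_series (fun n => f (k + n)%nat) l <-> is_series f l.
Proof. intros H. rewrite is_series_incr_Csum, (Csum_0 f k H), Cplus_0_l. reflexivity. Qed.

Lemma is_series_Cfin (f : nat -> C) N : (forall n, (N <= n)%nat -> f n = 0) -> is_series f (Csum f N).
Proof.
  intros H. apply is_series_Csum, (is_Clim_seq_ext_loc (fun _ => Csum f N) _ _ N); [|apply is_Clim_seq_const].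
  intros n Hn. replace n with (N + (n - N))%nat by lia. rewrite Csum_split.
  rewrite (Csum_0 (fun k => f (N + k)%nat)) by (intros; apply H; lia). ring.
Qed.

Lemma is_series_Csum_switch (X : nat -> nat -> C) (L : nat -> C) n :
  (forall l, is_series (X l) (L l)) -> is_series (fun m => Csum (fun l => X l m) n) (Csum L n).
Proof.
  intros H. induction n as [|n IH]; simpl; [|now apply is_series_Cplus].
  now apply (is_series_Cfin (fun _ => 0) 0).
Qed.

Lemma is_series_RtoC (f : nat -> R) (l : R) : is_series (fun n => RtoC (f n)) (RtoC l) <-> is_series f l.
Proof.
  rewrite is_series_Csum, <- (is_Clim_seq_incr_n _ 1).
  etransitivity; [|exact (is_Clim_seq_RtoC (sum_n f) l)].
  split; apply is_Clim_seq_ext; intros n; [|symmetry]; apply Csum_RtoC.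
Qed.

Definition CSeries (f : nat -> C) : C := (Series (fun n => Re (f n)), Series (fun n => Im (f n))).

Lemma CSeries_unique (f : nat -> C) (l : C) : is_series f l -> CSeries f = l.
Proof.
  intros H. apply is_series_Csum, (is_Clim_seq_incr_n _ 1) in H. rewrite is_Clim_seq_spec in H.
  destruct l as [a b]. unfold CSeries.
  f_equal; apply is_series_unique; refine (proj1 (is_lim_seq_spec (sum_n _) (Finite _)) _);
    intros eps; destruct (H eps) as [N HN]; exists N; intros n Hn; (eapply Rle_lt_trans; [|exact (HN n Hn)]).
  - rewrite <- Re_Csum. apply (re_le_Cmod (Csum f (S n) - (a, b))).
  - rewrite <- Im_Csum. apply (im_le_Cmod (Csum f (S n) - (a, b))).
Qed.

Lemma CSeries_ext f g : (forall n, f n = g n) -> CSeries f = CSeries g.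
Proof. intros H. unfold CSeries. f_equal; apply Series_ext; intros n; now rewrite H. Qed.

Lemma CSeries_fin (f : nat -> C) N : (forall n, (N <= n)%nat -> f n = 0) -> CSeries f = Csum f N.
Proof. intros H. now apply CSeries_unique, is_series_Cfin. Qed.

Lemma CSeries_0 (f : nat -> C) : (forall n, f n = 0) -> CSeries f = 0.
Proof. intros H. now apply (CSeries_fin f 0). Qed.

Definition abs_summable (f : nat -> C) : Prop := ex_series (fun n => Cmod (f n)).
Definition l1norm (f : nat -> C) : R := Series (fun n => Cmod (f n)).

Lemma ex_series_le_nonneg (a b : nat -> R) : (forall n, (0 <= a n <= b n)%R) -> ex_series b -> ex_series a.
Proof.
  intros H. apply (ex_series_le (V := R_CompleteNormedModule)). intros n.
  change (Rabs (a n) <= b n)%R. rewrite Rabs_pos_eq; apply H.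
Qed.

Lemma Series_nonneg (a : nat -> R) : (forall n, (0 <= a n)%R) -> ex_series a -> (0 <= Series a)%R.
Proof.
  intros H Ha. rewrite <- (is_series_unique (fun _ => 0%R) 0) at 1.
  - apply Series_le; [|assumption]. intros n. split; [lra|apply H].
  - apply (is_series_RtoC (fun _ => 0%R) 0). now apply (is_series_Cfin _ 0).
Qed.

Lemma term_le_Series (a : nat -> R) n : (forall k, (0 <= a k)%R) -> ex_series a -> (a n <= Series a)%R.
Proof.
  revert a. induction n as [|n IH]; intros a H Ha; rewrite Series_incr_1 by assumption;
    assert (Ha' : ex_series (fun k => a (S k))) by now apply (ex_series_incr_1 a).
  - pose proof (Series_nonneg _ (fun k => H (S k)) Ha'). lra.
  - pose proof (IH (fun k => a (S k)) (fun k => H (S k)) Ha'). pose proof (H O). simpl in *. lra.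
Qed.

Lemma abs_summable_le f (A : nat -> R) : (forall n, (Cmod (f n) <= A n)%R) -> ex_series A -> abs_summable f.
Proof. intros H. apply ex_series_le_nonneg. intros n. split; [apply Cmod_ge_0|apply H]. Qed.

Lemma abs_summable_ext f g : (forall n, f n = g n) -> abs_summable f -> abs_summable g.
Proof. intros H. apply ex_series_ext. intros n. now rewrite H. Qed.

Lemma abs_summable_plus f g : abs_summable f -> abs_summable g -> abs_summable (fun n => f n + g n).
Proof.
  intros Hf Hg. apply abs_summable_le with (fun n => Cmod (f n) + Cmod (g n))%R.
  - intros; apply Cmod_triangle.
  - now apply (ex_series_plus (V := R_NormedModule)).
Qed.

Lemma abs_summable_scal c f : abs_summable f -> abs_summable (fun n => c * f n).
Proof.
  intros Hf. apply abs_summable_le with (fun n => Cmod c * Cmod (f n))%R.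
  - intros; rewrite Cmod_mult; apply Rle_refl.
  - now apply (ex_series_scal (V := R_NormedModule)).
Qed.

Lemma abs_summable_minus f g : abs_summable f -> abs_summable g -> abs_summable (fun n => f n - g n).
Proof.
  intros Hf Hg. apply abs_summable_plus; [assumption|].
  apply abs_summable_ext with (fun n => - (1) * g n); [intros; ring|]. now apply abs_summable_scal.
Qed.

Lemma abs_summable_incr_n f k : abs_summable (fun n => f (k + n)%nat) <-> abs_summable f.
Proof. symmetry. apply (ex_series_incr_n (fun n => Cmod (f n)) k). Qed.

Lemma abs_summable_fin (f : nat -> C) N : (forall n, (N <= n)%nat -> f n = 0) -> abs_summable f.
Proof.
  intros H. apply (abs_summable_incr_n f N). exists 0%R. apply is_series_RtoC.
  apply (is_series_Cfin _ 0). intros n _. now rewrite H, Cmod_0 by lia.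
Qed.

Lemma CSeries_correct f : abs_summable f -> is_series f (CSeries f).
Proof.
  intros H. destruct (ex_series_le (V := C_CompleteNormedModule) f (fun n => Cmod (f n))) as [l Hl];
    [intros; apply Rle_refl|exact H|]. now rewrite (CSeries_unique f l).
Qed.

Lemma CSeries_plus f g : abs_summable f -> abs_summable g -> CSeries (fun n => f n + g n) = CSeries f + CSeries g.
Proof. intros Hf Hg. apply CSeries_unique, is_series_Cplus; now apply CSeries_correct. Qed.

Lemma CSeries_scal c f : abs_summable f -> CSeries (fun n => c * f n) = c * CSeries f.
Proof. intros Hf. now apply CSeries_unique, is_series_Cscal, CSeries_correct. Qed.

Lemma CSeries_minus f g : abs_summable f -> abs_summable g -> CSeries (fun n => f n - g n) = CSeries f - CSeries g.
Proof. intros Hf Hg. apply CSeries_unique, is_series_Cminus; now apply CSeries_correct. Qed.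

Lemma CSeries_incr_n f k : abs_summable f -> CSeries f = Csum f k + CSeries (fun n => f (k + n)%nat).
Proof.
  intros H. apply CSeries_unique, is_series_incr_Csum, CSeries_correct. now apply abs_summable_incr_n.
Qed.

Lemma CSeries_incr_1 f : abs_summable f -> CSeries f = f O + CSeries (fun n => f (S n)).
Proof. intros H. rewrite (CSeries_incr_n f 1) by assumption. simpl. ring. Qed.

Lemma CSeries_RtoC (f : nat -> R) : ex_series f -> CSeries (fun n => RtoC (f n)) = Series f.
Proof. intros H. now apply CSeries_unique, is_series_RtoC, Series_correct. Qed.

Lemma Cmod_CSeries_le f (A : nat -> R) : (forall n, (Cmod (f n) <= A n)%R) -> ex_series A ->
  (Cmod (CSeries f) <= Series A)%R.
Proof.
  intros H HA. refine (is_lim_seq_le (fun n => Cmod (Csum f (S n))) (sum_n A) (Cmod (CSeries f)) (Series A) _ _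
    (Series_correct _ HA)).
  - intros n. rewrite sum_n_Reals. now apply Cmod_Csum_le.
  - refine (filterlim_comp _ _ _ _ Cmod _ _ _ _ (filterlim_norm (V := C_NormedModule) (CSeries f))).
    apply (is_Clim_seq_incr_n (Csum f) 1), is_series_Csum, CSeries_correct. now apply abs_summable_le with A.
Qed.

Lemma Cmod_CSeries_minus_Csum_le f (A : nat -> R) n : (forall k, (Cmod (f k) <= A k)%R) -> ex_series A ->
  (Cmod (CSeries f - Csum f (S n)) <= Series A - sum_n A n)%R.
Proof.
  intros H HA. rewrite (CSeries_incr_n f (S n)) by now apply abs_summable_le with A.
  rewrite (Series_incr_n A (S n)) by (lia || assumption). rewrite sum_n_Reals. simpl pred.
  replace (Csum f (S n) + CSeries (fun k => f (S n + k)%nat) - Csum f (S n))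
    with (CSeries (fun k => f (S n + k)%nat)) by ring.
  replace (_ + _ - _)%R with (Series (fun k => A (S n + k)%nat)) by ring.
  apply Cmod_CSeries_le; [intros; apply H|]. now apply (ex_series_incr_n A).
Qed.

Lemma Cmod_le_l1norm f n : abs_summable f -> (Cmod (f n) <= l1norm f)%R.
Proof. apply (term_le_Series (fun n => Cmod (f n))). intros; apply Cmod_ge_0. Qed.

Lemma l1norm_nonneg f : abs_summable f -> (0 <= l1norm f)%R.
Proof. apply Series_nonneg. intros; apply Cmod_ge_0. Qed.

Lemma l1norm_ext f g : (forall n, f n = g n) -> l1norm f = l1norm g.
Proof. intros H. apply Series_ext. intros n. now rewrite H. Qed.

Lemma l1norm_scal c f : l1norm (fun n => c * f n) = (Cmod c * l1norm f)%R.
Proof. unfold l1norm. rewrite <- Series_scal_l. apply Series_ext. intros n. apply Cmod_mult. Qed.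

Lemma l1norm_le f (A : nat -> R) : (forall n, (Cmod (f n) <= A n)%R) -> ex_series A -> (l1norm f <= Series A)%R.
Proof. intros H. apply Series_le. intros n. split; [apply Cmod_ge_0|apply H]. Qed.

Lemma is_Clim_seq_CSeries_dominated (F : nat -> nat -> C) (f : nat -> C) (A : nat -> R) :
  (forall n k, (Cmod (F n k) <= A k)%R) -> ex_series A ->
  (forall k, is_Clim_seq (fun n => F n k) (f k)) -> is_Clim_seq (fun n => CSeries (F n)) (CSeries f).
Proof.
  intros HF HA Hf.
  assert (HfA : forall k, (Cmod (f k) <= A k)%R).
  { intros k. apply is_Clim_seq_Cmod_le with (fun n => F n k); auto. }
  apply is_Clim_seq_spec. intros eps. pose proof (cond_pos eps) as Heps.
  assert (Htail : exists K, (Series A - sum_n A K < eps / 3)%R).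
  { pose proof (proj2 (is_lim_seq_spec (sum_n A) (Series A)) (Series_correct _ HA)) as L.
    assert (E : (0 < eps / 3)%R) by lra. destruct (L (mkposreal _ E)) as [K HK]. exists K.
    specialize (HK K (Nat.le_refl _)). simpl in HK. apply Rabs_def2 in HK. lra. }
  destruct Htail as [K HK].
  assert (Hpartial : is_Clim_seq (fun n => Csum (F n) (S K)) (Csum f (S K))).
  { clear HK. induction (S K) as [|k IH]; simpl; [apply is_Clim_seq_const|]. now apply is_Clim_seq_plus. }
  assert (E : (0 < eps / 3)%R) by lra.
  destruct (proj1 (is_Clim_seq_spec _ _) Hpartial (mkposreal _ E)) as [N HN].
  exists N. intros n Hn. specialize (HN n Hn). simpl pos in HN.
  pose proof (Cmod_CSeries_minus_Csum_le (F n) A K (HF n) HA) as T1.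
  pose proof (Cmod_CSeries_minus_Csum_le f A K HfA HA) as T2.
  replace (CSeries (F n) - CSeries f) with
    ((CSeries (F n) - Csum (F n) (S K)) + (Csum (F n) (S K) - Csum f (S K)) - (CSeries f - Csum f (S K))) by ring.
  eapply Rle_lt_trans; [apply Cmod_minus_le|].
  pose proof (Cmod_triangle (CSeries (F n) - Csum (F n) (S K)) (Csum (F n) (S K) - Csum f (S K))). lra.
Qed.

Section Fubini.

Variable X : nat -> nat -> C.
Hypothesis rows_summable : forall m, abs_summable (X m).
Hypothesis rows_norms_summable : ex_series (fun m => l1norm (X m)).

Lemma fubini_abs_summable_column n : abs_summable (fun m => X m n).
Proof. eapply abs_summable_le; [|exact rows_norms_summable]. intros m. now apply Cmod_le_l1norm. Qed.

Lemma fubini_abs_summable_row_sums : abs_summable (fun m => CSeries (X m)).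
Proof.
  eapply abs_summable_le; [|exact rows_norms_summable]. intros m.
  apply Cmod_CSeries_le; [intros; apply Rle_refl|apply rows_summable].
Qed.

Lemma fubini_is_series : is_series (fun n => CSeries (fun m => X m n)) (CSeries (fun m => CSeries (X m))).
Proof.
  apply is_series_Csum, (is_Clim_seq_incr_n _ 1).
  apply (is_Clim_seq_ext (fun N => CSeries (fun m => Csum (X m) (1 + N)))).
  - intros N. apply CSeries_unique, (is_series_Csum_switch (fun n m => X m n)).
    intros n. apply CSeries_correct, fubini_abs_summable_column.
  - eapply is_Clim_seq_CSeries_dominated; [|exact rows_norms_summable|].
    + intros N m. eapply Rle_trans; [apply (Cmod_Csum_le _ (fun n => Cmod (X m n))); intros; apply Rle_refl|].
      rewrite <- sum_n_Reals.
      apply (is_lim_seq_incr_compare (sum_n (fun n => Cmod (X m n)))); [exact (Series_correct _ (rows_summable m))|].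
      intros k. rewrite sum_Sn. change (sum_n (fun n => Cmod (X m n)) k <= sum_n (fun n => Cmod (X m n)) k +
        Cmod (X m (S k)))%R.
      pose proof (Cmod_ge_0 (X m (S k))). lra.
    + intros m. apply (is_Clim_seq_incr_n (Csum (X m)) 1), is_series_Csum, CSeries_correct, rows_summable.
Qed.

End Fubini.

Lemma fubini_is_series_l1norm (X : nat -> nat -> C) :
  (forall m, abs_summable (X m)) -> ex_series (fun m => l1norm (X m)) ->
  is_series (fun n => l1norm (fun m => X m n)) (Series (fun m => l1norm (X m))).
Proof.
  intros H1 H2. set (Y := fun m n => RtoC (Cmod (X m n))).
  assert (EY : forall m n, Cmod (Y m n) = Cmod (X m n))
    by (intros; unfold Y; rewrite Cmod_R; apply Rabs_pos_eq, Cmod_ge_0).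
  apply is_series_RtoC.
  rewrite <- CSeries_RtoC by exact H2. rewrite (CSeries_ext _ (fun m => CSeries (Y m))).
  - apply (is_series_Cext (fun n => CSeries (fun m => Y m n))).
    + intros n. apply CSeries_RtoC. now apply (fubini_abs_summable_column X).
    + apply fubini_is_series.
      * intros m. unfold abs_summable. eapply ex_series_ext; [|exact (H1 m)]. intros; now rewrite EY.
      * eapply ex_series_ext; [|exact H2]. intros m. apply Series_ext. intros; now rewrite EY.
  - intros m. symmetry. exact (CSeries_RtoC _ (H1 m)).
Qed.

Section FubiniSums.

Variable X : nat -> nat -> C.
Hypothesis rows_summable : forall m, abs_summable (X m).
Hypothesis rows_norms_summable : ex_series (fun m => l1norm (X m)).

Lemma Cmod_column_sum_le n : (Cmod (CSeries (fun m => X m n)) <= l1norm (fun m => X m n))%R.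
Proof. apply Cmod_CSeries_le; [intros; apply Rle_refl|]. now apply fubini_abs_summable_column. Qed.

Lemma fubini_abs_summable_column_sums : abs_summable (fun n => CSeries (fun m => X m n)).
Proof.
  eapply abs_summable_le; [exact Cmod_column_sum_le|]. eexists. now apply fubini_is_series_l1norm.
Qed.

Lemma l1norm_column_sums_le : (l1norm (fun n => CSeries (fun m => X m n)) <= Series (fun m => l1norm (X m)))%R.
Proof.
  rewrite <- (is_series_unique _ _ (fubini_is_series_l1norm X rows_summable rows_norms_summable)).
  apply l1norm_le; [exact Cmod_column_sum_le|]. eexists. now apply fubini_is_series_l1norm.
Qed.

Lemma CSeries_switch : CSeries (fun n => CSeries (fun m => X m n)) = CSeries (fun m => CSeries (X m)).
Proof. now apply CSeries_unique, fubini_is_series. Qed.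

End FubiniSums.

(** * Complex differentiation *)

Lemma is_derive_eq (f : C -> C) (x l l' : C) : is_derive f x l -> l = l' -> is_derive f x l'.
Proof. now intros H <-. Qed.

Lemma is_derive_Cunique (f : C -> C) (x l l' : C) : is_derive f x l -> is_derive f x l' -> l = l'.
Proof. intros H H'. now rewrite <- (is_C_derive_unique f x l H), <- (is_C_derive_unique f x l' H'). Qed.

(* The codomain [C] may be normed as a module or as an absolute ring. *)
Lemma is_derive_AbsRing (f : C -> C) (x l : C) :
  is_derive (V := AbsRing_NormedModule C_AbsRing) f x l <-> is_derive f x l.
Proof. split; intros [_ H]; (split; [apply (is_linear_scal_l (K := C_AbsRing))|exact H]). Qed.

Lemma is_derive_Cconst (c x : C) : is_derive (fun _ => c) x (RtoC 0).
Proof. exact (is_derive_const c x). Qed.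

Lemma is_derive_Cid (x : C) : is_derive (fun y : C => y) x (RtoC 1).
Proof. apply is_derive_AbsRing, (is_derive_id (K := C_AbsRing)). Qed.

Lemma is_derive_Cplus (f g : C -> C) (x l m : C) :
  is_derive f x l -> is_derive g x m -> is_derive (fun y => f y + g y) x (l + m).
Proof. exact (is_derive_plus f g x l m). Qed.

Lemma is_derive_Cminus (f g : C -> C) (x l m : C) :
  is_derive f x l -> is_derive g x m -> is_derive (fun y => f y - g y) x (l - m).
Proof. exact (is_derive_minus f g x l m). Qed.

Lemma is_derive_Cmult (f g : C -> C) (x l m : C) :
  is_derive f x l -> is_derive g x m -> is_derive (fun y => f y * g y) x (l * g x + f x * m).
Proof.
  rewrite <- !is_derive_AbsRing. intros Hf Hg.
  exact (is_derive_mult (K := C_AbsRing) f g x l m Hf Hg Cmult_comm).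
Qed.

Lemma is_derive_Cscal (c : C) (f : C -> C) (x l : C) : is_derive f x l -> is_derive (fun y => c * f y) x (c * l).
Proof.
  intros H. eapply is_derive_eq; [apply is_derive_Cmult; [apply is_derive_Cconst|exact H]|]. simpl. ring.
Qed.

Lemma is_derive_Copp (f : C -> C) (x l : C) : is_derive f x l -> is_derive (fun y => - f y) x (- l).
Proof. exact (is_derive_opp f x l). Qed.

Lemma is_derive_Ccomp (f g : C -> C) (x l m : C) :
  is_derive f (g x) l -> is_derive g x m -> is_derive (fun y => f (g y)) x (m * l).
Proof.
  rewrite <- (is_derive_AbsRing g). exact (is_derive_comp f g x l m).
Qed.

Lemma locally_Cball (x : C) (d : R) : (0 < d)%R ->
  locally (T := AbsRing_UniformSpace C_AbsRing) x (fun y => (Cmod (y - x) < d)%R).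
Proof. intros Hd. exists (mkposreal d Hd). intros y Hy. exact Hy. Qed.

Lemma is_derive_Cext_loc (f g : C -> C) (x l : C) (d : R) : (0 < d)%R ->
  (forall y, (Cmod (y - x) < d)%R -> f y = g y) -> is_derive f x l -> is_derive g x l.
Proof.
  intros Hd E. apply is_derive_ext_loc. eapply filter_imp; [exact E|]. now apply locally_Cball.
Qed.

Lemma is_Clim_seq_derivable (f : C -> C) (u : nat -> C) (l m : C) :
  is_derive f l m -> is_Clim_seq u l -> is_Clim_seq (fun n => f (u n)) (f l).
Proof.
  intros D H. apply is_Clim_seq_AbsRing in H.
  apply (filterlim_comp _ _ _ u f _ _ _ H (ex_derive_continuous f l (ex_intro _ m D))).
Qed.

Lemma is_derive_quadratic_remainder (f : C -> C) (x l : C) (d K : R) : (0 < d)%R -> (0 <= K)%R ->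
  (forall h, (Cmod h <= d)%R -> (Cmod (f (x + h) - f x - h * l)%C <= K * Cmod h ^ 2)%R) -> is_derive f x l.
Proof.
  intros Hd HK H. split; [apply (is_linear_scal_l l)|].
  intros y Hy eps. rewrite <- (is_filter_lim_locally_unique (V := AbsRing_NormedModule C_AbsRing) x y Hy).
  assert (He : (0 < eps / (K + 1))%R) by (apply Rdiv_lt_0_compat; [apply cond_pos|lra]).
  eapply filter_imp; [|apply (locally_Cball x _ (Rmin_pos _ _ Hd He))]. intros z Hz. change C in z.
  change (Cmod ((f z - f x) - (z - x) * l) <= eps * Cmod (z - x))%R.
  pose proof (Rmin_l d (eps / (K + 1))). pose proof (Rmin_r d (eps / (K + 1))).
  specialize (H (z - x) ltac:(lra)). replace (x + (z - x)) with z in H by ring.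
  eapply Rle_trans; [exact H|]. pose proof (Cmod_ge_0 (z - x)).
  assert (Cmod (z - x) * (K + 1) <= eps)%R by (apply Rle_div_r; lra).
  simpl pow. nra.
Qed.

Lemma is_derive_remainder (f : C -> C) (x l : C) (eps : R) : (0 < eps)%R -> is_derive f x l ->
  exists d : R, (0 < d)%R /\
    forall h, (Cmod h < d)%R -> (Cmod (f (x + h) - f x - h * l)%C <= eps * Cmod h)%R.
Proof.
  intros He [_ H]. destruct (H x (fun P HP => HP) (mkposreal eps He)) as [d Hd].
  exists d. split; [apply cond_pos|]. intros h Hh.
  assert (E : x + h - x = h) by ring.
  assert (Hball : (Cmod (x + h - x) < d)%R) by now rewrite E.
  pose proof (Hd (x + h) Hball) as B.
  change (Cmod (f (x + h) - f x - (x + h - x) * l)%C <= eps * Cmod (x + h - x))%R in B. now rewrite E in B.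
Qed.

Lemma eq_is_Cderive (f : C -> C) (a b : C) :
  (forall t : R, (0 <= t <= 1)%R -> is_derive f (a + t * (b - a)) (RtoC 0)) -> f a = f b.
Proof.
  intros H. pose proof (Cmod_ge_0 (b - a)) as Hab.
  pose proof (eq_is_derive (V := C_R_NormedModule) (fun t : R => f (a + t * (b - a))) 0 1) as E.
  cbv beta in E. replace (a + 0 * (b - a)) with a in E by ring.
  replace (a + 1 * (b - a)) with b in E by ring. apply E; [|lra]. clear E.
  intros t Ht. split; [apply (is_linear_scal_l (K := R_AbsRing))|].
  intros s Hs eps. rewrite <- (is_filter_lim_locally_unique (V := AbsRing_NormedModule R_AbsRing) t s Hs).
  assert (He : (0 < eps / (Cmod (b - a) + 1))%R) by (apply Rdiv_lt_0_compat; [apply cond_pos|lra]).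
  destruct (is_derive_remainder f _ _ _ He (H t Ht)) as (d & Hd & B).
  assert (Hd' : (0 < d / (Cmod (b - a) + 1))%R) by (apply Rdiv_lt_0_compat; lra).
  exists (mkposreal _ Hd'). intros u Hu. change (Rabs (u - t) < d / (Cmod (b - a) + 1))%R in Hu.
  apply Rlt_div_r in Hu; [|lra].
  assert (Em : Cmod ((u - t)%R * (b - a)) = (Rabs (u - t) * Cmod (b - a))%R) by now rewrite Cmod_mult, Cmod_R.
  specialize (B ((u - t)%R * (b - a))). rewrite Em in B. pose proof (Rabs_pos (u - t)).
  specialize (B ltac:(nra)).
  replace (a + t * (b - a) + (u - t)%R * (b - a)) with (a + u * (b - a)) in B by (rewrite RtoC_minus; ring).
  replace (f (a + u * (b - a)) - f (a + t * (b - a)) - (u - t)%R * (b - a) * 0)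
    with (f (a + u * (b - a)) - f (a + t * (b - a))) in B by ring.
  replace (minus _ _) with (f (a + u * (b - a)) - f (a + t * (b - a)))
    by (symmetry; etransitivity; [apply f_equal, (scal_zero_r (V := C_R_ModuleSpace))|apply (minus_zero_r (G :=
      C_AbelianGroup))]).
  change (norm (minus u t)) with (Rabs (u - t)).
  rewrite <- Cmod_norm. eapply Rle_trans; [exact B|].
  pose proof (cond_pos eps). unfold Rdiv. rewrite Rmult_assoc. apply Rmult_le_compat_l; [lra|].
  apply Rmult_le_reg_l with (Cmod (b - a) + 1)%R; [lra|].
  rewrite <- Rmult_assoc, Rinv_r, Rmult_1_l by lra. nra.
Qed.

Lemma is_derive_CSeries (f : nat -> C -> C) (l : nat -> C) (x : C) (d : R) (K : nat -> R) :
  (0 < d)%R -> ex_series K -> (forall n, (0 <= K n)%R) ->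
  (forall h, (Cmod h <= d)%R -> abs_summable (fun n => f n (x + h))) -> abs_summable l ->
  (forall n h, (Cmod h <= d)%R -> (Cmod (f n (x + h) - f n x - h * l n)%C <= K n * Cmod h ^ 2)%R) ->
  is_derive (fun y => CSeries (fun n => f n y)) x (CSeries l).
Proof.
  intros Hd HK HK0 Hf Hl H.
  apply is_derive_quadratic_remainder with d (Series K); [assumption|now apply Series_nonneg|].
  intros h Hh. assert (Hx : abs_summable (fun n => f n x)).
  { apply (abs_summable_ext (fun n => f n (x + 0))); [intros; f_equal; ring|]. apply Hf. rewrite Cmod_0. lra. }
  rewrite <- CSeries_minus, <- CSeries_scal, <- CSeries_minus;
    [|apply abs_summable_minus|apply abs_summable_scal| | |]; auto.
  rewrite <- Series_scal_r. apply Cmod_CSeries_le; [intros; now apply H|]. now apply ex_series_scal_r.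
Qed.

Lemma is_derive_Cinv (x : C) : x <> 0 -> is_derive (fun y => / y) x (- / (x * x)).
Proof.
  intros Hx. assert (Hm : (0 < Cmod x)%R) by now apply Cmod_gt_0.
  apply is_derive_quadratic_remainder with (Cmod x / 2)%R (2 / Cmod x ^ 3)%R;
    [lra|apply Rlt_le, Rdiv_lt_0_compat; [lra|now apply pow_lt]|]. intros h Hh.
  assert (Hxh : (Cmod x / 2 <= Cmod (x + h))%R).
  { replace (x + h) with (x - - h) by ring. pose proof (Cmod_minus_ge x (- h)) as B. rewrite Cmod_opp in B. lra. }
  assert (x + h <> 0) by (apply Cmod_gt_0; lra).
  replace (/ (x + h) - / x - h * - / (x * x)) with (h * h * / (x * x * (x + h))) by (field; now split).
  rewrite Cmod_mult, Cmod_mult, Cmod_inv by (repeat apply Cmult_neq_0; assumption).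
  rewrite !Cmod_mult.
  replace (2 / Cmod x ^ 3 * Cmod h ^ 2)%R with (Cmod h * Cmod h * / (Cmod x * Cmod x * (Cmod x / 2)))%R by (field; lra).
  apply Rmult_le_compat_l; [pose proof (Cmod_ge_0 h); nra|].
  apply Rinv_le_contravar; [repeat apply Rmult_lt_0_compat; lra|]. apply Rmult_le_compat_l; [nra|assumption].
Qed.

Lemma is_Clim_seq_inv u (l : C) : l <> 0 -> is_Clim_seq u l -> is_Clim_seq (fun n => / u n) (/ l).
Proof. intros Hl. exact (is_Clim_seq_derivable (fun y => / y) u l _ (is_derive_Cinv l Hl)). Qed.

(** * The exponential function *)

Lemma cexp_plus a b : cexp (a + b) = cexp a * cexp b.
Proof.
  unfold cexp. change (Re (a + b)) with (Re a + Re b)%R. change (Im (a + b)) with (Im a + Im b)%R.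
  rewrite exp_plus, cos_plus, sin_plus. unfold Cmult, fst, snd. f_equal; ring.
Qed.

Lemma cexp_0 : cexp 0 = 1.
Proof. unfold cexp, RtoC; simpl. rewrite exp_0, cos_0, sin_0. f_equal; ring. Qed.

Lemma cexp_neq0 a : cexp a <> 0.
Proof.
  intros H. apply C1_nz. rewrite <- cexp_0. replace (RtoC 0) with (a + - a) at 1 by ring.
  rewrite cexp_plus, H. ring.
Qed.

Lemma cexp_opp a : cexp (- a) = / cexp a.
Proof.
  pose proof (cexp_neq0 a). apply (Cmult_reg_l (cexp a)); [assumption|].
  rewrite <- cexp_plus. replace (a + - a) with (RtoC 0) by ring. rewrite cexp_0. now field.
Qed.

Lemma cexp_INR n a : cexp (INR n * a) = cexp a ^ n.
Proof.
  induction n as [|n IH].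
  - simpl. replace (0 * a) with (RtoC 0) by ring. apply cexp_0.
  - rewrite S_INR, RtoC_plus. replace ((INR n + 1) * a) with (a + INR n * a) by ring.
    now rewrite cexp_plus, IH, Cpow_S.
Qed.

Lemma Cmod_cexp a : Cmod (cexp a) = exp (Re a).
Proof.
  unfold Cmod, cexp; simpl.
  replace (exp (Re a) * cos (Im a) * (exp (Re a) * cos (Im a) * 1) +
     exp (Re a) * sin (Im a) * (exp (Re a) * sin (Im a) * 1))%R with
    (exp (Re a) * exp (Re a) * (Rsqr (sin (Im a)) + Rsqr (cos (Im a))))%R by (unfold Rsqr; ring).
  rewrite sin2_cos2, Rmult_1_r. apply sqrt_square, Rlt_le, exp_pos.
Qed.

Lemma exp_le_compat x y : (x <= y)%R -> (exp x <= exp y)%R.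
Proof. intros [H| ->]; [apply Rlt_le; now apply exp_increasing|lra]. Qed.

Lemma exp_INR_mult n x : exp (INR n * x) = (exp x ^ n)%R.
Proof.
  induction n as [|n IH]; [simpl; rewrite Rmult_0_l; apply exp_0|].
  rewrite S_INR, Rmult_plus_distr_r, exp_plus, IH, Rmult_1_l. simpl. ring.
Qed.

Lemma exp_le_2 a : (a <= 1 / 2)%R -> (exp a <= 2)%R.
Proof.
  intros Ha. pose proof (exp_ineq1_le (- a)) as H. rewrite exp_Ropp in H. pose proof (exp_pos a).
  apply (Rmult_le_compat_r (exp a)) in H; [|lra]. rewrite Rinv_l in H by lra. nra.
Qed.

Lemma Rabs_exp_minus_le a : (Rabs a <= 1 / 2)%R -> (Rabs (exp a - 1 - a) <= 2 * a ^ 2)%R.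
Proof.
  intros Ha. apply Rabs_le_between in Ha.
  pose proof (exp_ineq1_le a). pose proof (exp_ineq1_le (- a)) as L. rewrite exp_Ropp in L. pose proof (exp_pos a).
  apply (Rmult_le_compat_r (exp a)) in L; [|lra]. rewrite Rinv_l in L by lra.
  rewrite Rabs_pos_eq by lra. nra.
Qed.

Lemma Rabs_sin_le x : (Rabs (sin x) <= Rabs x)%R.
Proof.
  destruct (MVT_gen sin 0 x cos) as (c & _ & E).
  - intros t _. apply is_derive_Reals, derivable_pt_lim_sin.
  - intros t _. apply continuity_sin.
  - rewrite sin_0, !Rminus_0_r in E. rewrite E, Rabs_mult. pose proof (Rabs_pos x).
    assert (Rabs (cos c) <= 1)%R by (apply Rabs_le; split; apply COS_bound). nra.
Qed.

Lemma Rabs_cos_minus_le x : (Rabs (cos x - 1) <= x ^ 2)%R.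
Proof.
  replace x with (2 * (x / 2))%R at 1 by field. rewrite cos_2a_sin.
  replace (1 - 2 * sin (x / 2) * sin (x / 2) - 1)%R with (- (2 * sin (x / 2) ^ 2))%R by ring.
  rewrite Rabs_Ropp, Rabs_pos_eq by (pose proof (pow2_ge_0 (sin (x / 2))); lra).
  rewrite <- (pow2_abs (sin (x / 2))), <- (pow2_abs x).
  pose proof (Rabs_sin_le (x / 2)) as H. pose proof (Rabs_pos (sin (x / 2))).
  unfold Rdiv in *. rewrite Rabs_mult, (Rabs_pos_eq (/ 2)) in H by lra. nra.
Qed.

Lemma Rabs_sin_minus_le x : (Rabs x <= 1)%R -> (Rabs (sin x - x) <= x ^ 2)%R.
Proof.
  intros Hx.
  destruct (MVT_gen (fun t => sin t - t)%R 0 x (fun t => cos t - 1)%R) as (c & Hc & E).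
  - intros t _. apply (is_derive_minus (V := R_NormedModule) sin (fun t => t)).
    + apply is_derive_Reals, derivable_pt_lim_sin.
    + apply (is_derive_id (K := R_AbsRing)).
  - intros t _. apply continuity_pt_minus; [apply continuity_sin|].
    apply derivable_continuous_pt, derivable_pt_id.
  - rewrite sin_0, !Rminus_0_r in E. rewrite E, Rabs_mult.
    pose proof (Rabs_cos_minus_le c) as Q. rewrite <- (pow2_abs c) in Q. rewrite <- (pow2_abs x).
    assert (Rabs c <= Rabs x)%R.
    { unfold Rmin, Rmax in Hc. destruct (Rle_dec 0 x).
      - rewrite !Rabs_pos_eq by lra. lra.
      - rewrite !Rabs_left1 by lra. lra. }
    pose proof (Rabs_pos c). pose proof (Rabs_pos x). pose proof (Rabs_pos (cos c - 1)). nra.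
Qed.

Lemma Cmod_le_Re_Im (z : C) : (Cmod z <= Rabs (Re z) + Rabs (Im z))%R.
Proof.
  replace z with (RtoC (Re z) + Ci * RtoC (Im z)) at 1.
  - eapply Rle_trans; [apply Cmod_triangle|]. rewrite Cmod_mult, Cmod_Ci, !Cmod_R. lra.
  - destruct z as [a b]. unfold Cmult, Cplus, RtoC, Ci; simpl. f_equal; ring.
Qed.

Lemma Cmod_cexp_minus_le h : (Cmod h <= 1 / 2)%R -> (Cmod (cexp h - 1 - h)%C <= 10 * Cmod h ^ 2)%R.
Proof.
  intros Hh. pose proof (re_le_Cmod h) as Ha. pose proof (im_le_Cmod h) as Hb.
  set (a := Re h) in *. set (b := Im h) in *. set (m := Cmod h) in *.
  pose proof (Rabs_exp_minus_le a ltac:(lra)) as E1. pose proof (Rle_abs a).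
  pose proof (exp_le_2 a ltac:(lra)) as E2.
  pose proof (Rabs_cos_minus_le b) as E3. pose proof (Rabs_sin_minus_le b ltac:(lra)) as E4.
  eapply Rle_trans; [apply Cmod_le_Re_Im|].
  replace (Re (cexp h - 1 - h)) with ((exp a - 1 - a) + exp a * (cos b - 1))%R
    by (symmetry; transitivity (exp a * cos b + - (1) + - a)%R; [reflexivity|ring]).
  replace (Im (cexp h - 1 - h)) with (exp a * (sin b - b) + ((exp a - 1 - a) + a) * b)%R
    by (symmetry; transitivity (exp a * sin b + - (0) + - b)%R; [reflexivity|ring]).
  pose proof (exp_pos a). pose proof (Rabs_pos a). pose proof (Rabs_pos b).
  rewrite <- (pow2_abs a) in E1. rewrite <- (pow2_abs b) in E3, E4.
  assert (Rabs a ^ 2 <= m ^ 2)%R by (apply pow_incr; lra).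
  assert (Rabs b ^ 2 <= m ^ 2)%R by (apply pow_incr; lra).
  assert (Rabs a * Rabs b <= m ^ 2)%R by (simpl; rewrite Rmult_1_r; apply Rmult_le_compat; lra).
  pose proof (Rabs_triang (exp a - 1 - a) (exp a * (cos b - 1))) as T1.
  pose proof (Rabs_triang (exp a * (sin b - b)) (((exp a - 1 - a) + a) * b)) as T2.
  pose proof (Rabs_triang (exp a - 1 - a) a) as T3.
  rewrite Rabs_mult, (Rabs_pos_eq (exp a)) in T1 by lra.
  rewrite !Rabs_mult, (Rabs_pos_eq (exp a)) in T2 by lra.
  assert (exp a * Rabs (cos b - 1) <= 2 * m ^ 2)%R by (pose proof (Rabs_pos (cos b - 1)); nra).
  assert (exp a * Rabs (sin b - b) <= 2 * m ^ 2)%R by (pose proof (Rabs_pos (sin b - b)); nra).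
  assert (Rabs (exp a - 1 - a + a) * Rabs b <= 2 * m ^ 2)%R.
  { apply Rle_trans with ((2 * Rabs a ^ 2 + Rabs a) * Rabs b)%R; [apply Rmult_le_compat_r; lra|].
    assert (Rabs a ^ 2 <= Rabs a / 2)%R by (simpl; nra). nra. }
  pose proof (pow2_ge_0 m). lra.
Qed.

Lemma is_derive_cexp (x : C) : is_derive cexp x (cexp x).
Proof.
  pose proof (Cmod_ge_0 (cexp x)).
  apply is_derive_quadratic_remainder with (1 / 2)%R (10 * Cmod (cexp x))%R; [lra|lra|].
  intros h Hh. rewrite cexp_plus.
  replace (cexp x * cexp h - cexp x - h * cexp x) with (cexp x * (cexp h - 1 - h)) by ring.
  rewrite Cmod_mult. pose proof (Cmod_cexp_minus_le h Hh). nra.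
Qed.

(** * Power series *)

Lemma Cmod_Cpow_plus_minus_le (x h : C) (d : R) n : (0 < d)%R -> (Cmod h <= d)%R ->
  (Cmod ((x + h) ^ n - x ^ n)%C <= Cmod h / d * (Cmod x + d) ^ n)%R.
Proof.
  intros Hd Hh. pose proof (Cmod_ge_0 x). pose proof (Cmod_ge_0 h).
  assert (0 <= Cmod h / d)%R by (apply Rmult_le_pos; [lra|apply Rlt_le, Rinv_0_lt_compat; lra]).
  assert (Eh : Cmod h = (Cmod h / d * d)%R) by (field; lra).
  induction n as [|n IH].
  - simpl. replace (1 - 1) with (RtoC 0) by ring. rewrite Cmod_0. lra.
  - rewrite !Cpow_S. replace ((x + h) * (x + h) ^ n - x * x ^ n) with
      (x * ((x + h) ^ n - x ^ n) + h * (x + h) ^ n) by ring.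
    eapply Rle_trans; [apply Cmod_triangle|]. rewrite !Cmod_mult, Cmod_pow.
    assert (Cmod (x + h) ^ n <= (Cmod x + d) ^ n)%R.
    { apply pow_incr. split; [apply Cmod_ge_0|]. pose proof (Cmod_triangle x h). lra. }
    apply Rle_trans with (Cmod x * (Cmod h / d * (Cmod x + d) ^ n) + Cmod h * (Cmod x + d) ^ n)%R.
    + apply Rplus_le_compat; apply Rmult_le_compat_l; assumption.
    + rewrite Eh at 2. apply Req_le. simpl. ring.
Qed.

Lemma Cmod_Cpow_taylor1_le (x h : C) (d : R) n : (0 < d)%R -> (Cmod h <= d)%R ->
  (Cmod ((x + h) ^ n - x ^ n - h * (INR n * x ^ (n - 1)))%C <= (Cmod h / d) ^ 2 * (Cmod x + d) ^ n)%R.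
Proof.
  intros Hd Hh. pose proof (Cmod_ge_0 x). pose proof (Cmod_ge_0 h).
  assert (Eh : Cmod h = (Cmod h / d * d)%R) by (field; lra).
  induction n as [|n IH].
  - simpl. replace (1 - 1 - h * (0 * 1)) with (RtoC 0) by ring. rewrite Cmod_0.
    pose proof (pow2_ge_0 (Cmod h / d)). nra.
  - replace ((x + h) ^ S n - x ^ S n - h * (INR (S n) * x ^ (S n - 1))) with
      (x * ((x + h) ^ n - x ^ n - h * (INR n * x ^ (n - 1))) + h * ((x + h) ^ n - x ^ n)).
    2:{ rewrite S_INR, RtoC_plus. destruct n as [|n].
        - simpl. ring.
        - replace (S (S n) - 1)%nat with (S n) by lia. replace (S n - 1)%nat with n by lia.
          rewrite !Cpow_S. ring. }
    eapply Rle_trans; [apply Cmod_triangle|]. rewrite !Cmod_mult.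
    pose proof (Cmod_Cpow_plus_minus_le x h d n Hd Hh) as L.
    apply Rle_trans with (Cmod x * ((Cmod h / d) ^ 2 * (Cmod x + d) ^ n) + Cmod h * (Cmod h / d * (Cmod x + d) ^ n))%R.
    + apply Rplus_le_compat; apply Rmult_le_compat_l; assumption.
    + rewrite Eh at 2. simpl. apply Req_le. ring.
Qed.

Lemma INR_mult_pow_le (a d : R) n : (0 <= a)%R -> (0 < d)%R -> (INR n * a ^ (n - 1) * d <= (a + d) ^ n)%R.
Proof.
  intros Ha Hd. induction n as [|n IH]; [simpl; lra|].
  rewrite S_INR. destruct n as [|n]; [simpl; lra|].
  replace (S (S n) - 1)%nat with (S n) by lia. replace (S n - 1)%nat with n in IH by lia.
  assert (a ^ S n <= (a + d) ^ S n)%R by (apply pow_incr; lra).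
  change ((a + d) ^ S (S n))%R with ((a + d) * (a + d) ^ S n)%R.
  assert (INR (S n) * a ^ S n * d <= a * (a + d) ^ S n)%R.
  { replace (INR (S n) * a ^ S n * d)%R with (a * (INR (S n) * a ^ n * d))%R by (simpl; ring).
    apply Rmult_le_compat_l; assumption. }
  nra.
Qed.

Definition CPSeries (c : nat -> C) (x : C) : C := CSeries (fun n => c n * x ^ n).
Definition CPS_derive (c : nat -> C) (n : nat) : C := INR (S n) * c (S n).

Lemma abs_summable_pow_le c x y : (Cmod x <= Cmod y)%R ->
  abs_summable (fun n => c n * y ^ n) -> abs_summable (fun n => c n * x ^ n).
Proof.
  intros Hxy. apply abs_summable_le. intros n. rewrite !Cmod_mult, !Cmod_pow.
  apply Rmult_le_compat_l; [apply Cmod_ge_0|]. apply pow_incr. split; [apply Cmod_ge_0|assumption].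
Qed.

Lemma abs_summable_CPS_derive c x y : (Cmod x < Cmod y)%R ->
  abs_summable (fun n => c n * y ^ n) -> abs_summable (fun n => CPS_derive c n * x ^ n).
Proof.
  intros Hxy H. pose proof (Cmod_ge_0 x) as H0. set (d := (Cmod y - Cmod x)%R).
  assert (Hd : (0 < d)%R) by (unfold d; lra).
  apply abs_summable_le with (fun n => / d * Cmod (c (S n) * y ^ S n))%R.
  - intros n. unfold CPS_derive. rewrite !Cmod_mult, Cmod_INR, !Cmod_pow.
    pose proof (INR_mult_pow_le (Cmod x) d (S n) H0 Hd) as B.
    replace (S n - 1)%nat with n in B by lia. replace (Cmod x + d)%R with (Cmod y) in B by (unfold d; ring).
    apply (Rmult_le_compat_l (/ d * Cmod (c (S n)))) in B.
    2:{ apply Rmult_le_pos; [apply Rlt_le, Rinv_0_lt_compat; lra|apply Cmod_ge_0]. }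
    rewrite <- (Rmult_assoc (/ d)). eapply Rle_trans; [|exact B]. apply Req_le. field. lra.
  - apply (ex_series_scal_l (/ d)%R (fun n => Cmod (c (S n) * y ^ S n))).
    now apply (ex_series_incr_1 (fun n => Cmod (c n * y ^ n))).
Qed.

Lemma CPSeries_CPS_derive c x : abs_summable (fun n => CPS_derive c n * x ^ n) ->
  abs_summable (fun n => INR n * (c n * x ^ (n - 1))) /\
  CSeries (fun n => INR n * (c n * x ^ (n - 1))) = CPSeries (CPS_derive c) x.
Proof.
  intros H.
  assert (E : forall n, CPS_derive c n * x ^ n = INR (S n) * (c (S n) * x ^ (S n - 1))).
  { intros n. unfold CPS_derive. replace (S n - 1)%nat with n by lia. ring. }
  assert (Hs : abs_summable (fun n => INR n * (c n * x ^ (n - 1)))).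
  { apply (abs_summable_incr_n _ 1). eapply abs_summable_ext; [exact E|exact H]. }
  split; [exact Hs|]. rewrite (CSeries_incr_1 _ Hs). change (INR 0) with 0%R. rewrite Cmult_0_l, Cplus_0_l.
  apply CSeries_ext. intros n. now rewrite E.
Qed.

Lemma is_derive_CPSeries c x y : (Cmod x < Cmod y)%R -> abs_summable (fun n => c n * y ^ n) ->
  is_derive (CPSeries c) x (CPSeries (CPS_derive c) x).
Proof.
  intros Hxy H. set (d := (Cmod y - Cmod x)%R). assert (Hd : (0 < d)%R) by (unfold d; lra).
  destruct (CPSeries_CPS_derive c x (abs_summable_CPS_derive c x y Hxy H)) as [Hs <-].
  apply is_derive_CSeries with d (fun n => / d ^ 2 * Cmod (c n * y ^ n))%R; try assumption.
  - now apply (ex_series_scal_l (/ d ^ 2)%R (fun n => Cmod (c n * y ^ n))).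
  - intros n. apply Rmult_le_pos; [|apply Cmod_ge_0]. now apply Rlt_le, Rinv_0_lt_compat, pow_lt.
  - intros h Hh. apply abs_summable_pow_le with y; [|exact H].
    pose proof (Cmod_triangle x h). unfold d in Hh. lra.
  - intros n h Hh.
    replace (c n * (x + h) ^ n - c n * x ^ n - h * (INR n * (c n * x ^ (n - 1)))) with
      (c n * ((x + h) ^ n - x ^ n - h * (INR n * x ^ (n - 1)))) by ring.
    rewrite !Cmod_mult, (Cmod_pow y). pose proof (Cmod_Cpow_taylor1_le x h d n Hd Hh) as Q.
    replace (Cmod x + d)%R with (Cmod y) in Q by (unfold d; ring).
    apply (Rmult_le_compat_l (Cmod (c n))) in Q; [|apply Cmod_ge_0].
    eapply Rle_trans; [exact Q|]. apply Req_le. field. lra.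
Qed.

Definition cvg_unit_disk (c : nat -> C) : Prop :=
  forall x, (Cmod x < 1)%R -> abs_summable (fun n => c n * x ^ n).

Lemma ex_Cmod_between (x : C) : (Cmod x < 1)%R -> exists y : C, (Cmod x < Cmod y < 1)%R.
Proof.
  intros H. exists (RtoC ((1 + Cmod x) / 2)). pose proof (Cmod_ge_0 x). rewrite Cmod_R, Rabs_pos_eq; lra.
Qed.

Lemma is_derive_CPSeries_unit_disk c x : cvg_unit_disk c -> (Cmod x < 1)%R ->
  is_derive (CPSeries c) x (CPSeries (CPS_derive c) x).
Proof.
  intros Hc Hx. destruct (ex_Cmod_between x Hx) as [y Hy]. apply (is_derive_CPSeries c x y); [lra|]. apply Hc; lra.
Qed.

Lemma cvg_unit_disk_CPS_derive c : cvg_unit_disk c -> cvg_unit_disk (CPS_derive c).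
Proof.
  intros Hc x Hx. destruct (ex_Cmod_between x Hx) as [y Hy].
  apply (abs_summable_CPS_derive c x y); [lra|]. apply Hc; lra.
Qed.

Lemma CPSeries_ext c c' x : (forall n, c n = c' n) -> CPSeries c x = CPSeries c' x.
Proof. intros E. apply CSeries_ext. intros n. now rewrite E. Qed.

Lemma CPSeries_at_0 c : CPSeries c 0 = c O.
Proof.
  unfold CPSeries. rewrite (CSeries_fin _ 1); [simpl; ring|]. intros [|n] Hn; [lia|]. simpl. ring.
Qed.

Lemma cvg_unit_disk_plus a b : cvg_unit_disk a -> cvg_unit_disk b -> cvg_unit_disk (fun n => a n + b n).
Proof.
  intros Ha Hb x Hx. apply abs_summable_ext with (fun n => a n * x ^ n + b n * x ^ n); [intros; ring|].
  apply abs_summable_plus; auto.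
Qed.

Lemma cvg_unit_disk_scal s a : cvg_unit_disk a -> cvg_unit_disk (fun n => s * a n).
Proof.
  intros Ha x Hx. apply abs_summable_ext with (fun n => s * (a n * x ^ n)); [intros; ring|].
  apply abs_summable_scal. auto.
Qed.

Lemma CPSeries_plus a b x : cvg_unit_disk a -> cvg_unit_disk b -> (Cmod x < 1)%R ->
  CPSeries (fun n => a n + b n) x = CPSeries a x + CPSeries b x.
Proof.
  intros Ha Hb Hx. unfold CPSeries. rewrite <- CSeries_plus by auto. apply CSeries_ext. intros; ring.
Qed.

Lemma CPSeries_scal s a x : cvg_unit_disk a -> (Cmod x < 1)%R -> CPSeries (fun n => s * a n) x = s * CPSeries a x.
Proof.
  intros Ha Hx. unfold CPSeries. rewrite <- CSeries_scal by auto. apply CSeries_ext. intros; ring.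
Qed.

Definition CPS_incr_n (a : nat -> C) (k n : nat) : C := if (n <? k)%nat then 0 else a (n - k)%nat.

Lemma CPS_incr_n_lt a k n : (n < k)%nat -> CPS_incr_n a k n = 0.
Proof. intros H. unfold CPS_incr_n. now rewrite (proj2 (Nat.ltb_lt _ _)) by lia. Qed.

Lemma CPS_incr_n_add a k n : CPS_incr_n a k (k + n) = a n.
Proof. unfold CPS_incr_n. rewrite (proj2 (Nat.ltb_ge _ _)) by lia. f_equal. lia. Qed.

Lemma abs_summable_CPS_incr_n a k : abs_summable (CPS_incr_n a k) <-> abs_summable a.
Proof.
  rewrite <- (abs_summable_incr_n (CPS_incr_n a k) k).
  split; apply abs_summable_ext; intros n; [|symmetry]; apply CPS_incr_n_add.
Qed.

Lemma is_series_CPS_incr_n a k (l : C) : is_series a l -> is_series (CPS_incr_n a k) l.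
Proof.
  intros H. apply (is_series_incr_0 _ k); [intros; now apply CPS_incr_n_lt|].
  eapply is_series_Cext; [|exact H]. intros n. now rewrite CPS_incr_n_add.
Qed.

Lemma l1norm_CPS_incr_n a k : l1norm (CPS_incr_n a k) = l1norm a.
Proof.
  unfold l1norm. rewrite (Series_incr_n_aux _ k).
  - apply Series_ext. intros n. now rewrite CPS_incr_n_add.
  - intros n Hn. rewrite CPS_incr_n_lt, Cmod_0 by assumption. reflexivity.
Qed.

Lemma CPS_incr_n_pow a k x n : CPS_incr_n a k n * x ^ n = x ^ k * CPS_incr_n (fun j => a j * x ^ j) k n.
Proof.
  unfold CPS_incr_n. destruct (Nat.ltb_spec n k) as [|H]; [ring|].
  replace n with (k + (n - k))%nat at 2 by lia. rewrite Cpow_add_r. ring.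
Qed.

Lemma cvg_unit_disk_CPS_incr_n a k : cvg_unit_disk a -> cvg_unit_disk (CPS_incr_n a k).
Proof.
  intros Ha x Hx. eapply abs_summable_ext; [intros n; symmetry; apply CPS_incr_n_pow|].
  now apply abs_summable_scal, abs_summable_CPS_incr_n, Ha.
Qed.

Lemma CPSeries_CPS_incr_n a k x : cvg_unit_disk a -> (Cmod x < 1)%R ->
  CPSeries (CPS_incr_n a k) x = x ^ k * CPSeries a x.
Proof.
  intros Ha Hx. unfold CPSeries at 1. rewrite (CSeries_ext _ _ (CPS_incr_n_pow a k x)).
  apply CSeries_unique, is_series_Cscal, is_series_CPS_incr_n, CSeries_correct. now apply Ha.
Qed.

Definition CPS_mult (a b : nat -> C) (n : nat) : C := Csum (fun k => a k * b (n - k)%nat) (S n).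

Section CauchyProduct.

Variables a b : nat -> C.
Hypothesis Ha : abs_summable a.
Hypothesis Hb : abs_summable b.

Let row_summable m : abs_summable (fun n => a m * CPS_incr_n b m n).
Proof. now apply abs_summable_scal, abs_summable_CPS_incr_n. Qed.

Let rows_norms : ex_series (fun m => l1norm (fun n => a m * CPS_incr_n b m n)).
Proof.
  apply ex_series_ext with (fun m => Cmod (a m) * l1norm b)%R; [|now apply ex_series_scal_r].
  intros m. now rewrite l1norm_scal, l1norm_CPS_incr_n.
Qed.

Let column_sum n : CSeries (fun m => a m * CPS_incr_n b m n) = CPS_mult a b n.
Proof.
  rewrite (CSeries_fin _ (S n)) by (intros; rewrite CPS_incr_n_lt by lia; ring).
  apply Csum_ext. intros k Hk. unfold CPS_incr_n. now rewrite (proj2 (Nat.ltb_ge _ _)) by lia.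
Qed.

Lemma abs_summable_CPS_mult : abs_summable (CPS_mult a b).
Proof. eapply abs_summable_ext; [exact column_sum|]. now apply fubini_abs_summable_column_sums. Qed.

Lemma CSeries_CPS_mult : CSeries (CPS_mult a b) = CSeries a * CSeries b.
Proof.
  rewrite <- (CSeries_ext _ _ column_sum), CSeries_switch by assumption.
  rewrite (CSeries_ext _ (fun m => CSeries b * a m)).
  - rewrite CSeries_scal by assumption. ring.
  - intros m. rewrite Cmult_comm. apply CSeries_unique, is_series_Cscal, is_series_CPS_incr_n.
    now apply CSeries_correct.
Qed.

Lemma l1norm_CPS_mult_le : (l1norm (CPS_mult a b) <= l1norm a * l1norm b)%R.
Proof.
  rewrite <- (l1norm_ext _ _ column_sum). eapply Rle_trans; [now apply l1norm_column_sums_le|].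
  unfold l1norm at 2. rewrite <- Series_scal_r. apply Req_le, Series_ext. intros m.
  now rewrite l1norm_scal, l1norm_CPS_incr_n.
Qed.

End CauchyProduct.

Lemma CPS_mult_pow a b x n : CPS_mult (fun k => a k * x ^ k) (fun k => b k * x ^ k) n = CPS_mult a b n * x ^ n.
Proof.
  unfold CPS_mult. rewrite Cmult_comm, <- Csum_scal. apply Csum_ext. intros k Hk.
  replace n with (k + (n - k))%nat at 3 by lia. rewrite Cpow_add_r. ring.
Qed.

Lemma cvg_unit_disk_CPS_mult a b : cvg_unit_disk a -> cvg_unit_disk b -> cvg_unit_disk (CPS_mult a b).
Proof.
  intros Ha Hb x Hx. eapply abs_summable_ext; [apply CPS_mult_pow|]. apply abs_summable_CPS_mult; auto.
Qed.

Lemma CPSeries_CPS_mult a b x : cvg_unit_disk a -> cvg_unit_disk b -> (Cmod x < 1)%R ->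
  CPSeries (CPS_mult a b) x = CPSeries a x * CPSeries b x.
Proof.
  intros Ha Hb Hx. unfold CPSeries. rewrite <- CSeries_CPS_mult by auto.
  apply CSeries_ext. intros n. symmetry. apply CPS_mult_pow.
Qed.

Lemma CPS_mult_0 a b : CPS_mult a b 0 = a O * b O.
Proof. unfold CPS_mult; simpl. ring. Qed.

Definition CPS_one (n : nat) : C := match n with O => 1 | _ => 0 end.

Fixpoint CPS_pow (a : nat -> C) (k : nat) : nat -> C :=
  match k with O => CPS_one | S j => CPS_mult a (CPS_pow a j) end.

Lemma cvg_unit_disk_CPS_one : cvg_unit_disk CPS_one.
Proof. intros x _. apply abs_summable_fin with 1%nat. intros [|n] Hn; [lia|]. simpl. ring. Qed.

Lemma CPSeries_CPS_one x : CPSeries CPS_one x = 1.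
Proof.
  unfold CPSeries. rewrite (CSeries_fin _ 1); [simpl; ring|]. intros [|n] Hn; [lia|]. simpl. ring.
Qed.

Lemma cvg_unit_disk_CPS_pow a k : cvg_unit_disk a -> cvg_unit_disk (CPS_pow a k).
Proof. intros Ha. induction k; simpl; [apply cvg_unit_disk_CPS_one|now apply cvg_unit_disk_CPS_mult]. Qed.

Lemma CPSeries_CPS_pow a k x : cvg_unit_disk a -> (Cmod x < 1)%R -> CPSeries (CPS_pow a k) x = CPSeries a x ^ k.
Proof.
  intros Ha Hx. induction k; simpl; [apply CPSeries_CPS_one|].
  rewrite CPSeries_CPS_mult by (try apply cvg_unit_disk_CPS_pow; assumption). now rewrite IHk.
Qed.

Lemma CPS_pow_0 a k : CPS_pow a k 0 = a O ^ k.
Proof. induction k; simpl; [reflexivity|]. now rewrite CPS_mult_0, IHk. Qed.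

Lemma l1norm_CPS_one x : l1norm (fun n => CPS_one n * x ^ n) = 1%R.
Proof.
  apply is_series_unique, is_series_RtoC.
  replace (RtoC 1) with (Csum (fun n => RtoC (Cmod (CPS_one n * x ^ n))) 1).
  - apply is_series_Cfin. intros [|n] Hn; [lia|]. simpl. now rewrite Cmult_0_l, Cmod_0.
  - simpl. rewrite Cmult_1_l, Cmod_1. ring.
Qed.

Lemma l1norm_CPS_pow_le a k x : cvg_unit_disk a -> (Cmod x < 1)%R ->
  (l1norm (fun n => CPS_pow a k n * x ^ n)%C <= l1norm (fun n => a n * x ^ n)%C ^ k)%R.
Proof.
  intros Ha Hx. induction k as [|k IH]; simpl; [rewrite l1norm_CPS_one; lra|].
  rewrite <- (l1norm_ext _ _ (CPS_mult_pow a (CPS_pow a k) x)).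
  eapply Rle_trans; [apply l1norm_CPS_mult_le; [|apply cvg_unit_disk_CPS_pow]; auto|].
  apply Rmult_le_compat_l; [apply l1norm_nonneg; auto|exact IH].
Qed.

Definition inv_fact (n : nat) : C := RtoC (/ INR (fact n)).

Lemma abs_summable_inv_fact x : abs_summable (fun n => inv_fact n * x ^ n).
Proof.
  exists (exp (Cmod x)). eapply is_series_ext; [|exact (is_exp_Reals (Cmod x))]. intros n. simpl.
  unfold inv_fact. rewrite Cmod_mult, Cmod_pow, Cmod_R, Rabs_pos_eq.
  - rewrite Rmult_comm, pow_n_pow. reflexivity.
  - apply Rlt_le, Rinv_0_lt_compat, INR_fact_lt_0.
Qed.

Lemma is_derive_CPSeries_inv_fact (x : C) : is_derive (CPSeries inv_fact) x (CPSeries inv_fact x).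
Proof.
  eapply is_derive_eq.
  - apply (is_derive_CPSeries inv_fact x (RtoC (Cmod x + 1))); [|apply abs_summable_inv_fact].
    pose proof (Cmod_ge_0 x). rewrite Cmod_R, Rabs_pos_eq; lra.
  - apply CPSeries_ext. intros n. unfold CPS_derive, inv_fact. rewrite <- RtoC_mult. f_equal.
    change (fact (S n)) with (S n * fact n)%nat. rewrite mult_INR. field.
    split; apply not_0_INR; [apply fact_neq_0|lia].
Qed.

(* The derivative of [y -> (sum y^n / n!) * cexp (- y)] vanishes. *)
Lemma cexp_CPSeries w : cexp w = CPSeries inv_fact w.
Proof.
  assert (E : CPSeries inv_fact 0 * cexp (- (0)) = CPSeries inv_fact w * cexp (- w)).
  { apply (eq_is_Cderive (fun x => CPSeries inv_fact x * cexp (- x))). intros t _.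
    eapply is_derive_eq.
    - apply is_derive_Cmult; [apply is_derive_CPSeries_inv_fact|].
      apply (is_derive_Ccomp cexp Copp); [apply is_derive_cexp|apply is_derive_Copp, is_derive_Cid].
    - simpl. ring. }
  rewrite CPSeries_at_0, !cexp_opp, cexp_0 in E. unfold inv_fact at 1 in E. simpl in E.
  rewrite Rinv_1, Cmult_1_l in E. pose proof (cexp_neq0 w).
  replace (CPSeries inv_fact w) with (cexp w * (CPSeries inv_fact w * / cexp w)) by (field; assumption).
  rewrite <- E. field.
Qed.

Definition CPS_exp (a : nat -> C) (n : nat) : C := CSeries (fun k => inv_fact k * CPS_pow a k n).

Section ExpOfPowerSeries.

Variable a : nat -> C.
Hypothesis Ha : cvg_unit_disk a.

Let row_summable x : (Cmod x < 1)%R -> forall k, abs_summable (fun n => inv_fact k * (CPS_pow a k n * x ^ n)).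
Proof. intros Hx k. apply abs_summable_scal. now apply cvg_unit_disk_CPS_pow. Qed.

Let rows_norms x : (Cmod x < 1)%R -> ex_series (fun k => l1norm (fun n => inv_fact k * (CPS_pow a k n * x ^ n))).
Proof.
  intros Hx. apply ex_series_le_nonneg with (fun k => Cmod (inv_fact k * RtoC (l1norm (fun n => a n * x ^ n)) ^ k));
    [|apply abs_summable_inv_fact].
  intros k. split; [apply l1norm_nonneg; now apply row_summable|].
  rewrite l1norm_scal, Cmod_mult, Cmod_pow, Cmod_R, Rabs_pos_eq by (apply l1norm_nonneg; auto).
  apply Rmult_le_compat_l; [apply Cmod_ge_0|]. now apply l1norm_CPS_pow_le.
Qed.

Let coefficient_summable n : abs_summable (fun k => inv_fact k * CPS_pow a k n).
Proof.
  set (x := RtoC (1 / 2)). assert (Hx : (Cmod x < 1)%R) by (unfold x; rewrite Cmod_R, Rabs_pos_eq; lra).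
  assert (Hx0 : x <> 0) by (apply RtoC_neq0; lra). pose proof (Cpow_nz x n Hx0) as Hxn.
  apply abs_summable_ext with (fun k => / x ^ n * (inv_fact k * (CPS_pow a k n * x ^ n))).
  - intros k. field. assumption.
  - apply abs_summable_scal. exact (fubini_abs_summable_column _ (row_summable x Hx) (rows_norms x Hx) n).
Qed.

Let column_sum x n : CSeries (fun k => inv_fact k * (CPS_pow a k n * x ^ n)) = CPS_exp a n * x ^ n.
Proof.
  unfold CPS_exp. rewrite Cmult_comm, <- CSeries_scal by apply coefficient_summable.
  apply CSeries_ext. intros k. ring.
Qed.

Lemma cvg_unit_disk_CPS_exp : cvg_unit_disk (CPS_exp a).
Proof.
  intros x Hx. eapply abs_summable_ext; [apply column_sum|]. apply fubini_abs_summable_column_sums; auto.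
Qed.

Lemma CPSeries_CPS_exp x : (Cmod x < 1)%R -> CPSeries (CPS_exp a) x = cexp (CPSeries a x).
Proof.
  intros Hx. unfold CPSeries at 1. rewrite <- (CSeries_ext _ _ (column_sum x)), CSeries_switch, cexp_CPSeries by auto.
  apply CSeries_ext. intros k. rewrite CSeries_scal by now apply cvg_unit_disk_CPS_pow.
  f_equal. now apply CPSeries_CPS_pow.
Qed.

End ExpOfPowerSeries.

Lemma CPS_exp_0 (a : nat -> C) : a O = 0 -> CPS_exp a 0 = 1.
Proof.
  intros H. unfold CPS_exp. rewrite (CSeries_fin _ 1).
  - simpl. unfold inv_fact. simpl. rewrite Rinv_1. ring.
  - intros [|m] Hm; [lia|]. rewrite CPS_pow_0, H, Cpow_S. ring.
Qed.

(* The coefficients of [x -> sum a(n) x^(k n)]. *)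
Definition dilate (k : nat) (a : nat -> C) (n : nat) : C :=
  if (n mod k =? 0)%nat then a (n / k)%nat else 0.

Lemma dilate_mul k a n : (0 < k)%nat -> dilate k a (k * n) = a n.
Proof.
  intros Hk. unfold dilate. now rewrite Nat.mul_comm, Nat.Div0.mod_mul, Nat.eqb_refl, Nat.div_mul by lia.
Qed.

Lemma dilate_0 k a : (0 < k)%nat -> dilate k a 0 = a O.
Proof. intros Hk. rewrite <- (dilate_mul k a 0 Hk). f_equal. lia. Qed.

Lemma dilate_not_multiple k a n : (n mod k <> 0)%nat -> dilate k a n = 0.
Proof. intros H. unfold dilate. now rewrite (proj2 (Nat.eqb_neq _ _)). Qed.

Lemma dilate_lt k a n : (0 < n < k)%nat -> dilate k a n = 0.
Proof. intros H. apply dilate_not_multiple. rewrite Nat.mod_small; lia. Qed.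

Lemma dilate_elim (P : nat -> C -> Prop) k a : (0 < k)%nat -> (forall n, P (k * n)%nat (a n)) ->
  (forall n, (n mod k <> 0)%nat -> P n 0) -> forall n, P n (dilate k a n).
Proof.
  intros Hk H1 H0 n. destruct (Nat.eq_dec (n mod k) 0) as [E|E].
  - pose proof (Nat.div_mod_eq n k) as Q. rewrite E, Nat.add_0_r in Q. rewrite Q, dilate_mul by assumption. apply H1.
  - rewrite dilate_not_multiple by assumption. now apply H0.
Qed.

Lemma Csum_dilate k a n r : (r < k)%nat -> Csum (dilate k a) (k * n + S r)%nat = Csum a (S n).
Proof.
  assert (Block : forall n r, (r < k)%nat -> Csum (fun j => dilate k a (k * n + j)%nat) (S r) = a n).
  { intros m s Hs. rewrite (Csum_single _ 0), Nat.add_0_r; [apply dilate_mul; lia|lia|].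
    intros j Hj Hj0. apply dilate_not_multiple.
    rewrite Nat.mul_comm, Nat.add_comm, Nat.Div0.mod_add, Nat.mod_small; lia. }
  intros Hr. rewrite Csum_split, Block by assumption. simpl. f_equal.
  induction n as [|n IH]; [now rewrite Nat.mul_0_r|].
  replace (k * S n)%nat with (k * n + S (k - 1))%nat by lia.
  rewrite Csum_split, Block, IH by lia. reflexivity.
Qed.

Lemma is_series_dilate k a (l : C) : (0 < k)%nat -> is_series (dilate k a) l <-> is_series a l.
Proof.
  intros Hk. rewrite !is_series_Csum. rewrite <- (is_Clim_seq_incr_n (Csum a) 1). split; intros H.
  - apply (is_Clim_seq_ext (fun n => Csum (dilate k a) (k * n + 1)%nat)).
    + intros n. apply Csum_dilate. lia.
    + apply (is_Clim_seq_subseq _ (fun n => (k * n + 1)%nat)); [|exact H].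
      apply eventually_subseq. intros; nia.
  - apply (is_Clim_seq_incr_n _ 1), (is_Clim_seq_ext (fun m => Csum a (1 + m / k))).
    + intros m. replace (1 + m)%nat with (k * (m / k) + S (m mod k))%nat by (pose proof (Nat.div_mod_eq m k); lia).
      symmetry. apply Csum_dilate, Nat.mod_upper_bound. lia.
    + apply (is_Clim_seq_subseq (fun n => Csum a (1 + n)) (fun m => (m / k)%nat)); [|exact H].
      intros P [N HN]. exists (k * N)%nat. intros n Hn. apply HN. apply Nat.div_le_lower_bound; lia.
Qed.

Lemma Cmod_dilate k a n : RtoC (Cmod (dilate k a n)) = dilate k (fun j => RtoC (Cmod (a j))) n.
Proof. unfold dilate. destruct (_ =? _)%nat; [reflexivity|now rewrite Cmod_0]. Qed.

Lemma abs_summable_dilate k a : (0 < k)%nat -> abs_summable a -> abs_summable (dilate k a).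
Proof.
  intros Hk H. exists (l1norm a). apply is_series_RtoC.
  eapply is_series_Cext; [intros n; symmetry; apply Cmod_dilate|].
  apply is_series_dilate; [assumption|]. now apply is_series_RtoC, Series_correct.
Qed.

Lemma l1norm_dilate k a : (0 < k)%nat -> abs_summable a -> l1norm (dilate k a) = l1norm a.
Proof.
  intros Hk H. apply is_series_unique, is_series_RtoC.
  eapply is_series_Cext; [intros n; symmetry; apply Cmod_dilate|].
  apply is_series_dilate; [assumption|]. now apply is_series_RtoC, Series_correct.
Qed.

Lemma CSeries_dilate k a : (0 < k)%nat -> abs_summable a -> CSeries (dilate k a) = CSeries a.
Proof. intros Hk H. apply CSeries_unique, is_series_dilate; [assumption|]. now apply CSeries_correct. Qed.

Lemma dilate_pow k a x n : dilate k a n * x ^ n = dilate k (fun j => a j * (x ^ k) ^ j) n.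
Proof.
  unfold dilate. destruct (n mod k =? 0)%nat eqn:E; [|ring].
  apply Nat.eqb_eq in E. rewrite <- Cpow_mult_r. pose proof (Nat.div_mod_eq n k) as Q.
  rewrite E, Nat.add_0_r in Q. now rewrite <- Q.
Qed.

Lemma Cmod_Cpow_lt_1 x n : (Cmod x < 1)%R -> (0 < n)%nat -> (Cmod (x ^ n) < 1)%R.
Proof.
  intros H Hn. rewrite Cmod_pow. apply pow_lt_1_compat; [|lia]. split; [apply Cmod_ge_0|assumption].
Qed.

Lemma cvg_unit_disk_dilate k a : (0 < k)%nat -> cvg_unit_disk a -> cvg_unit_disk (dilate k a).
Proof.
  intros Hk Ha x Hx. eapply abs_summable_ext; [intros n; symmetry; apply dilate_pow|].
  apply abs_summable_dilate; [assumption|]. now apply Ha, Cmod_Cpow_lt_1.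
Qed.

Lemma CPSeries_dilate k a x : (0 < k)%nat -> cvg_unit_disk a -> (Cmod x < 1)%R ->
  CPSeries (dilate k a) x = CPSeries a (x ^ k).
Proof.
  intros Hk Ha Hx. unfold CPSeries at 1. rewrite (CSeries_ext _ _ (dilate_pow k a x)).
  apply CSeries_dilate; [assumption|]. now apply Ha, Cmod_Cpow_lt_1.
Qed.

Lemma Cminus_1_neq0 x : (Cmod x < 1)%R -> 1 - x <> 0.
Proof.
  intros H E. apply Cminus_diag_uniq in E. rewrite <- E, Cmod_1 in H. lra.
Qed.

Lemma cvg_unit_disk_bounded (c : nat -> C) : (forall n, (Cmod (c n) <= 1)%R) -> cvg_unit_disk c.
Proof.
  intros H x Hx. pose proof (Cmod_ge_0 x). apply abs_summable_le with (fun n => Cmod x ^ n)%R.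
  - intros n. rewrite Cmod_mult, Cmod_pow. pose proof (pow_le (Cmod x) n ltac:(lra)). specialize (H n). nra.
  - apply ex_series_geom. rewrite Rabs_pos_eq; lra.
Qed.

Lemma cvg_unit_disk_1 : cvg_unit_disk (fun _ => 1).
Proof. apply cvg_unit_disk_bounded. intros _. rewrite Cmod_1. lra. Qed.

Lemma CPSeries_1 x : (Cmod x < 1)%R -> CPSeries (fun _ => 1) x = / (1 - x).
Proof.
  intros Hx. pose proof (Cminus_1_neq0 x Hx).
  assert (E : CPSeries (fun _ => 1) x = 1 + x * CPSeries (fun _ => 1) x).
  { unfold CPSeries at 1. rewrite CSeries_incr_1 by now apply cvg_unit_disk_1.
    unfold CPSeries. rewrite <- CSeries_scal by now apply cvg_unit_disk_1.
    f_equal; [simpl; ring|]. apply CSeries_ext. intros n. simpl. ring. }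
  apply (Cmult_reg_l (1 - x)); [assumption|]. rewrite Cinv_r by assumption.
  replace ((1 - x) * CPSeries (fun _ => 1) x) with (CPSeries (fun _ => 1) x - x * CPSeries (fun _ => 1) x) by ring.
  rewrite E at 1. ring.
Qed.

Lemma is_derive_inv_1_minus (x : C) : (Cmod x < 1)%R ->
  is_derive (fun y => / (1 - y)) x (/ ((1 - x) * (1 - x))).
Proof.
  intros Hx. eapply is_derive_eq; [apply (is_derive_Ccomp (fun y => / y) (fun y => 1 - y))|].
  - apply is_derive_Cinv. now apply Cminus_1_neq0.
  - apply is_derive_Cminus; [apply is_derive_Cconst|apply is_derive_Cid].
  - simpl. field. now apply Cminus_1_neq0.
Qed.

Lemma CSeries_INR_mult c x : cvg_unit_disk c -> (Cmod x < 1)%R ->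
  abs_summable (fun n => INR n * c n * x ^ n) /\
  CSeries (fun n => INR n * c n * x ^ n) = x * CPSeries (CPS_derive c) x.
Proof.
  intros Hc Hx. destruct (CPSeries_CPS_derive c x) as [Hs <-]; [now apply cvg_unit_disk_CPS_derive|].
  assert (E : forall n, x * (INR n * (c n * x ^ (n - 1))) = INR n * c n * x ^ n).
  { intros [|n]; [simpl; ring|]. rewrite (Cpow_S x). replace (S n - 1)%nat with n by lia. ring. }
  split; [eapply abs_summable_ext; [exact E|]; now apply abs_summable_scal|].
  rewrite <- CSeries_scal by assumption. apply CSeries_ext. intros n. now rewrite E.
Qed.

Lemma CSeries_INR_pow x : (Cmod x < 1)%R ->
  abs_summable (fun n => INR n * x ^ n) /\ CSeries (fun n => INR n * x ^ n) = x / ((1 - x) * (1 - x)).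
Proof.
  intros Hx. destruct (CSeries_INR_mult (fun _ => 1) x cvg_unit_disk_1 Hx) as [Hs E].
  assert (E1 : forall n, INR n * 1 * x ^ n = INR n * x ^ n) by (intros; ring).
  split; [exact (abs_summable_ext _ _ E1 Hs)|]. rewrite <- (CSeries_ext _ _ E1), E. unfold Cdiv. f_equal.
  apply (is_derive_Cunique (fun y => / (1 - y)) x); [|now apply is_derive_inv_1_minus].
  apply (is_derive_Cext_loc (CPSeries (fun _ => 1)) _ _ _ (1 - Cmod x)); [lra| |].
  - intros y Hy. apply CPSeries_1. pose proof (Cmod_minus_ge y x). lra.
  - apply is_derive_CPSeries_unit_disk; [apply cvg_unit_disk_1|assumption].
Qed.

Local Notation i := Coquelicot.Complex.Ci.

(** * The powers of [q] *)

Lemma qpowE r z : qpow r z = cexp (RtoC (2 * PI * r) * i * z).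
Proof. reflexivity. Qed.

Lemma qpow_plus r s z : qpow (r + s) z = qpow r z * qpow s z.
Proof. rewrite !qpowE, <- cexp_plus. f_equal. rewrite Rmult_plus_distr_l, RtoC_plus. ring. Qed.

Lemma qpow_0 z : qpow 0 z = 1.
Proof. rewrite qpowE, Rmult_0_r. replace (0 * i * z) with (RtoC 0) by ring. apply cexp_0. Qed.

Lemma qpow_at_0 r : qpow r 0 = 1.
Proof. rewrite qpowE, Cmult_0_r. apply cexp_0. Qed.

Lemma qpow_neq0 r z : qpow r z <> 0.
Proof. apply cexp_neq0. Qed.

Lemma qpow_mult_INR r n z : qpow (r * INR n) z = qpow r z ^ n.
Proof. rewrite !qpowE, <- cexp_INR. f_equal. rewrite !RtoC_mult. ring. Qed.

Lemma qpow_INR n z : qpow (INR n) z = qpow 1 z ^ n.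
Proof. rewrite <- qpow_mult_INR. f_equal. ring. Qed.

Lemma Cmod_qpow r z : Cmod (qpow r z) = exp (- (2 * PI * r * Im z)).
Proof. rewrite qpowE, Cmod_cexp. f_equal. destruct z as [a b]. unfold Cmult, RtoC, i; simpl. ring. Qed.

Lemma Cmod_qpow_R r (s : R) : Cmod (qpow r s) = 1%R.
Proof. rewrite Cmod_qpow. simpl. rewrite Rmult_0_r, Ropp_0. apply exp_0. Qed.

Lemma qpow_Cplus r z w : qpow r (z + w) = qpow r z * qpow r w.
Proof. rewrite !qpowE, <- cexp_plus. f_equal. ring. Qed.

Lemma qpow_scal r (s : R) z : qpow r (s * z) = qpow (r * s) z.
Proof. rewrite !qpowE. f_equal. rewrite !RtoC_mult. ring. Qed.

Lemma qpow_R r (s : R) : qpow r s = cexp (RtoC (2 * PI * (r * s)) * i).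
Proof. rewrite qpowE. f_equal. rewrite !RtoC_mult. ring. Qed.

Lemma Cmod_qpow_1_lt_1 z : UHP z -> (Cmod (qpow 1 z) < 1)%R.
Proof.
  intros H. rewrite Cmod_qpow. rewrite <- exp_0 at 2. apply exp_increasing.
  unfold UHP in H. pose proof PI_RGT_0. nra.
Qed.

Lemma is_derive_qpow (r : R) (z : C) : is_derive (qpow r) z (RtoC (2 * PI * r) * i * qpow r z).
Proof.
  eapply is_derive_eq.
  - apply (is_derive_Ccomp cexp (fun z => RtoC (2 * PI * r) * i * z)); [apply is_derive_cexp|].
    apply is_derive_Cscal, is_derive_Cid.
  - rewrite qpowE. ring.
Qed.

Lemma cexp_Ci (x : R) : cexp (x * i) = (cos x, sin x).
Proof.
  unfold cexp. replace (Re (x * i)) with 0%R by (simpl; ring). replace (Im (x * i)) with x by (simpl; ring).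
  rewrite exp_0. f_equal; ring.
Qed.

Lemma qpow_1_IZR (n : Z) : qpow 1 (IZR n) = 1.
Proof.
  assert (E : forall k : nat, qpow 1 (INR k) = 1).
  { intros k. rewrite qpow_R, Rmult_1_l, Rmult_comm, RtoC_mult, <- Cmult_assoc, cexp_INR, cexp_Ci, cos_2PI, sin_2PI.
    apply Cpow_1_l. }
  destruct (Z.le_gt_cases 0 n) as [H|H].
  - rewrite <- (Z2Nat.id n H), <- INR_IZR_INZ. apply E.
  - specialize (E (Z.to_nat (- n))). rewrite INR_IZR_INZ, Z2Nat.id in E by lia.
    apply (Cmult_reg_l (qpow 1 (IZR (- n)))); [apply qpow_neq0|].
    rewrite <- qpow_Cplus, <- RtoC_plus, <- plus_IZR, Z.add_opp_diag_l, E, qpow_at_0. ring.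
Qed.

Lemma qpow_1_period z n : qpow 1 (z + IZR n) = qpow 1 z.
Proof. rewrite qpow_Cplus, qpow_1_IZR. ring. Qed.

Lemma qpow_IZR_1 n : qpow (IZR n) 1 = 1.
Proof. rewrite qpow_R, Rmult_1_r, <- (Rmult_1_l (IZR n)), <- qpow_R. apply qpow_1_IZR. Qed.

Lemma qpow_1_neq_1 (x : R) : (0 < x < 1)%R -> qpow x 1 <> 1.
Proof.
  intros Hx E. pose proof PI_RGT_0. rewrite qpow_R, Rmult_1_r, cexp_Ci in E. apply (f_equal Re) in E.
  change (cos (2 * PI * x) = 1)%R in E. rewrite Rmult_assoc, cos_2a_sin in E.
  assert (0 < sin (PI * x))%R by (apply sin_gt_0; nra). nra.
Qed.

Lemma UHP_open z h : UHP z -> (Cmod h < Im z)%R -> UHP (z + h).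
Proof.
  intros Hz Hh. unfold UHP in *. change (Im (z + h)) with (Im z + Im h)%R.
  pose proof (im_le_Cmod h) as B. apply Rabs_le_between in B. lra.
Qed.

Lemma is_derive_ext_UHP (f g : C -> C) (z l : C) : UHP z -> (forall w, UHP w -> f w = g w) ->
  is_derive f z l -> is_derive g z l.
Proof.
  intros Hz E. apply (is_derive_Cext_loc f g z l (Im z) Hz). intros y Hy. apply E.
  replace y with (z + (y - z)) by ring. now apply UHP_open.
Qed.

Lemma is_derive_CPSeries_qpow c z : cvg_unit_disk c -> UHP z ->
  is_derive (fun z => CPSeries c (qpow 1 z)) z (RtoC (2 * PI) * i * (qpow 1 z * CPSeries (CPS_derive c) (qpow 1 z))).
Proof.
  intros Hc Hz. eapply is_derive_eq.
  - apply (is_derive_Ccomp (CPSeries c) (qpow 1)); [|apply is_derive_qpow].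
    now apply is_derive_CPSeries_unit_disk, Cmod_qpow_1_lt_1.
  - rewrite Rmult_1_r. ring.
Qed.

(** * Lambert series and the eta product *)

(* The [n]-th coefficient is the sum of [y d j] over all [(d + 1) * j = n]. *)
Definition lambert_coef (y : nat -> nat -> C) (n : nat) : C := CSeries (fun d => dilate (S d) (y d) n).

Lemma pow_pow_le_mult (r : R) d j : (0 <= r <= 1)%R -> ((r ^ S d) ^ S j <= r ^ d * r ^ S j)%R.
Proof.
  intros Hr. rewrite <- pow_mult, <- pow_add.
  replace (S d * S j)%nat with (d + S j + d * j)%nat by lia. rewrite (pow_add _ (d + S j)).
  assert (r ^ (d * j) <= 1)%R.
  { rewrite <- (pow1 (d * j)). apply pow_incr. lra. }
  assert (0 <= r ^ (d + S j))%R by (apply pow_le; lra). nra.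
Qed.

Lemma lambert_coef_at_0 (y : nat -> nat -> C) : (forall d, y d O = 0) -> lambert_coef y 0 = 0.
Proof. intros H. apply CSeries_0. intros d. rewrite dilate_0 by lia. apply H. Qed.

Lemma abs_summable_lambert_coef (y : nat -> nat -> C) n : (forall d, y d O = 0) ->
  abs_summable (fun d => dilate (S d) (y d) n).
Proof.
  intros H. destruct n as [|n].
  - apply abs_summable_fin with O. intros d _. rewrite dilate_0 by lia. apply H.
  - apply abs_summable_fin with (S n). intros d Hd. apply dilate_lt. lia.
Qed.

Section LambertSeries.

Variable y : nat -> nat -> C.
Hypothesis y_le : forall d j, (Cmod (y d j) <= INR j)%R.

Lemma lambert_bound_at_0 d : y d O = 0.
Proof. apply Cmod_eq_0. specialize (y_le d O). pose proof (Cmod_ge_0 (y d O)). simpl in y_le. lra. Qed.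

Variable x : C.
Hypothesis Hx : (Cmod x < 1)%R.

Let term_le d j : (Cmod (y d j * (x ^ S d) ^ j)%C <= Cmod x ^ d * Cmod (INR j * x ^ j)%C)%R.
Proof.
  pose proof (Cmod_ge_0 x). rewrite !Cmod_mult, Cmod_INR, !Cmod_pow. destruct j as [|j].
  - rewrite lambert_bound_at_0, Cmod_0. simpl. lra.
  - pose proof (pow_pow_le_mult (Cmod x) d j ltac:(lra)).
    replace (Cmod x ^ d * (INR (S j) * Cmod x ^ S j))%R with (INR (S j) * (Cmod x ^ d * Cmod x ^ S j))%R by ring.
    apply Rmult_le_compat; [apply Cmod_ge_0| |apply y_le|assumption]. now apply pow_le, pow_le.
Qed.

Let majorant_summable (c : R) : ex_series (fun j => c * Cmod (INR j * x ^ j)%C)%R.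
Proof. apply (ex_series_scal_l c (fun j => Cmod (INR j * x ^ j))). now apply CSeries_INR_pow. Qed.

Lemma abs_summable_lambert_row d : abs_summable (fun j => y d j * (x ^ S d) ^ j).
Proof. eapply abs_summable_le; [intros j; apply term_le|apply majorant_summable]. Qed.

Lemma ex_series_lambert_row_norms : ex_series (fun d => l1norm (fun j => y d j * (x ^ S d) ^ j)).
Proof.
  apply ex_series_le_nonneg with (fun d => Cmod x ^ d * l1norm (fun j => INR j * x ^ j)%C)%R.
  - intros d. split; [apply l1norm_nonneg, abs_summable_lambert_row|].
    unfold l1norm at 2. rewrite <- Series_scal_l. apply l1norm_le; [intros j; apply term_le|apply majorant_summable].
  - apply ex_series_scal_r, ex_series_geom. rewrite Rabs_pos_eq; [assumption|apply Cmod_ge_0].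
Qed.

Let dilated_row_summable d : abs_summable (dilate (S d) (fun j => y d j * (x ^ S d) ^ j)).
Proof. apply abs_summable_dilate; [lia|apply abs_summable_lambert_row]. Qed.

Let dilated_row_norms : ex_series (fun d => l1norm (dilate (S d) (fun j => y d j * (x ^ S d) ^ j))).
Proof.
  eapply ex_series_ext; [|exact ex_series_lambert_row_norms]. intros d. symmetry.
  apply l1norm_dilate; [lia|apply abs_summable_lambert_row].
Qed.

Let column_sum n : CSeries (fun d => dilate (S d) (fun j => y d j * (x ^ S d) ^ j) n) = lambert_coef y n * x ^ n.
Proof.
  unfold lambert_coef. rewrite Cmult_comm, <- CSeries_scal.
  - apply CSeries_ext. intros d. rewrite <- dilate_pow. ring.
  - apply abs_summable_lambert_coef, lambert_bound_at_0.
Qed.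

Lemma abs_summable_lambert : abs_summable (fun n => lambert_coef y n * x ^ n).
Proof. eapply abs_summable_ext; [exact column_sum|]. now apply fubini_abs_summable_column_sums. Qed.

Lemma CPSeries_lambert_coef :
  CPSeries (lambert_coef y) x = CSeries (fun d => CSeries (fun j => y d j * (x ^ S d) ^ j)).
Proof.
  unfold CPSeries. rewrite <- (CSeries_ext _ _ column_sum), CSeries_switch by assumption.
  apply CSeries_ext. intros d. apply CSeries_dilate; [lia|apply abs_summable_lambert_row].
Qed.

Lemma abs_summable_lambert_rows : abs_summable (fun d => CSeries (fun j => y d j * (x ^ S d) ^ j)).
Proof. apply fubini_abs_summable_row_sums; [exact abs_summable_lambert_row|exact ex_series_lambert_row_norms]. Qed.

Lemma is_series_lambert_columns :
  is_series (fun j => CSeries (fun d => y d j * (x ^ S d) ^ j)) (CPSeries (lambert_coef y) x).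
Proof.
  rewrite CPSeries_lambert_coef.
  apply fubini_is_series; [exact abs_summable_lambert_row|exact ex_series_lambert_row_norms].
Qed.

End LambertSeries.

(* The coefficients of [- log (1 - x)]. *)
Definition log_coef (n : nat) : C := match n with O => 0 | S m => RtoC (/ INR (S m)) end.

Lemma Cmod_inv_INR_S_le_1 m : (Cmod (RtoC (/ INR (S m))) <= 1)%R.
Proof.
  rewrite Cmod_R, Rabs_pos_eq.
  - rewrite <- Rinv_1. apply Rinv_le_contravar; [lra|]. rewrite S_INR. pose proof (pos_INR m). lra.
  - apply Rlt_le, Rinv_0_lt_compat, lt_0_INR. lia.
Qed.

Lemma cvg_unit_disk_log_coef : cvg_unit_disk log_coef.
Proof.
  apply cvg_unit_disk_bounded. intros [|n]; [simpl; rewrite Cmod_0; lra|apply Cmod_inv_INR_S_le_1].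
Qed.

Lemma CPSeries_CPS_derive_log_coef x : (Cmod x < 1)%R -> CPSeries (CPS_derive log_coef) x = / (1 - x).
Proof.
  intros Hx. rewrite <- CPSeries_1 by assumption. apply CPSeries_ext. intros n. unfold CPS_derive, log_coef.
  rewrite <- RtoC_mult, Rinv_r by (apply not_0_INR; lia). reflexivity.
Qed.

(* The derivative of [y -> cexp (CPSeries log_coef y) * (1 - y)] vanishes. *)
Lemma cexp_opp_CPSeries_log_coef x : (Cmod x < 1)%R -> cexp (- CPSeries log_coef x) = 1 - x.
Proof.
  intros Hx.
  assert (E : cexp (CPSeries log_coef 0) * (1 - 0) = cexp (CPSeries log_coef x) * (1 - x)).
  { apply (eq_is_Cderive (fun y => cexp (CPSeries log_coef y) * (1 - y))). intros t Ht.
    replace (0 + t * (x - 0)) with (t * x) by ring.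
    assert (Hm : (Cmod (t * x) < 1)%R).
    { rewrite Cmod_mult, Cmod_R, Rabs_pos_eq by lra. pose proof (Cmod_ge_0 x). nra. }
    eapply is_derive_eq; [apply is_derive_Cmult|].
    - apply (is_derive_Ccomp cexp (CPSeries log_coef)); [apply is_derive_cexp|].
      apply is_derive_CPSeries_unit_disk; [apply cvg_unit_disk_log_coef|assumption].
    - apply is_derive_Cminus; [apply is_derive_Cconst|apply is_derive_Cid].
    - simpl. rewrite CPSeries_CPS_derive_log_coef by assumption. field. now apply Cminus_1_neq0. }
  rewrite CPSeries_at_0 in E. simpl log_coef in E. rewrite cexp_0 in E.
  rewrite cexp_opp. apply (Cmult_reg_l (cexp (CPSeries log_coef x))); [apply cexp_neq0|].
  rewrite <- E. field. apply cexp_neq0.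
Qed.

Definition sigma_m1 : nat -> C :=
  lambert_coef (fun d j => match j with O => 0 | S _ => RtoC (/ INR (S d)) end).

Definition sigma_1 : nat -> C := lambert_coef (fun _ j => RtoC (INR j)).

Lemma sigma_m1_bound d j : (Cmod (match j with O => 0 | S _ => RtoC (/ INR (S d)) end) <= INR j)%R.
Proof.
  destruct j as [|j]; [rewrite Cmod_0; apply Rle_refl|].
  eapply Rle_trans; [apply Cmod_inv_INR_S_le_1|]. rewrite S_INR. pose proof (pos_INR j). lra.
Qed.

Lemma cvg_unit_disk_sigma_m1 : cvg_unit_disk sigma_m1.
Proof. intros x Hx. apply abs_summable_lambert; [exact sigma_m1_bound|assumption]. Qed.

Lemma sigma_m1_0 : sigma_m1 0 = 0.
Proof. now apply lambert_coef_at_0. Qed.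

Lemma INR_mult_sigma_m1 n : INR n * sigma_m1 n = sigma_1 n.
Proof.
  unfold sigma_m1, sigma_1, lambert_coef. rewrite <- CSeries_scal by now apply abs_summable_lambert_coef.
  apply CSeries_ext. intros d. revert n.
  apply (dilate_elim (fun n c => INR n * c = dilate (S d) (fun j => RtoC (INR j)) n)); [lia| |].
  - intros j. rewrite dilate_mul by lia. destruct j as [|j]; [simpl; ring|].
    rewrite mult_INR, <- RtoC_mult. f_equal. field. apply not_0_INR. lia.
  - intros n Hn. rewrite dilate_not_multiple by assumption. ring.
Qed.

Lemma CSeries_pow_div_sqr x : (Cmod x < 1)%R ->
  abs_summable (fun d => x ^ S d / ((1 - x ^ S d) * (1 - x ^ S d))) /\
  CSeries (fun d => x ^ S d / ((1 - x ^ S d) * (1 - x ^ S d))) = x * CPSeries (CPS_derive sigma_m1) x.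
Proof.
  intros Hx.
  assert (Hy : forall d j : nat, (Cmod (INR j) <= INR j)%R) by (intros; rewrite Cmod_INR; lra).
  assert (E : forall d, CSeries (fun j => INR j * (x ^ S d) ^ j) = x ^ S d / ((1 - x ^ S d) * (1 - x ^ S d))).
  { intros d. apply CSeries_INR_pow. apply Cmod_Cpow_lt_1; [assumption|lia]. }
  split.
  - eapply abs_summable_ext; [exact E|]. now apply (abs_summable_lambert_rows (fun _ j => INR j)).
  - rewrite <- (CSeries_ext _ _ E), <- (CPSeries_lambert_coef (fun _ j => INR j) Hy x Hx).
    rewrite <- (proj2 (CSeries_INR_mult sigma_m1 x cvg_unit_disk_sigma_m1 Hx)).
    apply CSeries_ext. intros n. now rewrite INR_mult_sigma_m1.
Qed.

Lemma is_series_log_coef_pow x : (Cmod x < 1)%R ->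
  is_series (fun j => CPSeries log_coef (x ^ S j)) (CPSeries sigma_m1 x).
Proof.
  intros Hx. pose proof (is_series_lambert_columns _ sigma_m1_bound x Hx) as H.
  apply (is_series_incr_0 _ 1) in H.
  - eapply is_series_Cext; [|exact H]. intros j. symmetry. unfold CPSeries.
    rewrite CSeries_incr_1 by (apply cvg_unit_disk_log_coef, Cmod_Cpow_lt_1; [assumption|lia]).
    simpl log_coef at 1. rewrite Cmult_0_l, Cplus_0_l. apply CSeries_ext. intros m.
    unfold log_coef. f_equal. rewrite <- !Cpow_mult_r. f_equal. lia.
  - intros [|n] Hn; [|lia]. apply CSeries_0. intros d. ring.
Qed.

Definition neg_log_eta_prod (z : C) : C := CPSeries sigma_m1 (qpow 1 z).

Lemma is_derive_neg_log_eta_prod (z : C) : UHP z -> is_derive neg_log_eta_prod z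
  (RtoC (2 * PI) * i * CSeries (fun d => qpow 1 z ^ S d / ((1 - qpow 1 z ^ S d) * (1 - qpow 1 z ^ S d)))).
Proof.
  intros Hz. rewrite (proj2 (CSeries_pow_div_sqr _ (Cmod_qpow_1_lt_1 z Hz))).
  now apply is_derive_CPSeries_qpow; [apply cvg_unit_disk_sigma_m1|].
Qed.

Lemma eta_partialE z N : UHP z ->
  eta_partial z N = cexp (- Csum (fun j => CPSeries log_coef (qpow 1 z ^ S j)) N).
Proof.
  intros Hz. induction N as [|N IH].
  - simpl. replace (- (0)) with (RtoC 0) by ring. now rewrite cexp_0.
  - change (eta_partial z (S N)) with (eta_partial z N * (1 - qpow (INR (S N)) z)).
    rewrite IH, qpow_INR, <- cexp_opp_CPSeries_log_coef by (apply Cmod_Cpow_lt_1; [now apply Cmod_qpow_1_lt_1|lia]).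
    rewrite <- cexp_plus. f_equal. cbn [Csum]. ring.
Qed.

Lemma eta_prodE z : UHP z -> eta_prod z = cexp (- neg_log_eta_prod z).
Proof.
  intros Hz. assert (L : is_Clim_seq (eta_partial z) (cexp (- neg_log_eta_prod z))).
  { eapply is_Clim_seq_ext; [intros N; symmetry; now apply eta_partialE|].
    apply (is_Clim_seq_derivable cexp _ _ _ (is_derive_cexp _)), is_Clim_seq_opp, is_series_Csum,
      is_series_log_coef_pow.
    now apply Cmod_qpow_1_lt_1. }
  apply (is_Clim_seq_unique (eta_partial z)); [|exact L].
  exact (epsilon_spec (inhabits (RtoC 0)) _ (ex_intro _ _ L)).
Qed.

(** * Partial fractions of the cotangent *)

Lemma Re_scal_R (r : R) (w : C) : Re (r * w) = (r * Re w)%R.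
Proof. unfold Cmult, RtoC, Re, Im; simpl. ring. Qed.

Lemma Im_scal_R (r : R) (w : C) : Im (r * w) = (r * Im w)%R.
Proof. unfold Cmult, RtoC, Re, Im; simpl. ring. Qed.

Lemma UHP_scal (r : R) (z : C) : (0 < r)%R -> UHP z -> UHP (r * z).
Proof. unfold UHP. rewrite Im_scal_R. intros. now apply Rmult_lt_0_compat. Qed.

Lemma UHP_plus_R (w : C) (s : R) : UHP w -> UHP (w + s).
Proof. unfold UHP. change (Im (w + s)) with (Im w + 0)%R. lra. Qed.

Lemma UHP_neq0 (w : C) : UHP w -> w <> 0.
Proof. intros H E. rewrite E in H. unfold UHP in H. simpl in H. lra. Qed.

Lemma UHP_plus_R_neq0 (w : C) (s : R) : UHP w -> w + s <> 0.
Proof. intros H. now apply UHP_neq0, UHP_plus_R. Qed.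

Lemma UHP_minus_R_neq0 (w : C) (s : R) : UHP w -> w - s <> 0.
Proof.
  intros H. replace (w - s) with (w + RtoC (- s)) by (rewrite RtoC_opp; ring). now apply UHP_plus_R_neq0.
Qed.

Lemma UHP_lattice_lower (z : C) : UHP z -> exists dl : R, (0 < dl)%R /\
  forall m x : R, (0 <= m)%R -> (dl * (m + Rabs x) <= Cmod (m * z + x)%C)%R.
Proof.
  intros Hz. unfold UHP in Hz. pose proof (Cmod_ge_0 z) as H0.
  set (K := (1 + (Cmod z + 1) / Im z)%R).
  assert (HK : (0 < K)%R) by (unfold K; pose proof (Rdiv_lt_0_compat (Cmod z + 1) (Im z) ltac:(lra) Hz); lra).
  exists (/ K)%R. split; [now apply Rinv_0_lt_compat|]. intros m x Hm. set (v := Cmod (m * z + x)).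
  assert (Him : (m * Im z <= v)%R).
  { unfold v. eapply Rle_trans; [|apply im_le_Cmod].
    replace (Im (m * z + x)) with (m * Im z)%R by (rewrite <- Im_scal_R; symmetry; apply Rplus_0_r). apply Rle_abs. }
  assert (Hx : (Rabs x <= v + m * Cmod z)%R).
  { assert (E : Rabs x = Cmod ((m * z + x) - m * z)) by (rewrite <- Cmod_R; f_equal; ring).
    rewrite E. eapply Rle_trans; [apply Cmod_minus_le|]. fold v.
    rewrite (Cmod_mult m z), Cmod_R, (Rabs_pos_eq m) by lra. lra. }
  apply Rmult_le_reg_l with K; [assumption|]. rewrite <- Rmult_assoc, Rinv_r, Rmult_1_l by lra.
  assert (m <= v / Im z)%R by (apply Rle_div_r; lra).
  replace (K * v)%R with (v + v / Im z * (Cmod z + 1))%R by (unfold K; field; lra).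
  assert (m * (Cmod z + 1) <= v / Im z * (Cmod z + 1))%R by (apply Rmult_le_compat_r; lra). lra.
Qed.

Lemma UHP_plus_R_lower (w : C) : UHP w -> exists dl : R, (0 < dl)%R /\
  forall s : R, (dl * Rabs s <= Cmod (w + s)%C)%R.
Proof.
  intros Hw. destruct (UHP_lattice_lower w Hw) as (dl & Hd & H). exists dl. split; [assumption|]. intros s.
  specialize (H 1%R s ltac:(lra)). rewrite Cmult_1_l in H. nra.
Qed.

Lemma Csum_geometric (x : C) n : (1 - x) * Csum (fun k => x ^ k) n = 1 - x ^ n.
Proof. induction n as [|n IH]; [simpl; ring|]. cbn [Csum]. rewrite Cmult_plus_distr_l, IH, Cpow_S. ring. Qed.

(* [qpow (j / N) k] is [e(jk/N)]. *)
Lemma Csum_roots_of_unity (N : nat) (j : Z) : (0 < N)%nat ->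
  Csum (fun k => qpow (IZR j / INR N) (INR k)) N = if (j mod Z.of_nat N =? 0)%Z then INR N else 0.
Proof.
  intros HN. assert (HN' : (0 < INR N)%R) by now apply lt_0_INR.
  set (r := (j mod Z.of_nat N)%Z). set (w := qpow (IZR r / INR N) 1).
  pose proof (Z.mod_pos_bound j (Z.of_nat N) ltac:(lia)) as B. fold r in B.
  rewrite (Csum_ext _ (fun k => w ^ k)).
  2:{ intros k _. unfold w. rewrite <- qpow_mult_INR, <- (Cmult_1_r (INR k)), qpow_scal.
      replace (IZR j / INR N * INR k)%R with (IZR (j / Z.of_nat N * Z.of_nat k) + IZR r / INR N * INR k)%R.
      - rewrite qpow_plus, qpow_IZR_1. ring.
      - rewrite (Z.div_mod j (Z.of_nat N)) at 2 by lia.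
        unfold r. rewrite plus_IZR, !mult_IZR, <- !INR_IZR_INZ. field. lra. }
  destruct (Z.eqb_spec r 0) as [E|E].
  - unfold w. rewrite E. replace (0 / INR N)%R with 0%R by (field; lra). rewrite qpow_0.
    rewrite (Csum_ext _ (fun _ => 1)) by (intros; apply Cpow_1_l). rewrite Csum_const. ring.
  - assert (Hw : w <> 1).
    { apply qpow_1_neq_1. pose proof (IZR_lt 0 r ltac:(lia)). pose proof (IZR_lt r (Z.of_nat N) ltac:(lia)) as L.
      rewrite <- INR_IZR_INZ in L. split; [apply Rdiv_lt_0_compat|apply Rlt_div_l]; lra. }
    assert (HwN : w ^ N = 1).
    { unfold w. rewrite <- qpow_mult_INR. replace (IZR r / INR N * INR N)%R with (IZR r) by (field; lra).
      apply qpow_IZR_1. }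
    apply (Cmult_reg_l (1 - w)).
    + intros Z0. apply Hw. symmetry. now apply Cminus_diag_uniq.
    + rewrite Csum_geometric, HwN. ring.
Qed.

Lemma root_of_unity_pow (N k : nat) : (0 < N)%nat -> qpow (1 / INR N) (INR k) ^ N = 1.
Proof.
  intros HN. assert (0 < INR N)%R by now apply lt_0_INR.
  rewrite <- qpow_mult_INR. replace (1 / INR N * INR N)%R with 1%R by (field; lra).
  rewrite INR_IZR_INZ. apply qpow_1_IZR.
Qed.

Lemma Csum_inv_1_minus_root (x : C) (N : nat) : (0 < N)%nat -> x ^ N <> 1 ->
  Csum (fun k => / (1 - x * qpow (1 / INR N) (INR k))) N = INR N / (1 - x ^ N).
Proof.
  intros HN Hx. assert (HN' : (0 < INR N)%R) by now apply lt_0_INR.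
  assert (HxN : 1 - x ^ N <> 0) by (intros E; apply Hx; symmetry; now apply Cminus_diag_uniq).
  assert (EN : forall k, (x * qpow (1 / INR N) (INR k)) ^ N = x ^ N).
  { intros k. rewrite Cpow_mult_l, root_of_unity_pow by assumption. ring. }
  assert (Hk : forall k, 1 - x * qpow (1 / INR N) (INR k) <> 0).
  { intros k E. apply HxN. rewrite <- (EN k), <- (Cminus_diag_uniq _ _ E), Cpow_1_l. ring. }
  apply (Cmult_reg_l (1 - x ^ N)); [assumption|]. rewrite <- Csum_scal.
  rewrite (Csum_ext _ (fun k => Csum (fun j => (x * qpow (1 / INR N) (INR k)) ^ j) N)).
  2:{ intros k _. rewrite <- (EN k), <- Csum_geometric. field. apply Hk. }
  rewrite Csum_switch.
  rewrite (Csum_ext _ (fun j => x ^ j * (if (Z.of_nat j mod Z.of_nat N =? 0)%Z then INR N else 0))).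
  2:{ intros j Hj. rewrite <- Csum_roots_of_unity, <- Csum_scal by assumption. apply Csum_ext. intros k _.
      rewrite Cpow_mult_l, <- (qpow_mult_INR (1 / INR N) j). do 2 f_equal. rewrite <- INR_IZR_INZ. field. lra. }
  rewrite (Csum_single _ 0).
  - rewrite Z.mod_0_l by lia. simpl. field. assumption.
  - assumption.
  - intros j Hj Hj0. rewrite Z.mod_small by lia. rewrite (proj2 (Z.eqb_neq _ _)) by lia. ring.
Qed.

(* This is [pi * cot (pi w)]. *)
Definition pi_cot (w : C) : C := - RtoC PI * i * ((1 + qpow 1 w) / (1 - qpow 1 w)).

Lemma pi_cot_period w n : pi_cot (w + IZR n) = pi_cot w.
Proof. unfold pi_cot. now rewrite qpow_1_period. Qed.

Lemma pi_cot_multiplication (w : C) (N : nat) : (0 < N)%nat -> qpow 1 w <> 1 ->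
  Csum (fun k => pi_cot ((w + INR k) / INR N)) N = INR N * pi_cot w.
Proof.
  intros HN Hq. assert (HN' : (0 < INR N)%R) by now apply lt_0_INR.
  assert (HNC : RtoC (INR N) <> 0) by (apply RtoC_neq0; lra).
  set (x := qpow (1 / INR N) w).
  assert (ExN : x ^ N = qpow 1 w).
  { unfold x. rewrite <- qpow_mult_INR. f_equal. field. lra. }
  assert (Ek : forall k, qpow 1 ((w + INR k) / INR N) = x * qpow (1 / INR N) (INR k)).
  { intros k. unfold x. rewrite <- qpow_Cplus.
    replace ((w + INR k) / INR N) with (RtoC (/ INR N) * (w + INR k)) by (rewrite RtoC_inv by lra; field; assumption).
    apply qpow_scal. }
  assert (Hk : forall k, 1 - x * qpow (1 / INR N) (INR k) <> 0).
  { intros k E. apply Hq. transitivity ((x * qpow (1 / INR N) (INR k)) ^ N).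
    - rewrite Cpow_mult_l, root_of_unity_pow, Cmult_1_r by assumption. now symmetry.
    - rewrite <- (Cminus_diag_uniq _ _ E). apply Cpow_1_l. }
  assert (Hq1 : 1 - qpow 1 w <> 0) by (intros E; apply Hq; symmetry; now apply Cminus_diag_uniq).
  unfold pi_cot. rewrite Csum_scal.
  rewrite (Csum_ext _ (fun k => 2 * (/ (1 - x * qpow (1 / INR N) (INR k))) - 1)).
  - rewrite Csum_minus, Csum_scal, Csum_inv_1_minus_root, ExN, Csum_const by (rewrite ?ExN; assumption).
    field. assumption.
  - intros k _. rewrite Ek. field. apply Hk.
Qed.

Lemma Csum_symmetric (F : R -> C) M :
  Csum (fun k => F (INR k - INR M)%R) (2 * M + 1) = F 0%R + Csum (fun k => F (INR (S k)) + F (- INR (S k))%R) M.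
Proof.
  induction M as [|M IH].
  - simpl. rewrite Rminus_0_r. ring.
  - replace (2 * S M + 1)%nat with (S (S (2 * M + 1)))%nat by lia.
    rewrite Csum_S_l. cbn [Csum].
    rewrite (Csum_ext _ (fun k => F (INR k - INR M)%R)) by (intros k _; f_equal; rewrite !S_INR; ring).
    rewrite IH. replace (INR 0 - INR (S M))%R with (- INR (S M))%R by (change (INR 0) with 0%R; ring).
    replace (INR (S (2 * M + 1)) - INR (S M))%R with (INR (S M)); [ring|].
    rewrite !S_INR, plus_INR, mult_INR. simpl. ring.
Qed.

Lemma pi_cot_finite_partial_fractions (w : C) (M : nat) : qpow 1 w <> 1 ->
  pi_cot w = / INR (2 * M + 1) * (pi_cot (w / INR (2 * M + 1)) +
    Csum (fun k => pi_cot ((w + INR (S k)) / INR (2 * M + 1)) + pi_cot ((w - INR (S k)) / INR (2 * M + 1))) M).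
Proof.
  intros Hq. set (N := (2 * M + 1)%nat).
  assert (HNC : RtoC (INR N) <> 0) by (apply RtoC_neq0, not_0_INR; unfold N; lia).
  assert (Ew : w - INR M = w + IZR (- Z.of_nat M)) by (rewrite opp_IZR, <- INR_IZR_INZ, RtoC_opp; reflexivity).
  apply (Cmult_reg_l (INR N)); [assumption|].
  rewrite <- (pi_cot_period w (- Z.of_nat M)), <- Ew, <- pi_cot_multiplication;
    [|unfold N; lia|rewrite Ew, qpow_1_period; assumption].
  rewrite (Csum_ext _ (fun k => (fun x : R => pi_cot ((w + x) / INR N)) (INR k - INR M)%R)).
  - unfold N. rewrite (Csum_symmetric (fun x : R => pi_cot ((w + x) / INR (2 * M + 1)))). fold N.
    rewrite Cmult_assoc, Cinv_r, Cmult_1_l by assumption. f_equal; [do 2 f_equal; ring|].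
    apply Csum_ext. intros k _. rewrite RtoC_opp. reflexivity.
  - intros k _. cbv beta. rewrite RtoC_minus. do 2 f_equal. ring.
Qed.

Lemma is_lim_seq_inv_INR (phi : nat -> nat) : filterlim phi eventually eventually ->
  is_lim_seq (fun n => / INR (phi n))%R 0.
Proof.
  intros H. replace (Finite 0) with (Rbar_inv p_infty) by reflexivity.
  apply is_lim_seq_inv; [|discriminate]. exact (filterlim_comp _ _ _ phi INR _ _ _ H is_lim_seq_INR).
Qed.

Lemma div_R_scal (w : C) (r : R) : r <> 0%R -> w / r = RtoC (/ r) * w.
Proof. intros H. rewrite RtoC_inv by assumption. unfold Cdiv. ring. Qed.

Lemma is_Clim_seq_div_INR (w : C) (phi : nat -> nat) : filterlim phi eventually eventually ->
  (forall n, (0 < phi n)%nat) -> is_Clim_seq (fun n => w / INR (phi n)) 0.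
Proof.
  intros H Hpos. replace (RtoC 0) with (0 * w) by ring.
  apply (is_Clim_seq_ext (fun n => RtoC (/ INR (phi n)) * w)).
  - intros n. symmetry. now apply div_R_scal, not_0_INR, Nat.neq_0_lt_0.
  - apply is_Clim_seq_mult; [now apply is_Clim_seq_RtoC, is_lim_seq_inv_INR|apply is_Clim_seq_const].
Qed.

Lemma is_Clim_seq_difference_quotient (f : C -> C) (x l : C) (h : nat -> C) : is_derive f x l ->
  (forall n, h n <> 0) -> is_Clim_seq h 0 -> is_Clim_seq (fun n => (f (x + h n) - f x) / h n) l.
Proof.
  intros D Hh H. apply is_Clim_seq_spec. intros eps. pose proof (cond_pos eps).
  destruct (is_derive_remainder f x l (eps / 2) ltac:(lra) D) as (d & Hd & B).
  destruct (proj1 (is_Clim_seq_spec _ _) H (mkposreal d Hd)) as [N HN]. exists N. intros n Hn.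
  specialize (HN n Hn). simpl in HN. replace (h n - 0) with (h n) in HN by ring. specialize (B (h n) HN).
  assert (0 < Cmod (h n))%R by now apply Cmod_gt_0.
  replace ((f (x + h n) - f x) / h n - l) with ((f (x + h n) - f x - h n * l) / h n) by (field; apply Hh).
  rewrite Cmod_div by apply Hh. apply Rlt_div_l; [assumption|]. nra.
Qed.

Section LargeMultiplier.

Variable phi : nat -> nat.
Hypothesis phi_lim : filterlim phi eventually eventually.
Hypothesis phi_pos : forall n, (0 < phi n)%nat.

Let INR_phi_neq0 n : RtoC (INR (phi n)) <> 0.
Proof. now apply RtoC_neq0, not_0_INR, Nat.neq_0_lt_0. Qed.

Lemma is_Clim_seq_mult_1_minus_qpow (w : C) : w <> 0 ->
  is_Clim_seq (fun n => INR (phi n) * (1 - qpow 1 (w / INR (phi n)))) (- (RtoC (2 * PI) * i * w)).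
Proof.
  intros Hw. assert (Hwn : forall n, w / INR (phi n) <> 0).
  { intros n. apply Cmult_neq_0; [assumption|]. apply Cinv_neq0. apply INR_phi_neq0. }
  pose proof (is_Clim_seq_difference_quotient (qpow 1) 0 _ _ (is_derive_qpow 1 0) Hwn
    (is_Clim_seq_div_INR w phi phi_lim phi_pos)) as L.
  apply (is_Clim_seq_scal (- w)) in L. rewrite qpow_at_0, Rmult_1_r in L.
  replace (- (RtoC (2 * PI) * i * w)) with (- w * (RtoC (2 * PI) * i * 1)) by ring.
  eapply is_Clim_seq_ext; [|exact L]. intros n. cbv beta. rewrite Cplus_0_l.
  field. split; [apply INR_phi_neq0|assumption].
Qed.

Lemma is_Clim_seq_pi_cot_div (w : C) : w <> 0 -> (forall n, qpow 1 (w / INR (phi n)) <> 1) ->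
  is_Clim_seq (fun n => / INR (phi n) * pi_cot (w / INR (phi n))) (/ w).
Proof.
  intros Hw Hq. pose proof (is_Clim_seq_mult_1_minus_qpow w Hw) as L.
  assert (HPI : RtoC PI <> 0) by (apply RtoC_neq0; pose proof PI_RGT_0; lra).
  assert (Hl : - (RtoC (2 * PI) * i * w) <> 0).
  { rewrite RtoC_mult. intros E. apply (Cmult_neq_0 _ _ HPI Hw). apply (Cmult_reg_l (2 * i)).
    - intros E'. apply (f_equal Im) in E'. simpl in E'. lra.
    - transitivity (- - (2 * RtoC PI * i * w)); [ring|]. rewrite E. ring. }
  replace (/ w) with (- RtoC PI * i * ((1 + 1) * / (- (RtoC (2 * PI) * i * w)))).
  2:{ rewrite RtoC_mult in *. field. repeat split; try assumption; intros E; apply Hl; rewrite E; ring. }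
  apply (is_Clim_seq_ext (fun n => - RtoC PI * i * ((1 + qpow 1 (w / INR (phi n))) *
     / (INR (phi n) * (1 - qpow 1 (w / INR (phi n))))))).
  { intros n. unfold pi_cot. field. split; [|apply INR_phi_neq0].
    intros E. apply (Hq n). symmetry. now apply Cminus_diag_uniq. }
  apply is_Clim_seq_scal, is_Clim_seq_mult; [|now apply is_Clim_seq_inv].
  apply is_Clim_seq_plus; [apply is_Clim_seq_const|]. rewrite <- (qpow_at_0 1).
  now apply (is_Clim_seq_derivable (qpow 1) _ 0 _ (is_derive_qpow 1 0)), is_Clim_seq_div_INR.
Qed.

End LargeMultiplier.

Lemma sin_ge_div_8 u : (0 <= u <= 3 * (PI / 4))%R -> (u / 8 <= sin u)%R.
Proof.
  intros Hu. pose proof PI_4. pose proof PI_RGT_0. destruct (Rle_lt_dec u (PI / 3)) as [H1|H1].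
  - destruct (MVT_gen sin 0 u cos) as (c & Hc & E).
    + intros t _. apply is_derive_Reals, derivable_pt_lim_sin.
    + intros t _. apply continuity_sin.
    + rewrite Rmin_left, Rmax_right in Hc by lra.
      assert (1 / 2 <= cos c)%R by (rewrite <- cos_PI3; apply cos_decr_1; lra).
      rewrite sin_0, !Rminus_0_r in E. nra.
  - cut (1 / 2 <= sin u)%R; [lra|]. rewrite <- sin_PI6. destruct (Rle_lt_dec u (PI / 2)).
    + apply sin_incr_1; lra.
    + rewrite <- (sin_PI_x u). apply sin_incr_1; lra.
Qed.

Lemma Rabs_sin_PI_mult_ge a : (Rabs a <= 3 / 4)%R -> (Rabs a / 4 <= Rabs (sin (PI * a)))%R.
Proof.
  intros H. pose proof PI2_3_2. pose proof (Rabs_pos a).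
  assert (L : (PI * Rabs a / 8 <= sin (PI * Rabs a))%R) by (apply sin_ge_div_8; nra).
  assert (E : Rabs (sin (PI * a)) = Rabs (sin (PI * Rabs a))).
  { unfold Rabs at 3. destruct (Rcase_abs a); [|reflexivity].
    now rewrite Ropp_mult_distr_r_reverse, sin_neg, Rabs_Ropp. }
  assert (3 * Rabs a <= PI * Rabs a)%R by (apply Rmult_le_compat_r; lra). rewrite E, (Rabs_pos_eq (sin _)); lra.
Qed.

Lemma Cmod_1_minus_qpow_sqr (w : C) :
  (Cmod (1 - qpow 1 w)%C ^ 2 =
   (1 - exp (- (2 * PI * Im w))) ^ 2 + 4 * exp (- (2 * PI * Im w)) * sin (PI * Re w) ^ 2)%R.
Proof.
  set (rho := exp (- (2 * PI * Im w))).
  assert (E : qpow 1 w = (rho * cos (2 * (PI * Re w)), rho * sin (2 * (PI * Re w)))%R).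
  { rewrite qpowE. unfold cexp. replace (Re (RtoC (2 * PI * 1) * i * w)) with (- (2 * PI * Im w))%R.
    - replace (Im (RtoC (2 * PI * 1) * i * w)) with (2 * (PI * Re w))%R; [reflexivity|].
      destruct w as [x y]; unfold Cmult, RtoC, i; simpl; ring.
    - destruct w as [x y]; unfold Cmult, RtoC, i; simpl; ring. }
  rewrite Cmod2_alt, E. set (a := (PI * Re w)%R).
  transitivity ((1 + - (rho * cos (2 * a))) ^ 2 + (0 + - (rho * sin (2 * a))) ^ 2)%R; [reflexivity|].
  rewrite cos_2a_sin, sin_2a. pose proof (sin2_cos2 a) as Q. unfold Rsqr in Q.
  replace ((0 + - (rho * (2 * sin a * cos a))) ^ 2)%R with (4 * rho ^ 2 * sin a ^ 2 * (cos a * cos a))%R by ring.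
  replace (cos a * cos a)%R with (1 - sin a * sin a)%R by lra. ring.
Qed.

Lemma Cmod_1_minus_qpow_ge (w : C) : (Rabs (Re w) <= 3 / 4)%R -> (0 <= Im w)%R ->
  (exp (- (2 * PI * Im w)) * Cmod w / 4 <= Cmod (1 - qpow 1 w)%C)%R.
Proof.
  intros Ha Hb. apply Rsqr_incr_0_var; [|apply Cmod_ge_0]. rewrite !Rsqr_pow2, Cmod_1_minus_qpow_sqr.
  pose proof (Rabs_sin_PI_mult_ge _ Ha) as S. set (a := Re w) in *. set (b := Im w) in *.
  set (rho := exp (- (2 * PI * b))). pose proof PI2_3_2.
  assert (Hr0 : (0 < rho)%R) by apply exp_pos.
  assert (Hr1 : (rho <= 1)%R) by (unfold rho; rewrite <- exp_0; apply exp_le_compat; nra).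
  assert (Hr : (rho * b <= 1 - rho)%R).
  { unfold rho. rewrite exp_Ropp. pose proof (exp_ineq1_le (2 * PI * b)). pose proof (exp_pos (2 * PI * b)).
    apply Rmult_le_reg_l with (exp (2 * PI * b)); [assumption|].
    replace (exp (2 * PI * b) * (/ exp (2 * PI * b) * b))%R with b by (field; lra).
    rewrite Rmult_minus_distr_l, Rinv_r by lra. nra. }
  replace ((rho * Cmod w / 4) ^ 2)%R with (rho ^ 2 * Cmod w ^ 2 / 16)%R by field. rewrite Cmod2_alt. fold a b.
  rewrite <- (pow2_abs a), <- (pow2_abs (sin (PI * a))). pose proof (Rabs_pos a).
  assert (B1 : ((rho * b) ^ 2 <= (1 - rho) ^ 2)%R) by (apply pow_incr; nra).
  assert (B2 : ((Rabs a / 4) ^ 2 <= Rabs (sin (PI * a)) ^ 2)%R) by (apply pow_incr; lra).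
  assert (B3 : (rho ^ 2 * Rabs a ^ 2 <= rho * Rabs a ^ 2)%R).
  { apply Rmult_le_compat_r; [apply pow2_ge_0|]. nra. }
  pose proof (pow2_ge_0 (rho * b)). nra.
Qed.

Lemma ex_series_inv_sqr_scal (A : R) : ex_series (fun k => A * / INR (S k) ^ 2)%R.
Proof.
  apply (ex_series_scal_l A (fun k => / INR (S k) ^ 2)%R).
  apply ex_series_le_nonneg with (fun k => 2 * (/ INR (S k) - / INR (S (S k))))%R.
  - intros k. rewrite (S_INR (S k)). set (x := INR (S k)).
    assert (1 <= x)%R by (unfold x; rewrite S_INR; pose proof (pos_INR k); lra).
    split; [apply Rlt_le, Rinv_0_lt_compat; nra|].
    replace (2 * (/ x - / (x + 1)))%R with (/ (x * (x + 1) / 2))%R by (field; lra).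
    apply Rinv_le_contravar; nra.
  - exists 2%R. apply is_series_RtoC, is_series_Csum.
    apply (is_Clim_seq_ext (fun n => RtoC (2 - 2 * / INR (S n)))).
    + induction n as [|n IH]; [simpl; f_equal; field|]. cbn [Csum]. rewrite <- IH, <- RtoC_plus. f_equal. ring.
    + apply is_Clim_seq_RtoC. replace (Finite 2) with (Finite (2 - 2 * 0))%R by (f_equal; ring).
      apply is_lim_seq_minus'; [apply is_lim_seq_const|]. apply (is_lim_seq_scal_l _ 2 0).
      apply is_lim_seq_inv_INR, eventually_subseq. intros; lia.
Qed.

Definition cot_pair (w : C) (k : nat) : C := / (w + INR (S k)) + / (w - INR (S k)).

Section CotangentPartialFractions.

Variable w : C.
Hypothesis Hw : UHP w.

Variable M0 : nat.
Hypothesis M0_large : (2 * Rabs (Re w) <= INR M0)%R.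

Let N n := (2 * (M0 + n) + 1)%nat.

Let INR_N n : INR (N n) = (2 * (INR M0 + INR n) + 1)%R.
Proof. unfold N. rewrite plus_INR, mult_INR, plus_INR. simpl. ring. Qed.

Let N_pos n : (0 < INR (N n))%R.
Proof. apply lt_0_INR. unfold N. lia. Qed.

Let N_lim : filterlim N eventually eventually.
Proof. apply eventually_subseq. unfold N. intros; lia. Qed.

Let N_neq0 n : RtoC (INR (N n)) <> 0.
Proof. apply RtoC_neq0. pose proof (N_pos n). lra. Qed.

Let qpow_1_UHP_neq_1 z : UHP z -> qpow 1 z <> 1.
Proof. intros Hz E. pose proof (Cmod_qpow_1_lt_1 z Hz) as B. rewrite E, Cmod_1 in B. lra. Qed.

Let UHP_div_N z n : UHP z -> UHP (z / INR (N n)).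
Proof.
  intros Hz. rewrite div_R_scal by (pose proof (N_pos n); lra). apply UHP_scal; [|assumption].
  apply Rinv_0_lt_compat, N_pos.
Qed.

(* The terms of [pi_cot_finite_partial_fractions], dominated by a multiple of [1/(k+1)^2]. *)
Let cot_term (n k : nat) : C := if (k <? M0 + n)%nat then
  / INR (N n) * (pi_cot ((w + INR (S k)) / INR (N n)) + pi_cot ((w - INR (S k)) / INR (N n))) else 0.

Let cot_term_lim k : is_Clim_seq (fun n => cot_term n k) (cot_pair w k).
Proof.
  assert (L : forall s : R, is_Clim_seq (fun n => / INR (N n) * pi_cot ((w + s) / INR (N n))) (/ (w + s))).
  { intros s. apply is_Clim_seq_pi_cot_div; [exact N_lim|intros n; unfold N; lia|now apply UHP_plus_R_neq0|].
    intros n. now apply qpow_1_UHP_neq_1, UHP_div_N, UHP_plus_R. }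
  apply (is_Clim_seq_ext_loc (fun n => / INR (N n) * pi_cot ((w + INR (S k)) / INR (N n)) +
    / INR (N n) * pi_cot ((w + RtoC (- INR (S k))) / INR (N n))) _ _ (S k)).
  - intros n Hn. unfold cot_term. rewrite (proj2 (Nat.ltb_lt _ _)), RtoC_opp by lia. unfold Cminus. ring.
  - unfold cot_pair, Cminus. rewrite <- RtoC_opp. apply is_Clim_seq_plus; apply L.
Qed.

Let pi_cot_sum n : pi_cot w = / INR (N n) * pi_cot (w / INR (N n)) + CSeries (cot_term n).
Proof.
  rewrite (CSeries_fin _ (M0 + n)) by (intros k Hk; unfold cot_term; now rewrite (proj2 (Nat.ltb_ge _ _))).
  rewrite (pi_cot_finite_partial_fractions w (M0 + n)) by now apply qpow_1_UHP_neq_1.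
  fold (N n). rewrite Cmult_plus_distr_l, <- Csum_scal. f_equal. apply Csum_ext. intros k Hk.
  unfold cot_term. now rewrite (proj2 (Nat.ltb_lt _ _)).
Qed.

Variable dl : R.
Hypothesis dl_pos : (0 < dl)%R.
Hypothesis dl_lower : forall s : R, (dl * Rabs s <= Cmod (w + s)%C)%R.

Let rho := exp (- (2 * PI * Im w)).

Let denominator_lower n k (s : R) : (k < M0 + n)%nat -> Rabs s = INR (S k) ->
  (rho * dl * INR (S k) / (4 * INR (N n)) <= Cmod (1 - qpow 1 ((w + s) / INR (N n)))%C)%R.
Proof.
  intros Hk Hs. pose proof (N_pos n) as HN. unfold UHP in Hw.
  assert (HN1 : (1 <= INR (N n))%R) by (apply (le_INR 1); unfold N; lia).
  rewrite div_R_scal by lra. assert (Hi : (0 < / INR (N n))%R) by now apply Rinv_0_lt_compat.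
  assert (HIm : Im (w + s) = Im w) by (change (Im w + 0 = Im w)%R; ring).
  eapply Rle_trans; [|apply Cmod_1_minus_qpow_ge].
  - rewrite Im_scal_R, HIm, Cmod_mult, Cmod_R, Rabs_pos_eq by lra.
    specialize (dl_lower s). rewrite Hs in dl_lower.
    assert (Hrho : (rho <= exp (- (2 * PI * (/ INR (N n) * Im w))))%R).
    { apply exp_le_compat. pose proof PI_RGT_0.
      assert (/ INR (N n) <= 1)%R by (rewrite <- Rinv_1; apply Rinv_le_contravar; lra).
      assert (/ INR (N n) * Im w <= Im w)%R by nra. nra. }
    assert (0 < rho)%R by apply exp_pos.
    replace (rho * dl * INR (S k) / (4 * INR (N n)))%R with (rho * (/ INR (N n) * (dl * INR (S k))) / 4)%R by (field;
      lra).
    apply Rmult_le_compat_r; [lra|]. pose proof (pos_INR (S k)).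
    apply Rmult_le_compat; [lra| |assumption|apply Rmult_le_compat_l; lra].
    apply Rmult_le_pos; [lra|nra].
  - rewrite Re_scal_R, Rabs_mult, Rabs_pos_eq by lra. apply Rmult_le_reg_l with (INR (N n)); [assumption|].
    rewrite <- Rmult_assoc, Rinv_r, Rmult_1_l, INR_N by lra.
    change (Re (w + s)) with (Re w + s)%R. pose proof (Rabs_triang (Re w) s).
    assert (INR (S k) <= INR M0 + INR n)%R by (rewrite <- plus_INR; apply le_INR; lia).
    pose proof (pos_INR M0). pose proof (pos_INR n). lra.
  - rewrite Im_scal_R, HIm. nra.
Qed.

Let cot_term_le (B : R) n k : (0 <= B)%R ->
  (Cmod (INR (N n) * (1 - qpow 1 (2 * w / INR (N n))))%C <= B)%R ->
  (Cmod (cot_term n k) <= 32 * PI * B / (rho * dl) ^ 2 * / INR (S k) ^ 2)%R.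
Proof.
  intros HB0 HB. assert (HSk : (0 < INR (S k))%R) by (apply lt_0_INR; lia).
  assert (Hrho : (0 < rho)%R) by apply exp_pos. pose proof PI_RGT_0. pose proof (N_pos n) as HN. pose proof (N_neq0 n).
  assert (Hrd : (0 < rho * dl)%R) by nra.
  unfold cot_term. destruct (Nat.ltb_spec k (M0 + n)) as [Hk|Hk].
  2:{ rewrite Cmod_0. apply Rmult_le_pos; [apply Rmult_le_pos; [nra|]|]; apply Rlt_le, Rinv_0_lt_compat, pow_lt; lra. }
  pose proof (denominator_lower n k (INR (S k)) Hk (Rabs_pos_eq _ (Rlt_le _ _ HSk))) as L1.
  pose proof (denominator_lower n k (- INR (S k)) Hk ltac:(rewrite Rabs_Ropp; apply Rabs_pos_eq; lra)) as L2.
  rewrite RtoC_opp in L2. fold (w - INR (S k)) in L2.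
  set (e1 := qpow 1 ((w + INR (S k)) / INR (N n))) in *. set (e2 := qpow 1 ((w - INR (S k)) / INR (N n))) in *.
  assert (E12 : e1 * e2 = qpow 1 (2 * w / INR (N n))).
  { unfold e1, e2. rewrite <- qpow_Cplus. f_equal. field. assumption. }
  rewrite <- E12 in HB. set (lb := (rho * dl * INR (S k) / (4 * INR (N n)))%R) in *.
  assert (Hlb : (0 < lb)%R) by (unfold lb; apply Rdiv_lt_0_compat; nra).
  assert (N1 : 1 - e1 <> 0) by (apply Cmod_gt_0; lra). assert (N2 : 1 - e2 <> 0) by (apply Cmod_gt_0; lra).
  unfold pi_cot. fold e1 e2.
  replace (/ INR (N n) * (- RtoC PI * i * ((1 + e1) / (1 - e1)) + - RtoC PI * i * ((1 + e2) / (1 - e2)))) with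
    (- (2 * RtoC PI) * i * (/ (INR (N n) * INR (N n)) * (INR (N n) * (1 - e1 * e2))) * / ((1 - e1) * (1 - e2)))
    by (field; repeat split; assumption).
  rewrite 3 Cmod_mult, Cmod_opp, <- RtoC_mult, Cmod_R, Cmod_Ci, (Rabs_pos_eq (2 * PI)) by lra.
  rewrite (Cmod_mult (/ _)), !Cmod_inv, (Cmod_mult (1 - e1)), (Cmod_mult (INR (N n)) (INR (N n))), Cmod_INR
    by (apply Cmult_neq_0; assumption).
  apply Rle_trans with (2 * PI * 1 * (/ (INR (N n) * INR (N n)) * B) * / (lb * lb))%R.
  - assert (0 < / (INR (N n) * INR (N n)))%R by (apply Rinv_0_lt_compat; nra).
    apply Rmult_le_compat.
    + apply Rmult_le_pos; [lra|]. apply Rmult_le_pos; [lra|apply Cmod_ge_0].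
    + apply Rlt_le, Rinv_0_lt_compat, Rmult_lt_0_compat; lra.
    + apply Rmult_le_compat_l; [lra|]. apply Rmult_le_compat_l; lra.
    + apply Rinv_le_contravar; [nra|]. apply Rmult_le_compat; lra.
  - unfold lb. apply Req_le. field. repeat split; lra.
Qed.

Lemma pi_cot_partial_fractions_of_bounds : pi_cot w = / w + CSeries (cot_pair w).
Proof.
  assert (H2w : 2 * w <> 0) by (apply Cmult_neq_0; [apply RtoC_neq0; lra|now apply UHP_neq0]).
  assert (N_pos' : forall n, (0 < N n)%nat) by (intros; unfold N; lia).
  destruct (is_Clim_seq_bounded _ _ (is_Clim_seq_mult_1_minus_qpow N N_lim N_pos' _ H2w)) as [B HB].
  assert (HB0 : (0 <= B)%R) by (eapply Rle_trans; [apply Cmod_ge_0|apply (HB O)]).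
  apply (is_Clim_seq_unique (fun _ => pi_cot w)); [apply is_Clim_seq_const|].
  eapply is_Clim_seq_ext; [intros n; symmetry; apply pi_cot_sum|]. apply is_Clim_seq_plus.
  - apply is_Clim_seq_pi_cot_div; [exact N_lim|exact N_pos'|now apply UHP_neq0|].
    intros n. now apply qpow_1_UHP_neq_1, UHP_div_N.
  - eapply is_Clim_seq_CSeries_dominated; [|apply ex_series_inv_sqr_scal|exact cot_term_lim].
    intros n k. apply cot_term_le; [exact HB0|apply HB].
Qed.

End CotangentPartialFractions.

Lemma pi_cot_partial_fractions (w : C) : UHP w -> pi_cot w = / w + CSeries (cot_pair w).
Proof.
  intros Hw. destruct (INR_unbounded (2 * Rabs (Re w))) as [M0 HM0]. apply Rlt_le in HM0.
  destruct (UHP_plus_R_lower w Hw) as (dl & Hd & H). exact (pi_cot_partial_fractions_of_bounds w Hw M0 HM0 dl Hd H).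
Qed.

Lemma UHP_inv_plus_R_le (w : C) : UHP w -> exists A : R, (0 < A)%R /\ forall k,
  (Cmod (/ (w + INR (S k))) <= A / INR (S k) /\ Cmod (/ (w - INR (S k))) <= A / INR (S k))%R.
Proof.
  intros Hw. destruct (UHP_plus_R_lower w Hw) as (dl & Hd & H). exists (/ dl)%R.
  split; [now apply Rinv_0_lt_compat|]. intros k. assert (HS : (0 < INR (S k))%R) by (apply lt_0_INR; lia).
  assert (Hdl : (0 < dl * INR (S k))%R) by now apply Rmult_lt_0_compat.
  replace (/ dl / INR (S k))%R with (/ (dl * INR (S k)))%R by (field; lra).
  split.
  - rewrite Cmod_inv by now apply UHP_plus_R_neq0. apply Rinv_le_contravar; [assumption|].
    specialize (H (INR (S k))). rewrite Rabs_pos_eq in H by lra. exact H.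
  - rewrite Cmod_inv by now apply UHP_minus_R_neq0. apply Rinv_le_contravar; [assumption|].
    specialize (H (- INR (S k))%R). rewrite RtoC_opp, Rabs_Ropp, Rabs_pos_eq in H by lra. exact H.
Qed.

Lemma abs_summable_cot_pair (w : C) : UHP w -> abs_summable (cot_pair w).
Proof.
  intros Hw. destruct (UHP_inv_plus_R_le w Hw) as (A & HA & H).
  apply abs_summable_le with (fun k => 2 * Cmod w * A ^ 2 * / INR (S k) ^ 2)%R; [|apply ex_series_inv_sqr_scal].
  intros k. assert (HS : (0 < INR (S k))%R) by (apply lt_0_INR; lia). destruct (H k) as [B1 B2].
  replace (cot_pair w k) with (2 * w * (/ (w + INR (S k)) * / (w - INR (S k)))).
  2:{ unfold cot_pair. field. split; [now apply UHP_minus_R_neq0|now apply UHP_plus_R_neq0]. }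
  rewrite !Cmod_mult, Cmod_R, Rabs_pos_eq by lra.
  replace (2 * Cmod w * A ^ 2 * / INR (S k) ^ 2)%R with (2 * Cmod w * (A / INR (S k) * (A / INR (S k))))%R by (field;
    lra).
  apply Rmult_le_compat_l; [pose proof (Cmod_ge_0 w); lra|].
  apply Rmult_le_compat; try apply Cmod_ge_0; assumption.
Qed.

Definition inv_sqr_pair (w : C) (k : nat) : C :=
  / ((w + INR (S k)) * (w + INR (S k))) + / ((w - INR (S k)) * (w - INR (S k))).

Lemma Cmod_inv_sqr_le (a : C) (r : R) : a <> 0 -> (Cmod (/ a) <= r)%R -> (Cmod (/ (a * a)) <= r * r)%R.
Proof.
  intros Ha H. replace (/ (a * a)) with (/ a * / a) by now field. rewrite Cmod_mult.
  apply Rmult_le_compat; try apply Cmod_ge_0; assumption.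
Qed.

Lemma abs_summable_inv_sqr_pair (w : C) : UHP w -> abs_summable (inv_sqr_pair w).
Proof.
  intros Hw. destruct (UHP_inv_plus_R_le w Hw) as (A & HA & H).
  apply abs_summable_le with (fun k => 2 * A ^ 2 * / INR (S k) ^ 2)%R; [|apply ex_series_inv_sqr_scal].
  intros k. assert (HS : (0 < INR (S k))%R) by (apply lt_0_INR; lia). destruct (H k) as [B1 B2].
  eapply Rle_trans; [apply Cmod_triangle|].
  apply Cmod_inv_sqr_le in B1; [|now apply UHP_plus_R_neq0].
  apply Cmod_inv_sqr_le in B2; [|now apply UHP_minus_R_neq0].
  replace (2 * A ^ 2 * / INR (S k) ^ 2)%R with
    (A / INR (S k) * (A / INR (S k)) + A / INR (S k) * (A / INR (S k)))%R by (field; lra).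
  now apply Rplus_le_compat.
Qed.

Lemma Cmod_inv_taylor1_le (a h : C) (r s : R) : a <> 0 -> a + h <> 0 ->
  (Cmod (/ a) <= r)%R -> (Cmod (/ (a + h)) <= s)%R ->
  (Cmod (/ (a + h) - / a + h * / (a * a))%C <= r ^ 2 * s * Cmod h ^ 2)%R.
Proof.
  intros Ha Hah Hr Hs.
  replace (/ (a + h) - / a + h * / (a * a)) with (h * h * (/ (a * a) * / (a + h))) by now field.
  rewrite !Cmod_mult. replace (r ^ 2 * s * Cmod h ^ 2)%R with (Cmod h * Cmod h * (r * r * s))%R by ring.
  apply Rmult_le_compat_l; [pose proof (Cmod_ge_0 h); nra|].
  apply Rmult_le_compat; try apply Cmod_ge_0; [now apply Cmod_inv_sqr_le|assumption].
Qed.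

Lemma Cmod_inv_UHP_le (w : C) (r : R) : (0 < r <= Im w)%R -> (Cmod (/ w) <= / r)%R.
Proof.
  intros H. rewrite Cmod_inv by (apply UHP_neq0; unfold UHP; lra). apply Rinv_le_contravar; [lra|].
  eapply Rle_trans; [|apply im_le_Cmod]. rewrite Rabs_pos_eq; lra.
Qed.

Lemma is_derive_CSeries_cot_pair (w : C) : UHP w ->
  is_derive (fun w => CSeries (cot_pair w)) w (- CSeries (inv_sqr_pair w)).
Proof.
  intros Hw. destruct (UHP_inv_plus_R_le w Hw) as (A & HA & H). pose proof Hw as Hy. unfold UHP in Hy.
  replace (- CSeries (inv_sqr_pair w)) with (CSeries (fun k => - (1) * inv_sqr_pair w k))
    by (rewrite CSeries_scal by (now apply abs_summable_inv_sqr_pair); ring).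
  assert (Hopen : forall h, (Cmod h <= Im w / 2)%R -> UHP (w + h)) by (intros h Hh; apply UHP_open; [assumption|lra]).
  apply (is_derive_CSeries (fun k w => cot_pair w k) _ w (Im w / 2) (fun k => 2 * A ^ 2 * (2 / Im w) * / INR (S k) ^
    2)%R).
  - lra.
  - apply ex_series_inv_sqr_scal.
  - intros k. assert (0 < 2 / Im w)%R by (apply Rdiv_lt_0_compat; lra).
    apply Rmult_le_pos; [nra|]. apply Rlt_le, Rinv_0_lt_compat, pow_lt, lt_0_INR. lia.
  - intros h Hh. now apply abs_summable_cot_pair, Hopen.
  - now apply abs_summable_scal, abs_summable_inv_sqr_pair.
  - intros k h Hh. assert (HS : (0 < INR (S k))%R) by (apply lt_0_INR; lia). destruct (H k) as [B1 B2].
    assert (Hinv : forall s : R, (Cmod (/ (w + s + h)) <= 2 / Im w)%R).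
    { intros s. replace (2 / Im w)%R with (/ (Im w / 2))%R by (field; lra). apply Cmod_inv_UHP_le.
      change (Im (w + s + h)) with (Im w + 0 + Im h)%R.
      pose proof (im_le_Cmod h) as Q. apply Rabs_le_between in Q. lra. }
    replace (cot_pair (w + h) k - cot_pair w k - h * (- (1) * inv_sqr_pair w k)) with
      ((/ (w + INR (S k) + h) - / (w + INR (S k)) + h * / ((w + INR (S k)) * (w + INR (S k)))) +
       (/ (w - INR (S k) + h) - / (w - INR (S k)) + h * / ((w - INR (S k)) * (w - INR (S k))))).
    2:{ unfold cot_pair, inv_sqr_pair. replace (w + h + INR (S k)) with (w + INR (S k) + h) by ring.
        replace (w + h - INR (S k)) with (w - INR (S k) + h) by ring. ring. }
    eapply Rle_trans; [apply Cmod_triangle|].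
    replace (2 * A ^ 2 * (2 / Im w) * / INR (S k) ^ 2 * Cmod h ^ 2)%R with
      ((A / INR (S k)) ^ 2 * (2 / Im w) * Cmod h ^ 2 + (A / INR (S k)) ^ 2 * (2 / Im w) * Cmod h ^ 2)%R by (field; lra).
    apply Rplus_le_compat; apply Cmod_inv_taylor1_le; try assumption.
    + now apply UHP_plus_R_neq0.
    + replace (w + INR (S k) + h) with (w + h + INR (S k)) by ring. now apply UHP_plus_R_neq0, Hopen.
    + apply Hinv.
    + now apply UHP_minus_R_neq0.
    + replace (w - INR (S k) + h) with (w + h - INR (S k)) by ring. now apply UHP_minus_R_neq0, Hopen.
    + unfold Cminus. rewrite <- RtoC_opp. apply Hinv.
Qed.

(* This is [(pi / sin (pi w))^2]. *)
Definition pi_csc_sqr (w : C) : C := - (RtoC (4 * PI ^ 2) * (qpow 1 w / ((1 - qpow 1 w) * (1 - qpow 1 w)))).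

Lemma Ci_sqr : i * i = - (1).
Proof. unfold i, Cmult, Copp, RtoC; simpl. f_equal; ring. Qed.

Lemma Ci_neq0 : i <> 0.
Proof. intros E. apply (f_equal Cmod) in E. rewrite Cmod_Ci, Cmod_0 in E. lra. Qed.

Lemma is_derive_pi_cot (w : C) : UHP w -> is_derive pi_cot w (- pi_csc_sqr w).
Proof.
  intros Hw. pose proof (Cmod_qpow_1_lt_1 w Hw) as Hq. pose proof (Cminus_1_neq0 _ Hq).
  apply (is_derive_ext_UHP (fun w => - RtoC PI * i * (2 * (/ (1 - qpow 1 w)) - 1))); [assumption| |].
  - intros v Hv. unfold pi_cot. field. now apply Cminus_1_neq0, Cmod_qpow_1_lt_1.
  - eapply is_derive_eq.
    + apply is_derive_Cscal, is_derive_Cminus; [|apply is_derive_Cconst]. apply is_derive_Cscal.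
      apply (is_derive_Ccomp (fun y => / (1 - y)) (qpow 1)); [now apply is_derive_inv_1_minus|apply is_derive_qpow].
    + unfold pi_csc_sqr. replace (RtoC (4 * PI ^ 2)) with (- (i * i) * (4 * RtoC PI * RtoC PI)).
      * rewrite Rmult_1_r, RtoC_mult. field. assumption.
      * rewrite Ci_sqr, RtoC_mult, RtoC_pow. ring.
Qed.

Lemma pi_csc_sqr_partial_fractions (w : C) : UHP w -> pi_csc_sqr w = / (w * w) + CSeries (inv_sqr_pair w).
Proof.
  intros Hw. assert (E : - pi_csc_sqr w = - / (w * w) + - CSeries (inv_sqr_pair w)).
  { apply (is_derive_Cunique pi_cot w); [now apply is_derive_pi_cot|].
    apply (is_derive_ext_UHP (fun w => / w + CSeries (cot_pair w))); [assumption| |].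
    - intros v Hv. symmetry. now apply pi_cot_partial_fractions.
    - apply is_derive_Cplus; [now apply is_derive_Cinv, UHP_neq0|now apply is_derive_CSeries_cot_pair]. }
  replace (pi_csc_sqr w) with (- - pi_csc_sqr w) by ring. rewrite E. ring.
Qed.

(** * The value of [zeta(2)] *)

Definition zeta2 : R := Series (fun k => / INR (S k) ^ 2)%R.

Lemma Csum_pairs f n : Csum f (2 * n) = Csum (fun k => f (2 * k)%nat + f (2 * k + 1)%nat) n.
Proof.
  induction n as [|n IH]; [reflexivity|].
  replace (2 * S n)%nat with (S (S (2 * n))) by lia. cbn [Csum]. rewrite IH.
  replace (S (2 * n)) with (2 * n + 1)%nat by lia. ring.
Qed.

Lemma is_series_pairs (f : nat -> C) (l : C) : is_series f l ->
  is_series (fun n => f (2 * n)%nat + f (2 * n + 1)%nat) l.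
Proof.
  rewrite !is_series_Csum. intros H. eapply is_Clim_seq_ext; [intros n; apply Csum_pairs|].
  apply (is_Clim_seq_subseq _ (fun n => (2 * n)%nat)); [|exact H]. apply eventually_subseq. intros; lia.
Qed.

Lemma is_series_zeta2 : is_series (fun k => RtoC (/ INR (S k) ^ 2)) (RtoC zeta2).
Proof.
  apply is_series_RtoC, Series_correct. eapply ex_series_ext; [|exact (ex_series_inv_sqr_scal 1)].
  intros k. apply Rmult_1_l.
Qed.

Lemma is_series_inv_odd_sqr : is_series (fun k => RtoC (/ INR (2 * k + 1) ^ 2)) (RtoC (3 / 4 * zeta2)).
Proof.
  pose proof (is_series_Cminus _ _ _ _ (is_series_pairs _ _ is_series_zeta2) (is_series_Cscal (RtoC (/ 4)) _ _
    is_series_zeta2)) as H.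
  replace (RtoC (3 / 4 * zeta2)) with (RtoC zeta2 - RtoC (/ 4) * RtoC zeta2)
    by (rewrite <- RtoC_mult, <- RtoC_minus; f_equal; field).
  eapply is_series_Cext; [|exact H]. intros k. cbv beta. rewrite <- RtoC_mult, <- RtoC_plus, <- RtoC_minus. f_equal.
  replace (S (2 * k)) with (2 * k + 1)%nat by lia. replace (INR (S (2 * k + 1))) with (2 * INR (S k))%R.
  - field. split; apply not_0_INR; lia.
  - rewrite !S_INR, plus_INR, mult_INR. simpl (INR 2). simpl (INR 1). ring.
Qed.

Lemma half_plus_INR (k : nat) : RtoC (1 / 2) + INR (S k) = RtoC (INR (2 * S k + 1) / 2).
Proof. rewrite <- RtoC_plus. f_equal. rewrite plus_INR, mult_INR. simpl (INR 2). simpl (INR 1). field. Qed.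

Lemma half_minus_INR (k : nat) : RtoC (1 / 2) - INR (S k) = - RtoC (INR (2 * k + 1) / 2).
Proof.
  rewrite <- RtoC_minus, <- RtoC_opp. f_equal. rewrite plus_INR, mult_INR, S_INR. simpl (INR 2). simpl (INR 1). field.
Qed.

Lemma CSeries_inv_sqr_pair_half : 4 + CSeries (inv_sqr_pair (RtoC (1 / 2))) = 6 * RtoC zeta2.
Proof.
  pose proof is_series_inv_odd_sqr as H.
  assert (H1 : is_series (fun k => RtoC (/ INR (2 * S k + 1) ^ 2)) (RtoC (3 / 4 * zeta2) - 1)).
  { apply (is_series_incr_Csum (fun k => RtoC (/ INR (2 * k + 1) ^ 2)) 1).
    assert (E : RtoC (/ INR (2 * 0 + 1) ^ 2) = 1) by (simpl; f_equal; field). cbn [Csum]. rewrite E.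
    replace (0 + 1 + _) with (RtoC (3 / 4 * zeta2)) by ring. exact H. }
  pose proof (is_series_Cscal 4 _ _ (is_series_Cplus _ _ _ _ H1 H)) as HS. cbv beta in HS.
  rewrite (CSeries_unique (inv_sqr_pair (RtoC (1 / 2))) (4 * (RtoC (3 / 4 * zeta2) - 1 + RtoC (3 / 4 * zeta2)))).
  - rewrite RtoC_mult, RtoC_div by lra. field.
  - eapply is_series_Cext; [|exact HS]. intros k. unfold inv_sqr_pair. rewrite half_plus_INR, half_minus_INR.
    pose proof (lt_0_INR (2 * S k + 1) ltac:(lia)). pose proof (lt_0_INR (2 * k + 1) ltac:(lia)).
    rewrite <- RtoC_opp, <- !RtoC_mult, <- !RtoC_inv, <- !RtoC_plus, <- RtoC_mult by nra.
    f_equal. field. split; lra.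
Qed.

Lemma inv_sqr_pair_bound (w : C) k : UHP w -> Re w = (1 / 2)%R ->
  (Cmod (inv_sqr_pair w k) <= 8 * / INR (S k) ^ 2)%R.
Proof.
  intros Hw HR. assert (HS : (1 <= INR (S k))%R) by (apply (le_INR 1); lia).
  assert (B1 : (Cmod (/ (w + INR (S k))) <= / (INR (S k) / 2))%R).
  { rewrite Cmod_inv by now apply UHP_plus_R_neq0. apply Rinv_le_contravar; [lra|].
    eapply Rle_trans; [|apply re_le_Cmod]. change (Re (w + INR (S k))) with (Re w + INR (S k))%R.
    rewrite HR, Rabs_pos_eq; lra. }
  assert (B2 : (Cmod (/ (w - INR (S k))) <= / (INR (S k) / 2))%R).
  { rewrite Cmod_inv by now apply UHP_minus_R_neq0. apply Rinv_le_contravar; [lra|].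
    eapply Rle_trans; [|apply re_le_Cmod]. change (Re (w - INR (S k))) with (Re w + - INR (S k))%R.
    rewrite HR, Rabs_left1; lra. }
  apply Cmod_inv_sqr_le in B1; [|now apply UHP_plus_R_neq0].
  apply Cmod_inv_sqr_le in B2; [|now apply UHP_minus_R_neq0].
  eapply Rle_trans; [apply Cmod_triangle|].
  replace (8 * / INR (S k) ^ 2)%R with (/ (INR (S k) / 2) * / (INR (S k) / 2) + / (INR (S k) / 2) * / (INR (S k) / 2))%R
    by (field; lra).
  now apply Rplus_le_compat.
Qed.

Lemma is_Clim_seq_inv_sqr_pair (w : nat -> C) (l : C) k : is_Clim_seq w l ->
  l + INR (S k) <> 0 -> l - INR (S k) <> 0 -> is_Clim_seq (fun n => inv_sqr_pair (w n) k) (inv_sqr_pair l k).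
Proof.
  intros L N1 N2. apply is_Clim_seq_plus; (apply is_Clim_seq_inv; [now apply Cmult_neq_0|]); apply is_Clim_seq_mult;
    (apply is_Clim_seq_plus || apply is_Clim_seq_minus); try exact L; apply is_Clim_seq_const.
Qed.

Lemma is_Clim_seq_pi_csc_sqr (w : nat -> C) (l : C) : is_Clim_seq w l -> qpow 1 l <> 1 ->
  is_Clim_seq (fun n => pi_csc_sqr (w n)) (pi_csc_sqr l).
Proof.
  intros L Hl. assert (Lq : is_Clim_seq (fun n => qpow 1 (w n)) (qpow 1 l))
    by exact (is_Clim_seq_derivable (qpow 1) w _ _ (is_derive_qpow 1 l) L).
  assert (L1 : is_Clim_seq (fun n => 1 - qpow 1 (w n)) (1 - qpow 1 l))
    by (apply is_Clim_seq_minus; [apply is_Clim_seq_const|exact Lq]).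
  assert (H1 : 1 - qpow 1 l <> 0) by (intros E; apply Hl; symmetry; now apply Cminus_diag_uniq).
  apply is_Clim_seq_opp, is_Clim_seq_scal, is_Clim_seq_mult; [exact Lq|].
  apply is_Clim_seq_inv; [now apply Cmult_neq_0|now apply is_Clim_seq_mult].
Qed.

Lemma pi_csc_sqr_half : pi_csc_sqr (RtoC (1 / 2)) = RtoC (PI ^ 2) /\ qpow 1 (RtoC (1 / 2)) = - (1).
Proof.
  assert (E : qpow 1 (RtoC (1 / 2)) = - (1)).
  { rewrite qpow_R. replace (2 * PI * (1 * (1 / 2)))%R with PI by field.
    rewrite cexp_Ci, cos_PI, sin_PI. unfold Copp, RtoC; simpl. f_equal; ring. }
  split; [|exact E]. unfold pi_csc_sqr. rewrite E, RtoC_mult. field.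
Qed.

(* Let [w = 1/2 + i t] tend to [1/2] in [pi_csc_sqr_partial_fractions]. *)
Lemma zeta2_eq : zeta2 = (PI ^ 2 / 6)%R.
Proof.
  set (w := fun n => RtoC (1 / 2) + RtoC (/ INR (S n)) * i).
  assert (Uw : forall n, UHP (w n)).
  { intros n. unfold UHP, w. rewrite <- (Rplus_0_l 0). apply Rplus_le_lt_compat; [apply Rle_refl|].
    rewrite Im_scal_R. simpl (Im i). rewrite Rmult_1_r. apply Rinv_0_lt_compat, lt_0_INR. lia. }
  assert (Rw : forall n, Re (w n) = (1 / 2)%R).
  { intros n. change (1 / 2 + Re (RtoC (/ INR (S n)) * i) = 1 / 2)%R. rewrite Re_scal_R. simpl (Re i). ring. }
  assert (Lw : is_Clim_seq w (RtoC (1 / 2))).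
  { replace (RtoC (1 / 2)) with (RtoC (1 / 2) + 0 * i) by ring. apply is_Clim_seq_plus; [apply is_Clim_seq_const|].
    apply is_Clim_seq_mult; [|apply is_Clim_seq_const].
    apply is_Clim_seq_RtoC, is_lim_seq_inv_INR, eventually_subseq. intros; lia. }
  assert (L2 : RtoC 4 = / (RtoC (1 / 2) * RtoC (1 / 2))) by (rewrite <- RtoC_mult, <- RtoC_inv by lra; f_equal; field).
  destruct pi_csc_sqr_half as [Ecsc Eq].
  assert (E : 4 + CSeries (inv_sqr_pair (RtoC (1 / 2))) = RtoC (PI ^ 2)).
  { rewrite <- Ecsc. apply (is_Clim_seq_unique (fun n => pi_csc_sqr (w n))).
    - eapply is_Clim_seq_ext; [intros n; symmetry; now apply pi_csc_sqr_partial_fractions|].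
      apply is_Clim_seq_plus.
      + rewrite L2. apply is_Clim_seq_inv; [|now apply is_Clim_seq_mult].
        rewrite <- RtoC_mult. apply RtoC_neq0. lra.
      + eapply is_Clim_seq_CSeries_dominated; [|apply (ex_series_inv_sqr_scal 8)|].
        * intros n k. now apply inv_sqr_pair_bound.
        * intros k. pose proof (lt_0_INR (2 * S k + 1) ltac:(lia)). pose proof (lt_0_INR (2 * k + 1) ltac:(lia)).
          apply is_Clim_seq_inv_sqr_pair; [exact Lw|rewrite half_plus_INR|rewrite half_minus_INR, <- RtoC_opp];
            apply RtoC_neq0; lra.
    - apply is_Clim_seq_pi_csc_sqr; [exact Lw|]. rewrite Eq. intros Z0. apply (f_equal Re) in Z0. simpl in Z0. lra. }
  rewrite CSeries_inv_sqr_pair_half, <- RtoC_mult in E. apply RtoC_inj in E. lra.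
Qed.

(** * The weight 2 Eisenstein series and the inversion formula for eta *)

Lemma Im_neg_inv (z : C) : z <> 0 -> Im (- / z) = (Im z / Cmod z ^ 2)%R.
Proof.
  intros H. assert (H2 : (Cmod z ^ 2 <> 0)%R) by (apply pow_nonzero; intros E; apply H; now apply Cmod_eq_0).
  rewrite Cmod2_alt in *. destruct z as [x y]. unfold Cinv, Copp in *; simpl in *. field.
  intros E. apply H2. rewrite <- E. ring.
Qed.

Lemma UHP_neg_inv (z : C) : UHP z -> UHP (- / z).
Proof.
  intros H. pose proof (UHP_neq0 z H). unfold UHP in *. rewrite Im_neg_inv by assumption.
  apply Rdiv_lt_0_compat; [assumption|]. apply pow_lt. now apply Cmod_gt_0.
Qed.

(* [1/(W - 1/2) - 1/(W + 1/2)] is a telescoping approximation of [1/W^2]. *)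
Lemma Cmod_inv_sqr_minus_telescoping_le (W : C) (r : R) : (0 < r)%R -> (r <= Cmod W)%R ->
  (r <= Cmod (W - RtoC (/ 2))%C)%R -> (r <= Cmod (W + RtoC (/ 2))%C)%R ->
  (Cmod (/ (W * W) - (/ (W - RtoC (/ 2)) - / (W + RtoC (/ 2))))%C <= / 4 * / r ^ 4)%R.
Proof.
  intros Hr L0 L1 L2. set (h := RtoC (/ 2)) in *.
  assert (N0 : W <> 0) by (apply Cmod_gt_0; lra). assert (N1 : W - h <> 0) by (apply Cmod_gt_0; lra).
  assert (N2 : W + h <> 0) by (apply Cmod_gt_0; lra).
  assert (Eh : h + h = 1) by (unfold h; rewrite <- RtoC_plus; f_equal; field).
  replace (/ (W * W) - (/ (W - h) - / (W + h))) with (- (h * h) * / (W * W * ((W - h) * (W + h)))).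
  2:{ replace (/ (W - h) - / (W + h)) with ((h + h) * / ((W - h) * (W + h))) by (field; split; assumption).
      rewrite Eh. field. repeat split; assumption. }
  rewrite Cmod_mult, Cmod_opp, Cmod_inv by (repeat apply Cmult_neq_0; assumption).
  unfold h at 1 2. rewrite !Cmod_mult, Cmod_R, Rabs_pos_eq by lra.
  replace (/ 2 * / 2)%R with (/ 4)%R by field. apply Rmult_le_compat_l; [lra|].
  replace (r ^ 4)%R with (r * r * (r * r))%R by ring.
  apply Rinv_le_contravar; [repeat apply Rmult_lt_0_compat; assumption|].
  apply Rmult_le_compat; try nra; apply Rmult_le_compat; lra.
Qed.

Lemma is_Clim_seq_inv_arith (a b : C) : b <> 0 -> is_Clim_seq (fun n => / (a + INR n * b)) 0.
Proof.
  intros Hb. assert (Hbm : (0 < Cmod b)%R) by now apply Cmod_gt_0.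
  apply is_Clim_seq_spec. intros eps. pose proof (cond_pos eps).
  destruct (INR_unbounded ((Cmod a + 2 / eps) / Cmod b)) as [N HN]. exists N. intros n Hn.
  replace (/ (a + INR n * b) - 0) with (/ (a + INR n * b)) by ring.
  assert (INR N <= INR n)%R by now apply le_INR.
  assert (0 < / eps)%R by now apply Rinv_0_lt_compat.
  assert (L : (/ eps < Cmod (a + INR n * b))%R).
  { replace (a + INR n * b) with (INR n * b - - a) by ring. pose proof (Cmod_minus_ge (INR n * b) (- a)) as B.
    rewrite Cmod_opp, Cmod_mult, Cmod_INR in B. apply Rlt_div_l in HN; [|assumption].
    assert (INR N * Cmod b <= INR n * Cmod b)%R by (apply Rmult_le_compat_r; lra). unfold Rdiv in HN. lra. }
  rewrite Cmod_inv by (apply Cmod_gt_0; lra). rewrite <- (Rinv_inv eps).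
  apply Rinv_lt_contravar; [|exact L]. apply Rmult_lt_0_compat; lra.
Qed.

Lemma is_Clim_seq_pow_0 (x : C) : (Cmod x < 1)%R -> is_Clim_seq (fun n => x ^ n) 0.
Proof.
  intros H. apply is_Clim_seq_squeeze with (fun n => Cmod x ^ n)%R.
  - intros n. replace (x ^ n - 0) with (x ^ n) by ring. rewrite Cmod_pow. lra.
  - apply is_lim_seq_geom. rewrite Rabs_pos_eq; [assumption|apply Cmod_ge_0].
Qed.

(* Its value is [G_2(w) / 2 - zeta(2)]: the sum of [1/(m w + n)^2] over [m > 0] and then all [n]. *)
Definition half_G2 (w : C) : C := CSeries (fun m => pi_csc_sqr (INR (S m) * w)).

Lemma pi_csc_sqr_INR_mult (w : C) m : pi_csc_sqr (INR (S m) * w) =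
  - RtoC (4 * PI ^ 2) * (qpow 1 w ^ S m / ((1 - qpow 1 w ^ S m) * (1 - qpow 1 w ^ S m))).
Proof. unfold pi_csc_sqr. rewrite qpow_scal, Rmult_1_l, qpow_INR. ring. Qed.

Lemma abs_summable_half_G2 (w : C) : UHP w -> abs_summable (fun m => pi_csc_sqr (INR (S m) * w)).
Proof.
  intros Hw. eapply abs_summable_ext; [intros m; symmetry; apply pi_csc_sqr_INR_mult|].
  apply abs_summable_scal. now apply CSeries_pow_div_sqr, Cmod_qpow_1_lt_1.
Qed.

Lemma is_derive_neg_log_eta_prod_G2 (w : C) : UHP w ->
  is_derive neg_log_eta_prod w (- (i / (2 * RtoC PI)) * half_G2 w).
Proof.
  intros Hw. assert (RtoC PI <> 0) by (apply RtoC_neq0; pose proof PI_RGT_0; lra).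
  eapply is_derive_eq; [now apply is_derive_neg_log_eta_prod|]. unfold half_G2.
  rewrite (CSeries_ext _ _ (pi_csc_sqr_INR_mult w)), CSeries_scal by (now apply CSeries_pow_div_sqr, Cmod_qpow_1_lt_1).
  rewrite !RtoC_mult, RtoC_pow. field. assumption.
Qed.

Section EisensteinInversion.

Variable z : C.
Hypothesis Hz : UHP z.

Let z' : C := - / z.
Let Hz' : UHP z' := UHP_neg_inv z Hz.
Let z_neq0 : z <> 0 := UHP_neq0 z Hz.

Let UHP_mult m : UHP (INR (S m) * z).
Proof. apply UHP_scal; [apply lt_0_INR; lia|exact Hz]. Qed.

Let UHP_INR_mult_neg_inv m : UHP (INR (S m) * z').
Proof. apply UHP_scal; [apply lt_0_INR; lia|exact Hz']. Qed.

Let boundary (m : nat) (x : R) : C := / (INR (S m) * z - x) - / (INR (S m) * z + x).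

(* The double series of the [1/(m z + n)^2 + 1/(m z - n)^2] converges absolutely after subtraction of a telescoping
   series in [n]. *)
Let regularized (m n : nat) : C :=
  inv_sqr_pair (INR (S m) * z) n - (boundary m (INR (S n) + / 2) - boundary m (INR (S n) - / 2)).

Let regularized_split m n : let Wp := INR (S m) * z + INR (S n) in let Wm := INR (S m) * z - INR (S n) in
  regularized m n = (/ (Wp * Wp) - (/ (Wp - RtoC (/ 2)) - / (Wp + RtoC (/ 2)))) +
    (/ (Wm * Wm) - (/ (Wm - RtoC (/ 2)) - / (Wm + RtoC (/ 2)))).
Proof.
  intros Wp Wm. unfold regularized, inv_sqr_pair, boundary. fold Wp Wm. rewrite RtoC_plus, RtoC_minus.
  replace (INR (S m) * z - (INR (S n) + RtoC (/ 2))) with (Wm - RtoC (/ 2)) by (unfold Wm; ring).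
  replace (INR (S m) * z + (INR (S n) + RtoC (/ 2))) with (Wp + RtoC (/ 2)) by (unfold Wp; ring).
  replace (INR (S m) * z - (INR (S n) - RtoC (/ 2))) with (Wm + RtoC (/ 2)) by (unfold Wm; ring).
  replace (INR (S m) * z + (INR (S n) - RtoC (/ 2))) with (Wp - RtoC (/ 2)) by (unfold Wp; ring). ring.
Qed.

Let regularized_bound : exists A : R, (0 <= A)%R /\
  forall m n, (Cmod (regularized m n) <= A * / INR (S m) ^ 2 * / INR (S n) ^ 2)%R.
Proof.
  destruct (UHP_lattice_lower z Hz) as (dl & Hd & H). pose proof (pow_lt dl 4 Hd) as Hd4.
  exists (/ dl ^ 4)%R. split; [now apply Rlt_le, Rinv_0_lt_compat|]. intros m n.
  assert (Hm : (1 <= INR (S m))%R) by (apply (le_INR 1); lia).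
  assert (Hn : (1 <= INR (S n))%R) by (apply (le_INR 1); lia).
  rewrite regularized_split. set (x := INR (S m)) in *. set (y := INR (S n)) in *.
  set (r := (dl * (x + y) / 2)%R).
  assert (Hr : (0 < r)%R) by (unfold r; apply Rdiv_lt_0_compat; [apply Rmult_lt_0_compat|]; lra).
  assert (L : forall s : R, (y / 2 <= Rabs s)%R -> (r <= Cmod (x * z + s)%C)%R).
  { intros s Hs. eapply Rle_trans; [|apply H; lra]. unfold r, Rdiv. rewrite Rmult_assoc. apply Rmult_le_compat_l; lra. }
  assert (T : forall s : R, Rabs s = y ->
    (Cmod (/ ((x * z + s) * (x * z + s)) - (/ (x * z + s - RtoC (/ 2)) - / (x * z + s +
      RtoC (/ 2))))%C <= / 4 * / r ^ 4)%R).
  { intros s Hs. pose proof (Rabs_triang_inv s (/ 2)) as T1. pose proof (Rabs_triang_inv s (- / 2)) as T2.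
    rewrite Rabs_Ropp in T2. rewrite (Rabs_pos_eq (/ 2)) in T1, T2 by lra.
    apply Cmod_inv_sqr_minus_telescoping_le; [assumption|apply L; lra| |].
    - replace (x * z + s - RtoC (/ 2)) with (x * z + (s - / 2)%R) by (rewrite RtoC_minus; ring). apply L. lra.
    - replace (x * z + s + RtoC (/ 2)) with (x * z + (s - - / 2)%R) by (rewrite RtoC_minus, RtoC_opp; ring).
      apply L. lra. }
  pose proof (T y ltac:(apply Rabs_pos_eq; lra)) as Tp.
  pose proof (T (- y)%R ltac:(rewrite Rabs_Ropp; apply Rabs_pos_eq; lra)) as Tm.
  rewrite RtoC_opp in Tm. change (x * z + - y) with (x * z - y) in Tm.
  eapply Rle_trans; [apply Cmod_triangle|].
  (* AM-GM: [16 x^2 y^2 <= (x + y)^4] *)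
  assert (Q : ((4 * (x * y)) ^ 2 <= ((x + y) ^ 2) ^ 2)%R) by (apply pow_incr; pose proof (pow2_ge_0 (x - y)); nra).
  assert (Hxy : (0 < x ^ 2 * y ^ 2)%R) by (apply Rmult_lt_0_compat; apply pow_lt; lra).
  assert (I : (/ r ^ 4 <= / (dl ^ 4 * (x ^ 2 * y ^ 2)))%R).
  { apply Rinv_le_contravar; [nra|]. replace (r ^ 4)%R with (dl ^ 4 * (((x + y) ^ 2) ^ 2 / 16))%R by (unfold r; field).
    apply Rmult_le_compat_l; [lra|]. nra. }
  replace (/ dl ^ 4 * / x ^ 2 * / y ^ 2)%R with (/ (dl ^ 4 * (x ^ 2 * y ^ 2)))%R by (field; repeat split; lra).
  assert (0 < / r ^ 4)%R by now apply Rinv_0_lt_compat, pow_lt. lra.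
Qed.

Let regularized_row_summable m : abs_summable (regularized m).
Proof.
  destruct regularized_bound as (A & _ & HA).
  apply abs_summable_le with (fun n => A * / INR (S m) ^ 2 * / INR (S n) ^ 2)%R;
    [apply HA|apply ex_series_inv_sqr_scal].
Qed.

Let regularized_row_norms : ex_series (fun m => l1norm (regularized m)).
Proof.
  destruct regularized_bound as (A & _ & HA).
  apply ex_series_le_nonneg with (fun m => A * zeta2 * / INR (S m) ^ 2)%R; [|apply ex_series_inv_sqr_scal].
  intros m. split; [now apply l1norm_nonneg|].
  replace (A * zeta2 * / INR (S m) ^ 2)%R with (Series (fun n => A * / INR (S m) ^ 2 * / INR (S n) ^ 2)%R).
  - apply l1norm_le; [apply HA|apply ex_series_inv_sqr_scal].
  - rewrite Series_scal_l. fold zeta2. ring.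
Qed.

Let boundary_cot_pair m (x : R) : (0 < x)%R -> boundary m x = / z * cot_pair (x * z') m.
Proof.
  intros Hx. unfold boundary, cot_pair.
  pose proof (UHP_plus_R_neq0 _ x (UHP_mult m)). pose proof (UHP_minus_R_neq0 _ x (UHP_mult m)).
  assert (E1 : x * z' + INR (S m) = (INR (S m) * z - x) / z) by (unfold z'; field; assumption).
  assert (E2 : x * z' - INR (S m) = - ((INR (S m) * z + x) / z)) by (unfold z'; field; assumption).
  rewrite E1, E2. field. repeat split; assumption.
Qed.

Let boundary_summable (x : R) : (0 < x)%R -> abs_summable (fun m => boundary m x).
Proof.
  intros Hx. apply abs_summable_ext with (fun m => / z * cot_pair (x * z') m); [intros; now rewrite boundary_cot_pair|].
  now apply abs_summable_scal, abs_summable_cot_pair, UHP_scal.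
Qed.

Let CSeries_boundary (x : R) : (0 < x)%R -> CSeries (fun m => boundary m x) = / z * (pi_cot (x * z') - / (x * z')).
Proof.
  intros Hx. assert (UHP (x * z')) by now apply UHP_scal.
  rewrite (CSeries_ext _ (fun m => / z * cot_pair (x * z') m)) by (intros; now apply boundary_cot_pair).
  rewrite CSeries_scal by now apply abs_summable_cot_pair. rewrite pi_cot_partial_fractions by assumption. f_equal.
  ring.
Qed.

Let boundary_row_lim m : is_Clim_seq (fun n => boundary m (INR n + / 2)) 0.
Proof.
  replace (RtoC 0) with (0 - 0) by ring. apply is_Clim_seq_minus.
  - apply (is_Clim_seq_ext (fun n => / ((INR (S m) * z - RtoC (/ 2)) + INR n * - (1)))).
    + intros n. f_equal. rewrite RtoC_plus. ring.
    + apply is_Clim_seq_inv_arith. intros E. apply C1_nz. replace (RtoC 1) with (- - (1)) by ring. rewrite E. ring.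
  - apply (is_Clim_seq_ext (fun n => / ((INR (S m) * z + RtoC (/ 2)) + INR n * 1))).
    + intros n. f_equal. rewrite RtoC_plus. ring.
    + apply is_Clim_seq_inv_arith, C1_nz.
Qed.

Let boundary_sums_lim : is_Clim_seq (fun n => CSeries (fun m => boundary m (INR n + / 2))) (/ z * (- RtoC PI * i)).
Proof.
  eapply is_Clim_seq_ext; [intros n; symmetry; apply CSeries_boundary; pose proof (pos_INR n); lra|].
  apply is_Clim_seq_scal. replace (- RtoC PI * i) with (- RtoC PI * i * ((1 + 0) * / (1 - 0)) - 0) by field.
  assert (Lq : is_Clim_seq (fun n => qpow 1 ((INR n + / 2)%R * z')) 0).
  { apply (is_Clim_seq_ext (fun n => qpow (/ 2) z' * qpow 1 z' ^ n)).
    - intros n. rewrite qpow_scal, <- qpow_INR, <- qpow_plus. f_equal. ring.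
    - replace (RtoC 0) with (qpow (/ 2) z' * 0) by ring.
      now apply is_Clim_seq_scal, is_Clim_seq_pow_0, Cmod_qpow_1_lt_1. }
  apply is_Clim_seq_minus.
  - apply is_Clim_seq_scal, is_Clim_seq_mult; [|apply is_Clim_seq_inv].
    + apply is_Clim_seq_plus; [apply is_Clim_seq_const|exact Lq].
    + replace (1 - 0) with (RtoC 1) by ring. apply C1_nz.
    + apply is_Clim_seq_minus; [apply is_Clim_seq_const|exact Lq].
  - apply (is_Clim_seq_ext (fun n => / (RtoC (/ 2) * z' + INR n * z'))).
    + intros n. f_equal. rewrite RtoC_plus. ring.
    + now apply is_Clim_seq_inv_arith, UHP_neq0.
Qed.

Let inv_sqr_pair_switch m n : inv_sqr_pair (INR (S m) * z) n = / (z * z) * inv_sqr_pair (INR (S n) * z') m.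
Proof.
  unfold inv_sqr_pair.
  pose proof (UHP_plus_R_neq0 _ (INR (S n)) (UHP_mult m)). pose proof (UHP_minus_R_neq0 _ (INR (S n)) (UHP_mult m)).
  assert (E1 : INR (S n) * z' + INR (S m) = (INR (S m) * z - INR (S n)) / z) by (unfold z'; field; assumption).
  assert (E2 : INR (S n) * z' - INR (S m) = - ((INR (S m) * z + INR (S n)) / z)) by (unfold z'; field; assumption).
  rewrite E1, E2. field. repeat split; assumption.
Qed.

Let CSeries_inv_sqr_pair_mult (w : C) m : UHP w ->
  CSeries (inv_sqr_pair (INR (S m) * w)) = pi_csc_sqr (INR (S m) * w) - / (w * w) * RtoC (/ INR (S m) ^ 2).
Proof.
  intros Hw. pose proof (UHP_neq0 w Hw). assert (Hm : INR (S m) <> 0%R) by (apply not_0_INR; lia).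
  rewrite pi_csc_sqr_partial_fractions by (apply UHP_scal; [apply lt_0_INR; lia|assumption]).
  rewrite RtoC_inv, RtoC_pow by now apply pow_nonzero. apply RtoC_neq0 in Hm. field. split; assumption.
Qed.

Let telescoping n m : boundary m (INR (S n) + / 2) - boundary m (INR (S n) - / 2) =
  boundary m (INR (S n) + / 2) - boundary m (INR n + / 2).
Proof. do 2 f_equal. rewrite S_INR. field. Qed.

Let row_sum m : CSeries (regularized m) =
  pi_csc_sqr (INR (S m) * z) - / (z * z) * RtoC (/ INR (S m) ^ 2) + boundary m (/ 2).
Proof.
  rewrite <- CSeries_inv_sqr_pair_mult by assumption.
  replace (_ + boundary m (/ 2)) with (CSeries (inv_sqr_pair (INR (S m) * z)) - (0 - boundary m (/ 2))) by ring.
  apply CSeries_unique, is_series_Cminus; [now apply CSeries_correct, abs_summable_inv_sqr_pair|].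
  apply is_series_Csum. eapply is_Clim_seq_ext.
  - intros n. transitivity (Csum (fun k => boundary m (INR (S k) + / 2) - boundary m (INR k + / 2)) n).
    + symmetry. apply (Csum_telescope (fun k => boundary m (INR k + / 2))).
    + apply Csum_ext. intros k _. now rewrite telescoping.
  - simpl INR. rewrite Rplus_0_l. apply is_Clim_seq_minus; [apply boundary_row_lim|apply is_Clim_seq_const].
Qed.

Let column_sum n : CSeries (fun m => regularized m n) =
  / (z * z) * pi_csc_sqr (INR (S n) * z') - RtoC (/ INR (S n) ^ 2) -
  (CSeries (fun m => boundary m (INR (S n) + / 2)) - CSeries (fun m => boundary m (INR n + / 2))).
Proof.
  assert (Hpos : forall k, (0 < INR k + / 2)%R) by (intros k; pose proof (pos_INR k); lra).
  rewrite <- CSeries_minus by (apply boundary_summable, Hpos).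
  replace (/ (z * z) * pi_csc_sqr (INR (S n) * z') - RtoC (/ INR (S n) ^ 2))
    with (/ (z * z) * CSeries (inv_sqr_pair (INR (S n) * z'))).
  2:{ rewrite CSeries_inv_sqr_pair_mult by assumption. unfold z'. field. assumption. }
  rewrite <- CSeries_scal, <- CSeries_minus.
  - apply CSeries_ext. intros m. unfold regularized. now rewrite inv_sqr_pair_switch, telescoping.
  - now apply abs_summable_scal, abs_summable_inv_sqr_pair.
  - apply abs_summable_minus; apply boundary_summable, Hpos.
  - now apply abs_summable_inv_sqr_pair.
Qed.

Let sum_of_row_sums : CSeries (fun m => CSeries (regularized m)) =
  half_G2 z - / (z * z) * RtoC zeta2 + CSeries (fun m => boundary m (/ 2)).
Proof.
  apply CSeries_unique. eapply is_series_Cext; [intros m; symmetry; apply row_sum|].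
  apply is_series_Cplus; [|apply CSeries_correct, boundary_summable; lra].
  apply is_series_Cminus; [now apply CSeries_correct, abs_summable_half_G2|]. apply is_series_Cscal, is_series_zeta2.
Qed.

Let sum_of_column_sums : CSeries (fun n => CSeries (fun m => regularized m n)) =
  / (z * z) * half_G2 z' - RtoC zeta2 - (/ z * (- RtoC PI * i) - CSeries (fun m => boundary m (/ 2))).
Proof.
  apply CSeries_unique. eapply is_series_Cext; [intros n; symmetry; apply column_sum|]. apply is_series_Cminus.
  - apply is_series_Cminus; [|apply is_series_zeta2].
    now apply is_series_Cscal, CSeries_correct, abs_summable_half_G2.
  - apply is_series_Csum.
    eapply is_Clim_seq_ext; [intros n; symmetry; apply (Csum_telescope (fun n => CSeries (fun m => boundary m (INR n +
      / 2))))|].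
    simpl INR. rewrite Rplus_0_l. apply is_Clim_seq_minus; [apply boundary_sums_lim|apply is_Clim_seq_const].
Qed.

(* The boundary term [pi i / z] is the defect of the interchange of the two summations. *)
Lemma half_G2_inversion :
  half_G2 z - / (z * z) * RtoC zeta2 = / (z * z) * half_G2 (- / z) - RtoC zeta2 + RtoC PI * i * / z.
Proof.
  fold z'. pose proof (CSeries_switch regularized regularized_row_summable regularized_row_norms) as E.
  rewrite sum_of_row_sums, sum_of_column_sums in E. set (B := CSeries (fun m => boundary m (/ 2))) in *.
  replace (half_G2 z - / (z * z) * RtoC zeta2) with ((half_G2 z - / (z * z) * RtoC zeta2 + B) - B) by ring.
  rewrite <- E. field. assumption.
Qed.

End EisensteinInversion.

Definition log_eta_sq (z : C) : C := RtoC (PI / 6) * i * z - 2 * neg_log_eta_prod z.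

Definition eta_sq (z : C) : C := cexp (log_eta_sq z).

Lemma eta_sqr z : UHP z -> eta z ^ 2 = eta_sq z.
Proof.
  intros Hz. unfold eta. rewrite eta_prodE, qpowE, <- cexp_plus by assumption.
  rewrite Cpow_S, Cpow_1_r, <- cexp_plus. unfold eta_sq, log_eta_sq. f_equal.
  replace (2 * PI * (1 / 24))%R with (PI / 12)%R by field.
  replace (PI / 6)%R with (PI / 12 + PI / 12)%R by field. rewrite RtoC_plus. ring.
Qed.

Lemma eta_sq_neq0 z : eta_sq z <> 0.
Proof. apply cexp_neq0. Qed.

Lemma is_derive_log_eta_sq (z : C) : UHP z ->
  is_derive log_eta_sq z (RtoC (PI / 6) * i + i / RtoC PI * half_G2 z).
Proof.
  intros Hz. assert (RtoC PI <> 0) by (apply RtoC_neq0; pose proof PI_RGT_0; lra).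
  eapply is_derive_eq.
  - apply is_derive_Cminus; apply is_derive_Cscal; [apply is_derive_Cid|now apply is_derive_neg_log_eta_prod_G2].
  - simpl. field. assumption.
Qed.

Lemma is_derive_log_eta_sq_quotient (z : C) : UHP z ->
  is_derive (fun z => log_eta_sq (- / z) - log_eta_sq z) z (/ z).
Proof.
  intros Hz. pose proof (UHP_neq0 z Hz). assert (RtoC PI <> 0) by (apply RtoC_neq0; pose proof PI_RGT_0; lra).
  eapply is_derive_eq.
  - apply is_derive_Cminus; [|now apply is_derive_log_eta_sq].
    apply (is_derive_Ccomp log_eta_sq (fun z => - / z)); [now apply is_derive_log_eta_sq, UHP_neg_inv|].
    now apply is_derive_Copp, is_derive_Cinv.
  - pose proof (half_G2_inversion z Hz) as E. rewrite zeta2_eq in E.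
    replace (half_G2 z) with (half_G2 z - / (z * z) * RtoC (PI ^ 2 / 6) + / (z * z) * RtoC (PI ^ 2 / 6)) by ring.
    rewrite E, !RtoC_div, RtoC_pow by lra.
    transitivity (- (i * i) * / z); [field; split; assumption|rewrite Ci_sqr; ring].
Qed.

Lemma UHP_convex (z w : C) (t : R) : (0 <= t <= 1)%R -> UHP z -> UHP w -> UHP (z + t * (w - z)).
Proof.
  unfold UHP. intros Ht Hz Hw. change (Im (z + t * (w - z))) with (Im z + Im (t * (w - z)))%R.
  rewrite Im_scal_R. change (Im (w - z)) with (Im w + - Im z)%R.
  destruct (Req_dec t 1) as [->|]; [lra|nra].
Qed.

(* The logarithmic derivative of [eta_sq (- / z) / (z * eta_sq z)] vanishes; evaluate at [z = i]. *)
Lemma eta_sq_inversion (z : C) : UHP z -> eta_sq (- / z) = - i * z * eta_sq z.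
Proof.
  intros Hz. pose proof (UHP_neq0 z Hz). pose proof Ci_neq0 as Hi.
  assert (Ui : UHP i) by (unfold UHP; simpl; lra).
  assert (E : cexp (log_eta_sq (- / z) - log_eta_sq z) * / z = cexp (log_eta_sq (- / i) - log_eta_sq i) * / i).
  { apply (eq_is_Cderive (fun z => cexp (log_eta_sq (- / z) - log_eta_sq z) * / z)). intros t Ht.
    pose proof (UHP_convex z i t Ht Hz Ui) as Hw. set (w := z + t * (i - z)) in *.
    pose proof (UHP_neq0 w Hw). eapply is_derive_eq.
    - apply is_derive_Cmult; [|now apply is_derive_Cinv].
      apply (is_derive_Ccomp cexp); [apply is_derive_cexp|now apply is_derive_log_eta_sq_quotient].
    - simpl. field. assumption. }
  assert (Ei : - / i = i) by (apply (Cmult_reg_l i); [assumption|]; rewrite Ci_sqr; field; assumption).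
  rewrite Ei in E. replace (log_eta_sq i - log_eta_sq i) with (RtoC 0) in E by ring. rewrite cexp_0 in E.
  unfold eta_sq. replace (log_eta_sq (- / z)) with ((log_eta_sq (- / z) - log_eta_sq z) + log_eta_sq z) by ring.
  rewrite cexp_plus. f_equal.
  replace (cexp (log_eta_sq (- / z) - log_eta_sq z)) with (z * (cexp (log_eta_sq (- / z) - log_eta_sq z) * / z))
    by (field; assumption).
  rewrite E, <- Ei at 1. field. assumption.
Qed.

(** * The slash action and the Fricke group *)

Definition aut (m : mat) (z : C) : C := RtoC (IZR (mc m)) * z + RtoC (IZR (md m)).

Definition mmul (m n : mat) : mat :=
  Mat (ma m * ma n + mb m * mc n) (ma m * mb n + mb m * md n) (mc m * ma n + md m * mc n) (mc m * mb n + md m * md n).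

Definition msmul (k : Z) (m : mat) : mat := Mat (k * ma m) (k * mb m) (k * mc m) (k * md m).

Definition Tmat (s : Z) : mat := Mat 1 s 0 1.

Definition Rmat (s : Z) : mat := Mat 1 0 (2 * s) 1.

Lemma mat_eq a b c d a' b' c' d' : a = a' -> b = b' -> c = c' -> d = d' -> Mat a b c d = Mat a' b' c' d'.
Proof. now intros -> -> -> ->. Qed.

Lemma mdet_mmul m n : mdet (mmul m n) = (mdet m * mdet n)%Z.
Proof. unfold mdet, mmul; simpl. ring. Qed.

Lemma mdet_msmul k m : mdet (msmul k m) = (k * k * mdet m)%Z.
Proof. unfold mdet, msmul; simpl. ring. Qed.

Lemma mdet_Tmat s : mdet (Tmat s) = 1%Z.
Proof. unfold mdet, Tmat; cbn [ma mb mc md]. ring. Qed.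

Lemma mdet_Rmat s : mdet (Rmat s) = 1%Z.
Proof. unfold mdet, Rmat; cbn [ma mb mc md]. ring. Qed.

Lemma aut_neq0 m z : (0 < mdet m)%Z -> UHP z -> aut m z <> 0.
Proof.
  intros Hd Hz E. assert (Ec : mc m = 0%Z).
  { apply (f_equal Im) in E. unfold aut in E. change (Im (_ + _)) with (Im (IZR (mc m) * z) + 0)%R in E.
    rewrite Im_scal_R, Rplus_0_r in E. apply Rmult_integral in E. unfold UHP in Hz.
    destruct E as [E|E]; [|simpl in E; lra].
    now apply eq_IZR_R0. }
  unfold aut in E. rewrite Ec, Cmult_0_l, Cplus_0_l in E. apply RtoC_inj, eq_IZR_R0 in E.
  unfold mdet in Hd. rewrite Ec, E in Hd. lia.
Qed.

Lemma Im_div (u v : C) : v <> 0 -> Im (u / v) = ((Im u * Re v - Re u * Im v) / Cmod v ^ 2)%R.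
Proof.
  intros Hv. assert (H : (Cmod v ^ 2 <> 0)%R) by (apply pow_nonzero; intros E; apply Hv; now apply Cmod_eq_0).
  rewrite Cmod2_alt in *. destruct u as [a b], v as [c d]. simpl in *. field. intros E. apply H. rewrite <- E. ring.
Qed.

Lemma UHP_mact m z : (0 < mdet m)%Z -> UHP z -> UHP (mact m z).
Proof.
  intros Hd Hz. pose proof (aut_neq0 m z Hd Hz) as Ha. unfold UHP, mact. fold (aut m z). rewrite Im_div by assumption.
  apply Rdiv_lt_0_compat; [|now apply pow_lt, Cmod_gt_0].
  replace (_ - _)%R with (IZR (mdet m) * Im z)%R.
  - apply Rmult_lt_0_compat; [now apply (IZR_lt 0)|exact Hz].
  - unfold aut, mdet. rewrite minus_IZR, !mult_IZR. destruct z as [x y]. simpl. ring.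
Qed.

Lemma aut_mmul m n z : aut n z <> 0 -> aut (mmul m n) z = aut m (mact n z) * aut n z.
Proof.
  intros H. unfold mact. fold (aut n z). unfold aut at 2. unfold aut at 1, mmul; cbn [ma mb mc md].
  rewrite !plus_IZR, !mult_IZR, !RtoC_plus, !RtoC_mult.
  transitivity (IZR (mc m) * (IZR (ma n) * z + IZR (mb n)) + IZR (md m) * aut n z); [unfold aut; ring|].
  field. assumption.
Qed.

Lemma mact_mmul m n z : aut n z <> 0 -> aut m (mact n z) <> 0 -> mact (mmul m n) z = mact m (mact n z).
Proof.
  intros Hn Hm. unfold mact at 1. fold (aut (mmul m n) z). rewrite aut_mmul by assumption.
  unfold mact at 2. fold (aut m (mact n z)).
  assert (E : IZR (ma (mmul m n)) * z + IZR (mb (mmul m n)) = (IZR (ma m) * mact n z + IZR (mb m)) * aut n z).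
  { unfold mact. fold (aut n z). unfold mmul; cbn [ma mb]. rewrite !plus_IZR, !mult_IZR, !RtoC_plus, !RtoC_mult.
    transitivity (IZR (ma m) * (IZR (ma n) * z + IZR (mb n)) + IZR (mb m) * aut n z); [unfold aut; ring|].
    field. assumption. }
  rewrite E. field. split; assumption.
Qed.

Lemma slash2E m f z : (0 < mdet m)%Z ->
  slash 2 m f z = RtoC (IZR (mdet m)) * / (aut m z * aut m z) * f (mact m z).
Proof.
  intros H. unfold slash. fold (aut m z). do 2 f_equal.
  - rewrite <- RtoC_pow. simpl. rewrite Rmult_1_r, sqrt_sqrt; [reflexivity|]. apply (IZR_le 0). lia.
  - f_equal. simpl. ring.
Qed.

Lemma slash2_mmul m n f z : (0 < mdet m)%Z -> (0 < mdet n)%Z -> UHP z ->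
  slash 2 (mmul m n) f z = slash 2 n (slash 2 m f) z.
Proof.
  intros Hm Hn Hz. pose proof (aut_neq0 n z Hn Hz). pose proof (aut_neq0 m _ Hm (UHP_mact n z Hn Hz)).
  rewrite (slash2E n), !slash2E by (rewrite ?mdet_mmul; nia).
  rewrite mact_mmul, aut_mmul, mdet_mmul, mult_IZR, RtoC_mult by assumption. field. split; assumption.
Qed.

Lemma slash2_msmul k m f z : (0 < mdet m)%Z -> k <> 0%Z -> UHP z -> slash 2 (msmul k m) f z = slash 2 m f z.
Proof.
  intros Hm Hk Hz. pose proof (aut_neq0 m z Hm Hz).
  assert (Hk' : RtoC (IZR k) <> 0) by now apply RtoC_neq0, not_0_IZR.
  assert (Ea : aut (msmul k m) z = IZR k * aut m z).
  { unfold aut, msmul; cbn [mc md]. rewrite !mult_IZR, !RtoC_mult. ring. }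
  assert (Em : mact (msmul k m) z = mact m z).
  { unfold mact. fold (aut (msmul k m) z) (aut m z). rewrite Ea. unfold msmul; cbn [ma mb].
    rewrite !mult_IZR, !RtoC_mult. field. split; assumption. }
  rewrite !slash2E by (rewrite ?mdet_msmul; nia). rewrite Ea, Em, mdet_msmul, !mult_IZR, !RtoC_mult. field.
  split; assumption.
Qed.

Lemma slash2_ext m f g z : (0 < mdet m)%Z -> UHP z -> (forall w, UHP w -> f w = g w) -> slash 2 m f z = slash 2 m g z.
Proof. intros Hm Hz E. rewrite !slash2E, E by (try apply UHP_mact; assumption). reflexivity. Qed.

Lemma slash2_scal m (c : C) f z : (0 < mdet m)%Z -> slash 2 m (fun w => c * f w) z = c * slash 2 m f z.
Proof. intros Hm. rewrite !slash2E by assumption. ring. Qed.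

Lemma slash2_plus m f g z : (0 < mdet m)%Z -> slash 2 m (fun w => f w + g w) z = slash 2 m f z + slash 2 m g z.
Proof. intros Hm. rewrite !slash2E by assumption. ring. Qed.

Definition slash_eigen (m : mat) (c : C) (f : C -> C) : Prop := forall z, UHP z -> slash 2 m f z = c * f z.

Lemma slash_eigen_mmul m n (c d : C) f : (0 < mdet m)%Z -> (0 < mdet n)%Z ->
  slash_eigen m c f -> slash_eigen n d f -> slash_eigen (mmul m n) (c * d) f.
Proof.
  intros Hm Hn Hc Hd z Hz. rewrite slash2_mmul by assumption.
  rewrite (slash2_ext n _ (fun w => c * f w)), slash2_scal, Hd by assumption. ring.
Qed.

Lemma slash_eigen_plus_scal m (c s : C) f g : (0 < mdet m)%Z ->
  slash_eigen m c f -> slash_eigen m c g -> slash_eigen m c (fun z => f z + s * g z).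
Proof.
  intros Hm Hf Hg z Hz. rewrite slash2_plus, slash2_scal, Hf, Hg by assumption. ring.
Qed.

Lemma ipow_eq_mod e e' : (e mod 4 = e' mod 4)%Z -> ipow e = ipow e'.
Proof. intros H. unfold ipow. now rewrite H. Qed.

Lemma ipowE n : ipow n = qpow (IZR n / 4) 1.
Proof.
  rewrite (Z.div_mod n 4) at 2 by lia. rewrite plus_IZR, mult_IZR.
  replace ((4 * IZR (n / 4) + IZR (n mod 4)) / 4)%R with (IZR (n / 4) + IZR (n mod 4) / 4)%R by field.
  rewrite qpow_plus, qpow_IZR_1, Cmult_1_l, qpow_R, cexp_Ci. unfold ipow.
  pose proof (Z.mod_pos_bound n 4 ltac:(lia)) as B.
  assert (n mod 4 = 0 \/ n mod 4 = 1 \/ n mod 4 = 2 \/ n mod 4 = 3)%Z as [E|[E|[E|E]]] by lia; rewrite E.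
  - replace (2 * PI * (0 / 4 * 1))%R with 0%R by field. now rewrite cos_0, sin_0.
  - replace (2 * PI * (1 / 4 * 1))%R with (PI / 2)%R by field. now rewrite cos_PI2, sin_PI2.
  - replace (2 * PI * (2 / 4 * 1))%R with PI by field. now rewrite cos_PI, sin_PI.
  - replace (2 * PI * (3 / 4 * 1))%R with (3 * (PI / 2))%R by field. rewrite cos_3PI2, sin_3PI2.
    unfold Copp, Defs.Ci; simpl. f_equal; ring.
Qed.

Lemma ipow_plus e e' : ipow (e + e') = ipow e * ipow e'.
Proof. rewrite !ipowE, <- qpow_plus, plus_IZR. f_equal. field. Qed.

Lemma Cconj_ipow e : Cconj (ipow e) = ipow (- e).
Proof.
  rewrite (ipow_eq_mod (- e) (- (e mod 4))) by (now rewrite <- Z.sub_0_l, <- (Z.sub_0_l (e mod 4)), Zminus_mod_idemp_r).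
  unfold ipow at 1. pose proof (Z.mod_pos_bound e 4 ltac:(lia)) as B.
  assert (e mod 4 = 0 \/ e mod 4 = 1 \/ e mod 4 = 2 \/ e mod 4 = 3)%Z as [E|[E|[E|E]]] by lia; rewrite E;
    unfold Cconj, ipow, RtoC, Copp, Defs.Ci; simpl; f_equal; ring.
Qed.

(* The character [nu_eps] for [r = 1] and its conjugate for [r = 3] modulo 4. *)
Definition chi (r : Z) (eps : R) : mat -> C := if (r mod 4 =? 1)%Z then nu eps else nubar eps.

Lemma ipow_odd_mul (r : Z) e : Z.Odd r -> ipow (r * e) = if (r mod 4 =? 1)%Z then ipow e else Cconj (ipow e).
Proof.
  intros [k ->]. destruct (Z.eqb_spec ((2 * k + 1) mod 4) 1) as [E|E]; [|rewrite Cconj_ipow].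
  - apply ipow_eq_mod. now rewrite Z.mul_mod, E, Z.mul_1_l, Z.mod_mod by lia.
  - assert (H : ((2 * k + 1) mod 4 = 3)%Z).
    { pose proof (Z.div_mod (2 * k + 1) 4). pose proof (Z.mod_pos_bound (2 * k + 1) 4). lia. }
    apply ipow_eq_mod. rewrite Z.mul_mod, H by lia.
    rewrite Zmult_mod_idemp_r. replace (3 * e)%Z with (- e + e * 4)%Z by ring. apply Z.mod_add. lia.
Qed.

Lemma chiE r eps m : Z.Odd r -> chi r eps m =
  if Z.eqb (mdet m) 1 then ipow (r * (md m * (mb m - mc m / 2)))
  else RtoC eps * ipow (r * ((mc m / 2) * (ma m / 2 + md m / 2))).
Proof.
  intros Hr. unfold chi.
  transitivity (if (r mod 4 =? 1)%Z then nu eps m else nubar eps m); [now destruct (r mod 4 =? 1)%Z|].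
  unfold nubar, nu. destruct (mdet m =? 1)%Z; rewrite (ipow_odd_mul r) by assumption; destruct (r mod 4 =? 1)%Z;
    try reflexivity.
  rewrite Cmult_conj. f_equal. unfold Cconj, RtoC; simpl. f_equal; ring.
Qed.

Definition T_invariant (r : Z) (f : C -> C) : Prop := forall z, UHP z -> f (z + 1) = ipow r * f z.

Lemma T_invariant_IZR r f n z : T_invariant r f -> UHP z -> f (z + IZR n) = ipow (r * n) * f z.
Proof.
  intros HT. assert (H : forall (k : nat) w, UHP w -> f (w + IZR (Z.of_nat k)) = ipow (r * Z.of_nat k) * f w).
  { intros k w Hw. induction k as [|k IH].
    - rewrite Z.mul_0_r. simpl. rewrite Cplus_0_r. change (ipow 0) with (RtoC 1). ring.
    - rewrite Nat2Z.inj_succ, <- Z.add_1_r, plus_IZR, RtoC_plus, Cplus_assoc, HT by now apply UHP_plus_R.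
      rewrite IH, Z.mul_add_distr_l, ipow_plus, Z.mul_1_r. ring. }
  intros Hz. destruct (Z.le_gt_cases 0 n) as [Hn|Hn].
  - rewrite <- (Z2Nat.id n Hn). now apply H.
  - set (w := z + IZR n). specialize (H (Z.to_nat (- n)) w (UHP_plus_R z _ Hz)). rewrite Z2Nat.id in H by lia.
    replace (w + IZR (- n)) with z in H by (unfold w; rewrite opp_IZR, RtoC_opp; ring).
    rewrite H, Cmult_assoc, <- ipow_plus. replace (r * n + r * - n)%Z with 0%Z by ring. change (ipow 0) with (RtoC 1).
    ring.
Qed.

Lemma slash_eigen_Tmat r f s : T_invariant r f -> slash_eigen (Tmat s) (ipow (r * s)) f.
Proof.
  intros HT z Hz. rewrite slash2E by (rewrite mdet_Tmat; lia). rewrite <- (T_invariant_IZR r) by assumption.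
  rewrite mdet_Tmat. unfold aut, mact, Tmat; simpl. replace ((1 * z + IZR s) / (0 * z + 1)) with (z + IZR s) by field.
  field.
Qed.

Lemma slash2_W2 f z : UHP z -> slash 2 W2 f z = / (2 * z * z) * f (- / (2 * z)).
Proof.
  intros Hz. pose proof (UHP_neq0 z Hz). rewrite slash2E by reflexivity. unfold mdet, aut, mact, W2; simpl.
  replace ((0 * z + -1) / (2 * z + 0)) with (- / (2 * z)).
  - field. assumption.
  - rewrite RtoC_m1. field. assumption.
Qed.

Lemma slash_eigen_W2 (eps : R) f : slash_eigen W2 eps f <->
  forall z, UHP z -> f (- / (2 * z)) = RtoC eps * (2 * z * z) * f z.
Proof.
  split; intros H z Hz; pose proof (UHP_neq0 z Hz); specialize (H z Hz); rewrite slash2_W2 in * by assumption.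
  - replace (f (- / (2 * z))) with (2 * z * z * (/ (2 * z * z) * f (- / (2 * z)))) by (field; assumption).
    rewrite H. ring.
  - rewrite H. field. assumption.
Qed.

(* [W2 T^(-s) W2 = -2 R^s] *)
Lemma slash_eigen_Rmat r (eps : R) f s : (eps * eps = 1)%R -> T_invariant r f -> slash_eigen W2 eps f ->
  slash_eigen (Rmat s) (ipow (r * - s)) f.
Proof.
  intros He HT HW z Hz.
  rewrite <- (slash2_msmul (-2) (Rmat s)) by (rewrite ?mdet_Rmat; lia || assumption).
  replace (msmul (-2) (Rmat s)) with (mmul (mmul W2 (Tmat (- s))) W2)
    by (unfold msmul, Rmat, mmul, W2, Tmat; cbn [ma mb mc md]; apply mat_eq; ring).
  pose proof (slash_eigen_Tmat r f (- s) HT) as HTs.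
  rewrite (slash_eigen_mmul (mmul W2 (Tmat (- s))) W2 (eps * ipow (r * - s)) eps f);
    try (rewrite ?mdet_mmul, ?mdet_Tmat; reflexivity || assumption).
  - replace (RtoC eps * ipow (r * - s) * eps) with (RtoC eps * RtoC eps * ipow (r * - s)) by ring.
    rewrite <- RtoC_mult, He. ring.
  - apply slash_eigen_mmul; (rewrite ?mdet_Tmat; reflexivity) || assumption.
Qed.

Definition nu_exponent (m : mat) : Z := (md m * (mb m - mc m / 2))%Z.

Lemma ipow_mul_eq_mod r e e' : (e mod 4 = e' mod 4)%Z -> ipow (r * e) = ipow (r * e').
Proof. intros H. apply ipow_eq_mod. now rewrite <- Zmult_mod_idemp_r, H, Zmult_mod_idemp_r. Qed.

Lemma in_Gamma0_2_odd m : in_Gamma0_2 m -> Z.Odd (ma m) /\ Z.Odd (md m).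
Proof.
  destruct m as [a b c d]. intros [Hdet [e He]]. unfold mdet in Hdet. cbn [ma mb mc md] in *. subst c.
  destruct (Z.Even_or_Odd a) as [[q ->]|Ha].
  - assert (2 * (q * d - b * e) = 1)%Z by (rewrite <- Hdet; ring). lia.
  - destruct (Z.Even_or_Odd d) as [[q ->]|Hd]; [|now split].
    assert (2 * (a * q - b * e) = 1)%Z by (rewrite <- Hdet; ring). lia.
Qed.

Lemma nu_exponent_Tmat m s : in_Gamma0_2 m -> (nu_exponent (mmul m (Tmat s)) mod 4 = (nu_exponent m + s) mod 4)%Z.
Proof.
  intros Hm. destruct (in_Gamma0_2_odd m Hm) as [[k Hk] _]. destruct m as [a b c d], Hm as [Hdet [e He]].
  unfold mdet, nu_exponent, mmul, Tmat in *. cbn [ma mb mc md] in *. subst c a.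
  rewrite !Z.mul_0_r, !Z.mul_1_r, !Z.add_0_r, (Z.mul_comm 2 e), Z.div_mul by lia.
  assert (Hev : exists t, (e * s * ((2 * k + 1) * s - e) = 2 * t)%Z).
  { destruct (Z.Even_or_Odd e) as [[u ->]|[u ->]]; [exists (u * s * ((2 * k + 1) * s - 2 * u))%Z; ring|].
    destruct (Z.Even_or_Odd s) as [[w ->]|[w ->]]; [exists ((2 * u + 1) * w * ((2 * k + 1) * (2 * w) - (2 * u + 1)))%Z;
      ring|].
    exists ((2 * u + 1) * (2 * w + 1) * (2 * k * w + k + w - u))%Z. ring. }
  destruct Hev as [t Ht].
  replace (_ * _)%Z with (d * (b - e) + s + (b * e * s + t) * 4)%Z; [apply Z.mod_add; lia|].
  transitivity (d * (b - e) + s * ((2 * k + 1) * d - b * (2 * e)) + 4 * (b * e * s) + 2 * (e * s * ((2 * k +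
    1) * s - e)))%Z; [|ring].
  rewrite Hdet, Ht. ring.
Qed.

Lemma nu_exponent_Rmat m s : in_Gamma0_2 m -> (nu_exponent (mmul m (Rmat s)) mod 4 = (nu_exponent m + - s) mod 4)%Z.
Proof.
  intros Hm. destruct (in_Gamma0_2_odd m Hm) as [_ [k Hk]]. destruct m as [a b c d], Hm as [Hdet [e He]].
  unfold nu_exponent, mmul, Rmat in *. cbn [ma mb mc md] in *. subst c d.
  replace (2 * e * 1 + (2 * k + 1) * (2 * s))%Z with ((e + (2 * k + 1) * s) * 2)%Z by ring.
  rewrite (Z.mul_comm 2 e), !Z.div_mul by lia.
  replace (_ * (_ - _))%Z with ((2 * k + 1) * (b - e) + - s + (- s * (k * k + k)) * 4)%Z by ring.
  apply Z.mod_add. lia.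
Qed.

(* Euclid's algorithm on the bottom row. *)
Lemma Gamma0_2_ind (P : mat -> Prop) :
  (forall n, P (Tmat n)) -> (forall n, P (msmul (-1) (Tmat n))) ->
  (forall m s, in_Gamma0_2 m -> P m -> P (mmul m (Tmat s))) ->
  (forall m s, in_Gamma0_2 m -> P m -> P (mmul m (Rmat s))) ->
  forall m, in_Gamma0_2 m -> P m.
Proof.
  intros P1 PN PT PR.
  assert (H : forall (k : nat) m, (Z.abs (mc m) + Z.abs (md m) < Z.of_nat k)%Z -> in_Gamma0_2 m -> P m).
  2:{ intros m. apply (H (S (Z.to_nat (Z.abs (mc m) + Z.abs (md m))))). lia. }
  induction k as [|k IH]; intros m Hk Hm; [lia|]. destruct (in_Gamma0_2_odd m Hm) as [_ Hodd].
  destruct m as [a b c d], Hm as [Hdet [e He]]. unfold mdet in Hdet. cbn [ma mb mc md] in *. subst c.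
  assert (Z.abs d <> Z.abs (2 * e)) by (destruct Hodd; lia).
  destruct (Z.eq_dec e 0) as [->|He0]; [|destruct (Z_lt_le_dec (Z.abs d) (Z.abs (2 * e)))].
  - assert (Had : (a * d = 1)%Z) by lia. destruct (Z.mul_eq_1 a d Had) as [-> | ->].
    + replace d with 1%Z by lia. apply P1.
    + replace (Mat _ b (2 * 0) d) with (msmul (-1) (Tmat (- b))); [apply PN|].
      unfold msmul, Tmat; cbn [ma mb mc md]. apply mat_eq; lia.
  - assert (exists s, (s = 1 \/ s = -1)%Z /\ (Z.abs (2 * (e + s * d)) < Z.abs (2 * e))%Z) as (s & Hs & Hlt).
    { destruct Hodd. destruct (Z_lt_le_dec 0 (e * d)); [exists (-1)%Z|exists 1%Z]; split; try lia; nia. }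
    replace (Mat a b (2 * e) d) with (mmul (Mat (a + 2 * s * b) b (2 * (e + s * d)) d) (Rmat (- s)))
      by (unfold mmul, Rmat; cbn [ma mb mc md]; apply mat_eq; ring).
    assert (in_Gamma0_2 (Mat (a + 2 * s * b) b (2 * (e + s * d)) d)).
    { split; [unfold mdet; cbn [ma mb mc md]; rewrite <- Hdet; ring|now exists (e + s * d)%Z]. }
    apply PR, IH; cbn [mc md]; assumption || lia.
  - assert (exists s, (s = 1 \/ s = -1)%Z /\ (Z.abs (d + s * (2 * e)) < Z.abs d)%Z) as (s & Hs & Hlt).
    { destruct (Z_lt_le_dec 0 (e * d)); [exists (-1)%Z|exists 1%Z]; split; try lia; nia. }
    replace (Mat a b (2 * e) d) with (mmul (Mat a (b + s * a) (2 * e) (d + s * (2 * e))) (Tmat (- s)))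
      by (unfold mmul, Tmat; cbn [ma mb mc md]; apply mat_eq; ring).
    assert (in_Gamma0_2 (Mat a (b + s * a) (2 * e) (d + s * (2 * e)))).
    { split; [unfold mdet; cbn [ma mb mc md]; rewrite <- Hdet; ring|now exists e]. }
    apply PT, IH; cbn [mc md]; assumption || lia.
Qed.

Lemma slash_eigen_Gamma0_2 r (eps : R) f : (eps * eps = 1)%R -> T_invariant r f -> slash_eigen W2 eps f ->
  forall m, in_Gamma0_2 m -> slash_eigen m (ipow (r * nu_exponent m)) f.
Proof.
  intros He HT HW. apply Gamma0_2_ind.
  - intros n. replace (nu_exponent (Tmat n)) with n by (unfold nu_exponent, Tmat; cbn [mb mc md];
      rewrite Z.div_0_l by lia; ring).
    now apply slash_eigen_Tmat.
  - intros n z Hz. rewrite slash2_msmul by (rewrite ?mdet_Tmat; lia || assumption).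
    replace (nu_exponent (msmul (-1) (Tmat n))) with n
      by (unfold nu_exponent, msmul, Tmat; cbn [mb mc md]; rewrite Z.mul_0_r, Z.div_0_l by lia; ring).
    now apply slash_eigen_Tmat.
  - intros m s Hm IH. rewrite (ipow_mul_eq_mod r _ _ (nu_exponent_Tmat m s Hm)), Z.mul_add_distr_l, ipow_plus.
    destruct Hm as [Hdet _]. apply slash_eigen_mmul; try (rewrite ?mdet_Tmat; lia || assumption).
    now apply slash_eigen_Tmat.
  - intros m s Hm IH. rewrite (ipow_mul_eq_mod r _ _ (nu_exponent_Rmat m s Hm)), Z.mul_add_distr_l, ipow_plus.
    destruct Hm as [Hdet _]. apply slash_eigen_mmul; try (rewrite ?mdet_Rmat; lia || assumption).
    now apply (slash_eigen_Rmat r eps).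
Qed.

(* The coset of [W2] is reached from [Gamma_0(2)] by multiplication on the right. *)
Lemma slash_eigen_GammaStar2 r (eps : R) f : Z.Odd r -> (eps * eps = 1)%R -> T_invariant r f -> slash_eigen W2 eps f ->
  forall m, in_GammaStar2 m -> slash_eigen m (chi r eps m) f.
Proof.
  intros Hr He HT HW m Hm. rewrite chiE by assumption. destruct Hm as [Hm|(Hdet & [a Ha] & [c Hc] & [d Hd])].
  - destruct (Hm) as [-> _]. now apply (slash_eigen_Gamma0_2 r eps).
  - rewrite Hdet. change (2 =? 1)%Z with false. cbv iota. destruct m as [A b C' D]. cbn [ma mb mc md] in *.
    subst A C' D.
    set (g := Mat (- b) a (- (2 * d)) c).
    assert (Hg : in_Gamma0_2 g).
    { split; [|exists (- d)%Z; cbn [g mc]; ring]. unfold mdet in *; cbn [g ma mb mc md] in *. lia. }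
    replace (Mat (2 * a) b (2 * c) (2 * d)) with (mmul g W2) by (unfold mmul, g, W2; cbn [ma mb mc md]; apply mat_eq;
      ring).
    rewrite Cmult_comm. replace (_ * _)%Z with (r * nu_exponent g)%Z.
    + apply slash_eigen_mmul; try reflexivity; try assumption; [destruct Hg;
        lia|now apply (slash_eigen_Gamma0_2 r eps)].
    + unfold nu_exponent, g; cbn [mb mc md].
      replace (- (2 * d))%Z with (- d * 2)%Z by ring.
      rewrite (Z.mul_comm 2 a), (Z.mul_comm 2 c), (Z.mul_comm 2 d), !Z.div_mul by lia. ring.
Qed.

(** * q-series and eta quotients *)

Definition is_qseries (rho : R) (f : C -> C) (c : nat -> C) : Prop :=
  cvg_unit_disk c /\ forall z, UHP z -> f z = qpow rho z * CPSeries c (qpow 1 z).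

Lemma is_qseries_eq rho rho' f c : rho = rho' -> is_qseries rho f c -> is_qseries rho' f c.
Proof. now intros <-. Qed.

Lemma is_qseries_ext rho f g c : (forall z, UHP z -> f z = g z) -> is_qseries rho f c -> is_qseries rho g c.
Proof. intros E [H1 H2]. split; [assumption|]. intros z Hz. rewrite <- E by assumption. auto. Qed.

Lemma is_qseries_plus rho f g a b :
  is_qseries rho f a -> is_qseries rho g b -> is_qseries rho (fun z => f z + g z) (fun n => a n + b n).
Proof.
  intros [H1 H2] [H3 H4]. split; [now apply cvg_unit_disk_plus|]. intros z Hz.
  rewrite H2, H4, CPSeries_plus by (try apply Cmod_qpow_1_lt_1; assumption). ring.
Qed.

Lemma is_qseries_scal rho s f a : is_qseries rho f a -> is_qseries rho (fun z => s * f z) (fun n => s * a n).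
Proof.
  intros [H1 H2]. split; [now apply cvg_unit_disk_scal|]. intros z Hz.
  rewrite H2, CPSeries_scal by (try apply Cmod_qpow_1_lt_1; assumption). ring.
Qed.

Lemma is_qseries_mult rho sg f g a b :
  is_qseries rho f a -> is_qseries sg g b -> is_qseries (rho + sg) (fun z => f z * g z) (CPS_mult a b).
Proof.
  intros [H1 H2] [H3 H4]. split; [now apply cvg_unit_disk_CPS_mult|]. intros z Hz.
  rewrite H2, H4, CPSeries_CPS_mult, qpow_plus by (try apply Cmod_qpow_1_lt_1; assumption). ring.
Qed.

Lemma is_qseries_pow rho f a n : is_qseries rho f a -> is_qseries (rho * INR n) (fun z => f z ^ n) (CPS_pow a n).
Proof.
  intros [H1 H2]. split; [now apply cvg_unit_disk_CPS_pow|]. intros z Hz.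
  rewrite H2, CPSeries_CPS_pow, qpow_mult_INR, Cpow_mult_l by (try apply Cmod_qpow_1_lt_1; assumption). reflexivity.
Qed.

Lemma is_qseries_dilate k rho f a : (0 < k)%nat -> is_qseries rho f a ->
  is_qseries (INR k * rho) (fun z => f (INR k * z)) (dilate k a).
Proof.
  intros Hk [H1 H2]. split; [now apply cvg_unit_disk_dilate|]. intros z Hz.
  rewrite CPSeries_dilate, H2, !qpow_scal by (assumption || now apply Cmod_qpow_1_lt_1 || now apply UHP_scal;
    [apply lt_0_INR|]).
  rewrite Rmult_1_l, qpow_INR. do 2 f_equal. ring.
Qed.

Lemma is_qseries_incr_n rho f a k : is_qseries (rho + INR k) f a -> is_qseries rho f (CPS_incr_n a k).
Proof.
  intros [H1 H2]. split; [now apply cvg_unit_disk_CPS_incr_n|]. intros z Hz.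
  rewrite H2, CPSeries_CPS_incr_n, qpow_plus, qpow_INR by (try apply Cmod_qpow_1_lt_1; assumption). ring.
Qed.

Lemma is_qseries_ex_derive rho f c z : is_qseries rho f c -> UHP z ->
  ex_derive (K := C_AbsRing) (V := C_NormedModule) f z.
Proof.
  intros [H1 H2] Hz. eexists.
  eapply is_derive_ext_UHP; [exact Hz|intros w Hw; symmetry; now apply H2|].
  apply is_derive_Cmult; [apply is_derive_qpow|now apply is_derive_CPSeries_qpow].
Qed.

Lemma is_qseries_T_invariant r f c : is_qseries (IZR r / 4) f c -> T_invariant r f.
Proof.
  intros [_ H] z Hz. rewrite !H by (try apply (UHP_plus_R z 1); assumption).
  rewrite (qpow_1_period z 1), qpow_Cplus, ipowE. ring.
Qed.

(* [f = q^rho (1 + O(q^(j+1)))] *)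
Definition is_monic_qseries (rho : R) (j : nat) (f : C -> C) : Prop :=
  exists c : nat -> C, is_qseries rho f c /\ c O = 1 /\ forall k, (1 <= k <= j)%nat -> c k = 0.

Lemma is_monic_qseries_eq rho rho' j f : rho = rho' -> is_monic_qseries rho j f -> is_monic_qseries rho' j f.
Proof. now intros <-. Qed.

Lemma is_monic_qseries_ext rho j f g : (forall z, UHP z -> f z = g z) ->
  is_monic_qseries rho j f -> is_monic_qseries rho j g.
Proof. intros E (c & H & Hc). exists c. split; [now apply (is_qseries_ext rho f)|assumption]. Qed.

Lemma is_monic_qseries_mult rho sg f g :
  is_monic_qseries rho 0 f -> is_monic_qseries sg 0 g -> is_monic_qseries (rho + sg) 0 (fun z => f z * g z).
Proof.
  intros (a & Ha & Ha0 & _) (b & Hb & Hb0 & _). exists (CPS_mult a b). split; [now apply is_qseries_mult|].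
  split; [rewrite CPS_mult_0, Ha0, Hb0; ring|intros; lia].
Qed.

Lemma is_monic_qseries_pow rho f n : is_monic_qseries rho 0 f -> is_monic_qseries (rho * INR n) 0 (fun z => f z ^ n).
Proof.
  intros (a & Ha & Ha0 & _). exists (CPS_pow a n). split; [now apply is_qseries_pow|].
  split; [now rewrite CPS_pow_0, Ha0, Cpow_1_l|intros; lia].
Qed.

Lemma is_monic_qseries_dilate k rho f : (0 < k)%nat -> is_monic_qseries rho 0 f ->
  is_monic_qseries (INR k * rho) 0 (fun z => f (INR k * z)).
Proof.
  intros Hk (a & Ha & Ha0 & _). exists (dilate k a). split; [now apply is_qseries_dilate|].
  split; [now rewrite dilate_0|intros; lia].
Qed.

Lemma is_monic_qseries_plus_scal rho j k s f g : is_monic_qseries rho j f -> is_monic_qseries (rho + INR k) 0 g ->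
  (j < k)%nat -> is_monic_qseries rho j (fun z => f z + s * g z).
Proof.
  intros (a & Ha & Ha0 & Hj) (b & Hb & _) Hk. exists (fun n => a n + s * CPS_incr_n b k n).
  split; [now apply is_qseries_plus, is_qseries_scal, is_qseries_incr_n|].
  split; [|intros n Hn]; rewrite CPS_incr_n_lt, ?Ha0, ?Hj by lia; ring.
Qed.

Lemma is_monic_qseries_reduce rho j f g : is_monic_qseries rho j f -> is_monic_qseries (rho + INR (S j)) 0 g ->
  exists s, is_monic_qseries rho (S j) (fun z => f z + s * g z).
Proof.
  intros (a & Ha & Ha0 & Hj) (b & Hb & Hb0 & _). exists (- a (S j)), (fun n => a n + - a (S j) * CPS_incr_n b (S j) n).
  split; [now apply is_qseries_plus, is_qseries_scal, is_qseries_incr_n|].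
  split; [rewrite CPS_incr_n_lt, Ha0 by lia; ring|]. intros n Hn. destruct (Nat.eq_dec n (S j)) as [->|Hne].
  - pose proof (CPS_incr_n_add b (S j) 0) as E. rewrite Nat.add_0_r, Hb0 in E. rewrite E. ring.
  - rewrite CPS_incr_n_lt, Hj by lia. ring.
Qed.

Lemma cexp_neg_log_eta_prod (s : C) : exists c : nat -> C, c O = 1 /\ cvg_unit_disk c /\
  forall z, UHP z -> cexp (s * neg_log_eta_prod z) = CPSeries c (qpow 1 z).
Proof.
  assert (Hs : cvg_unit_disk (fun n => s * sigma_m1 n)) by apply cvg_unit_disk_scal, cvg_unit_disk_sigma_m1.
  exists (CPS_exp (fun n => s * sigma_m1 n)). split; [apply CPS_exp_0; rewrite sigma_m1_0; ring|].
  split; [now apply cvg_unit_disk_CPS_exp|]. intros z Hz.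
  now rewrite CPSeries_CPS_exp, CPSeries_scal by (try apply cvg_unit_disk_sigma_m1; try apply Cmod_qpow_1_lt_1;
    assumption).
Qed.

Lemma eta_sq_monic : is_monic_qseries (1 / 12) 0 eta_sq.
Proof.
  destruct (cexp_neg_log_eta_prod (-(2))) as (c & Hc0 & Hc & E). exists c.
  split; [split|split]; try assumption; [|intros; lia].
  intros z Hz. rewrite <- E, qpowE, <- cexp_plus by assumption. unfold eta_sq, log_eta_sq. f_equal.
  replace (2 * PI * (1 / 12))%R with (PI / 6)%R by field. ring.
Qed.

Lemma inv_eta_sq_monic : is_monic_qseries (- (1 / 12)) 0 (fun z => / eta_sq z).
Proof.
  destruct (cexp_neg_log_eta_prod 2) as (c & Hc0 & Hc & E). exists c.
  split; [split|split]; try assumption; [|intros; lia].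
  intros z Hz. rewrite <- E, qpowE, <- cexp_plus by assumption. unfold eta_sq. rewrite <- cexp_opp. unfold log_eta_sq.
  f_equal.
  replace (2 * PI * - (1 / 12))%R with (- (PI / 6))%R by field. rewrite RtoC_opp. ring.
Qed.

Definition eta_sq_2 (z : C) : C := eta_sq (2 * z).

Lemma eta_sq_2_monic : is_monic_qseries (1 / 6) 0 eta_sq_2.
Proof.
  eapply is_monic_qseries_eq; [|apply (is_monic_qseries_dilate 2), eta_sq_monic; lia]. simpl. field.
Qed.

Lemma inv_eta_sq_2_monic : is_monic_qseries (- (1 / 6)) 0 (fun z => / eta_sq_2 z).
Proof.
  eapply is_monic_qseries_eq; [|apply (is_monic_qseries_dilate 2 (- (1 / 12)) (fun z => / eta_sq z)), inv_eta_sq_monic;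
    lia]. simpl. field.
Qed.

Lemma UHP_W2 z : UHP z -> UHP (- / (2 * z)).
Proof. intros Hz. apply UHP_neg_inv, UHP_scal; [lra|assumption]. Qed.

Lemma eta_sq_W2 z : UHP z -> eta_sq (- / (2 * z)) = - i * (2 * z) * eta_sq_2 z.
Proof. intros Hz. apply eta_sq_inversion, UHP_scal; [lra|assumption]. Qed.

Lemma eta_sq_2_W2 z : UHP z -> eta_sq_2 (- / (2 * z)) = - i * z * eta_sq z.
Proof.
  intros Hz. pose proof (UHP_neq0 z Hz). unfold eta_sq_2. rewrite <- eta_sq_inversion by assumption. f_equal. field.
  assumption.
Qed.

Definition pow_quot (f g : C -> C) (m n : nat) (z : C) : C := f z ^ m * (/ g z) ^ n.

Lemma pow_quot_scal (f g f' g' : C -> C) (A B w z : C) m n : B <> 0 -> g' z <> 0 -> f w = A * f' z -> g w = B * g' z ->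
  pow_quot f g m n w = A ^ m * / B ^ n * pow_quot f' g' m n z.
Proof.
  intros HB Hg' Ef Eg. unfold pow_quot.
  rewrite Ef, Eg, Cpow_mult_l, !Cpow_inv, Cpow_mult_l by (try apply Cmult_neq_0; assumption).
  pose proof (Cpow_nz B n HB). pose proof (Cpow_nz _ n Hg'). field. split; assumption.
Qed.

Lemma pow_quot_monic rho sg f g m n : is_monic_qseries rho 0 f -> is_monic_qseries sg 0 (fun z => / g z) ->
  is_monic_qseries (rho * INR m + sg * INR n) 0 (pow_quot f g m n).
Proof.
  intros Hf Hg. apply (is_monic_qseries_mult _ _ (fun z => f z ^ m) (fun z => (/ g z) ^ n));
    now apply is_monic_qseries_pow.
Qed.

Lemma opp_Ci_mult_neq0 (w : C) : w <> 0 -> - i * w <> 0.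
Proof.
  intros Hw. intros E. apply (Cmult_neq_0 i w Ci_neq0 Hw). replace (i * w) with (- (- i * w)) by ring. rewrite E.
  ring.
Qed.

Lemma eta_quot_W2 m n z : UHP z ->
  pow_quot eta_sq eta_sq_2 m n (- / (2 * z)) = (- i * (2 * z)) ^ m * / (- i * z) ^ n * pow_quot eta_sq_2 eta_sq m n z.
Proof.
  intros Hz. apply pow_quot_scal; [|apply eta_sq_neq0|now apply eta_sq_W2|now apply eta_sq_2_W2].
  now apply opp_Ci_mult_neq0, UHP_neq0.
Qed.

Lemma eta_quot_2_W2 m n z : UHP z ->
  pow_quot eta_sq_2 eta_sq m n (- / (2 * z)) = (- i * z) ^ m * / (- i * (2 * z)) ^ n * pow_quot eta_sq eta_sq_2 m n z.
Proof.
  intros Hz. apply pow_quot_scal; [|apply eta_sq_neq0|now apply eta_sq_2_W2|now apply eta_sq_W2].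
  apply opp_Ci_mult_neq0, Cmult_neq_0; [apply RtoC_neq0; lra|now apply UHP_neq0].
Qed.

Lemma h2E z : UHP z -> h2 z = eta_sq z * eta_sq_2 z.
Proof. intros Hz. unfold h2. rewrite !eta_sqr; [reflexivity|apply UHP_scal; [lra|assumption]|assumption]. Qed.

Lemma h2_neq0 z : UHP z -> h2 z <> 0.
Proof. intros Hz. rewrite h2E by assumption. apply Cmult_neq_0; apply eta_sq_neq0. Qed.

Lemma h2_monic : is_monic_qseries (1 / 4) 0 h2.
Proof.
  apply (is_monic_qseries_ext _ _ (fun z => eta_sq z * eta_sq_2 z)); [intros z Hz; now rewrite h2E|].
  eapply is_monic_qseries_eq; [|apply is_monic_qseries_mult; [apply eta_sq_monic|apply eta_sq_2_monic]]. field.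
Qed.

Lemma h2_W2 : slash_eigen W2 (-1)%R h2.
Proof.
  apply slash_eigen_W2. intros z Hz. rewrite !h2E by (try apply UHP_W2; assumption).
  rewrite eta_sq_W2, eta_sq_2_W2, RtoC_m1 by assumption.
  transitivity ((i * i) * (2 * z * z) * (eta_sq z * eta_sq_2 z)); [ring|]. rewrite Ci_sqr. ring.
Qed.

Definition hauptmodul_plus_inv (s : R) (z : C) : C :=
  pow_quot eta_sq eta_sq_2 12 12 z + RtoC s * pow_quot eta_sq_2 eta_sq 12 12 z.

Lemma hauptmodul_plus_inv_monic s : is_monic_qseries (-1) 0 (hauptmodul_plus_inv s).
Proof.
  apply (is_monic_qseries_plus_scal _ _ 2); [| |lia].
  - eapply is_monic_qseries_eq; [|apply pow_quot_monic; [apply eta_sq_monic|apply inv_eta_sq_2_monic]]. simpl. field.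
  - eapply is_monic_qseries_eq; [|apply pow_quot_monic; [apply eta_sq_2_monic|apply inv_eta_sq_monic]]. simpl. field.
Qed.

Lemma hauptmodul_plus_inv_W2 (e : R) z : (e * e = 1)%R -> UHP z ->
  hauptmodul_plus_inv (e * 4096) (- / (2 * z)) = RtoC e * hauptmodul_plus_inv (e * 4096) z.
Proof.
  intros He Hz. pose proof (UHP_neq0 z Hz). pose proof Ci_neq0. unfold hauptmodul_plus_inv.
  rewrite eta_quot_W2, eta_quot_2_W2, RtoC_mult by assumption.
  set (t := pow_quot eta_sq eta_sq_2 12 12 z). set (t' := pow_quot eta_sq_2 eta_sq 12 12 z).
  transitivity (RtoC e * t + RtoC e * RtoC e * (4096 * t')); [rewrite <- (RtoC_mult e e), He; field; now split|ring].
Qed.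

Definition quarter_form (eps : R) (z : C) : C :=
  pow_quot eta_sq eta_sq_2 7 5 z + RtoC (- eps * 64) * pow_quot eta_sq_2 eta_sq 7 5 z.

Lemma quarter_form_monic eps : is_monic_qseries (- (1 / 4)) 0 (quarter_form eps).
Proof.
  apply (is_monic_qseries_plus_scal _ _ 1); [| |lia].
  - eapply is_monic_qseries_eq; [|apply pow_quot_monic; [apply eta_sq_monic|apply inv_eta_sq_2_monic]]. simpl. field.
  - eapply is_monic_qseries_eq; [|apply pow_quot_monic; [apply eta_sq_2_monic|apply inv_eta_sq_monic]]. simpl. field.
Qed.

Lemma quarter_form_W2 eps : (eps * eps = 1)%R -> slash_eigen W2 eps (quarter_form eps).
Proof.
  intros He. apply slash_eigen_W2. intros z Hz. pose proof (UHP_neq0 z Hz). pose proof Ci_neq0. unfold quarter_form.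
  rewrite eta_quot_W2, eta_quot_2_W2, RtoC_mult, RtoC_opp by assumption.
  assert (E : (- i * (2 * z)) ^ 7 * / (- i * z) ^ 5 = (i * i) * (128 * z * z)) by (field; now split).
  assert (E' : (- i * z) ^ 7 * / (- i * (2 * z)) ^ 5 = (i * i) * (z * z * / 32)) by (field; now split).
  rewrite E, E', Ci_sqr. set (t := pow_quot eta_sq eta_sq_2 7 5 z). set (t' := pow_quot eta_sq_2 eta_sq 7 5 z).
  transitivity (RtoC eps * (2 * z * z) * t - RtoC eps * RtoC eps * (128 * z * z * t'));
    [rewrite <- RtoC_mult, He; field|ring].
Qed.

Definition three_quarter_form (z : C) : C := h2 z * hauptmodul_plus_inv (-1 * 4096) z.

Lemma three_quarter_form_monic : is_monic_qseries (- (3 / 4)) 0 three_quarter_form.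
Proof.
  eapply is_monic_qseries_eq; [|apply is_monic_qseries_mult; [apply h2_monic|apply hauptmodul_plus_inv_monic]]. field.
Qed.

Lemma three_quarter_form_W2 : slash_eigen W2 1%R three_quarter_form.
Proof.
  apply slash_eigen_W2. intros z Hz. unfold three_quarter_form.
  rewrite hauptmodul_plus_inv_W2, (proj1 (slash_eigen_W2 _ _) h2_W2) by (assumption || ring).
  transitivity (RtoC (-1) * RtoC (-1) * (2 * z * z) * (h2 z * hauptmodul_plus_inv (-1 * 4096) z)); [ring|].
  rewrite <- RtoC_mult. replace (-1 * -1)%R with 1%R by ring. reflexivity.
Qed.

Section Reduction.

Variables (rho eps : R) (f0 : C -> C).
Hypothesis f0_monic : is_monic_qseries rho 0 f0.
Hypothesis f0_W2 : slash_eigen W2 eps f0.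

Let raised (k : nat) (z : C) : C := f0 z * hauptmodul_plus_inv (1 * 4096) z ^ k.

Let raised_monic k : is_monic_qseries (rho - INR k) 0 (raised k).
Proof.
  eapply is_monic_qseries_eq; [|apply is_monic_qseries_mult; [exact f0_monic|apply is_monic_qseries_pow,
    hauptmodul_plus_inv_monic]].
  ring.
Qed.

Let raised_W2 k : slash_eigen W2 eps (raised k).
Proof.
  apply slash_eigen_W2. intros z Hz. unfold raised.
  rewrite (proj1 (slash_eigen_W2 _ _) f0_W2), hauptmodul_plus_inv_W2, Cmult_1_l by (assumption || ring). ring.
Qed.

(* Multiplying by the invariant [hauptmodul_plus_inv 4096] raises the order of the pole by one;
  the unwanted coefficients
   are then removed with the forms of smaller pole order. *)
Lemma ex_monic_qseries_W2 j : exists f, is_monic_qseries (rho - INR j) j f /\ slash_eigen W2 eps f.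
Proof.
  assert (H : forall k, (k <= j)%nat -> exists f, is_monic_qseries (rho - INR j) k f /\ slash_eigen W2 eps f).
  2:{ now apply H. }
  induction k as [|k IH]; intros Hk; [now exists (raised j)|].
  destruct (IH ltac:(lia)) as (f & Hf & HW).
  destruct (is_monic_qseries_reduce (rho - INR j) k f (raised (j - S k))) as [s Hs]; [assumption| |].
  - eapply is_monic_qseries_eq; [|apply raised_monic]. rewrite minus_INR by assumption. ring.
  - exists (fun z => f z + s * raised (j - S k) z). split; [assumption|]. now apply slash_eigen_plus_scal.
Qed.

End Reduction.

(** * Weakly holomorphic forms *)

Definition is_qexp (t s : R) (f : C -> C) (c : nat -> C) : Prop :=
  forall z, UHP z -> is_series (fun m => c m * qpow ((INR m - s) / t) z) (f z).

Lemma is_qexp_ext t s f g (c e : nat -> C) : (forall z, UHP z -> f z = g z) -> (forall m, c m = e m) ->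
  is_qexp t s f c -> is_qexp t s g e.
Proof.
  intros Ef Ec H z Hz. rewrite <- Ef by assumption. eapply is_series_Cext; [|now apply H]. intros m. cbv beta.
  now rewrite Ec.
Qed.

Lemma is_qexp_plus t s f g (c e : nat -> C) :
  is_qexp t s f c -> is_qexp t s g e -> is_qexp t s (fun z => f z + g z) (fun m => c m + e m).
Proof.
  intros Hf Hg z Hz. eapply is_series_Cext; [|now apply is_series_Cplus; [apply Hf|apply Hg]]. intros m. cbv beta. ring.
Qed.

Lemma is_qexp_scal t s x f (c : nat -> C) : is_qexp t s f c -> is_qexp t s (fun z => x * f z) (fun m => x * c m).
Proof.
  intros H z Hz. eapply is_series_Cext; [|apply is_series_Cscal, H, Hz]. intros m. cbv beta. ring.
Qed.

Lemma is_qexp_Csum t s (F : nat -> C -> C) (c : nat -> nat -> C) n : (forall l, is_qexp t s (F l) (c l)) ->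
  is_qexp t s (fun z => Csum (fun l => F l z) n) (fun m => Csum (fun l => c l m) n).
Proof.
  intros H z Hz. eapply is_series_Cext; [|exact (is_series_Csum_switch _ _ n (fun l => H l z Hz))].
  intros m. cbv beta. rewrite Cmult_comm, <- Csum_scal. apply Csum_ext. intros l _. ring.
Qed.

Lemma is_qexp_incr_n t s f (c : nat -> C) k : (forall m, (m < k)%nat -> c m = 0) ->
  is_qexp t s f c <-> is_qexp t (s - INR k) f (fun m => c (k + m)%nat).
Proof.
  intros Hc. assert (H : forall z, is_series (fun m => c m * qpow ((INR m - s) / t) z) (f z) <->
    is_series (fun m => c (k + m)%nat * qpow ((INR m - (s - INR k)) / t) z) (f z)).
  { intros z. rewrite <- (is_series_incr_0 _ k) by (intros m Hm; rewrite Hc by assumption; ring).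
    split; apply is_series_Cext; intros m; rewrite plus_INR; do 3 f_equal; ring. }
  split; intros Hf z Hz; now apply H, Hf.
Qed.

Lemma UHP_affine (z : C) (x D : R) : (0 < D)%R -> UHP z -> UHP ((z + x) / D).
Proof. intros HD Hz. rewrite div_R_scal by lra. apply UHP_scal; [now apply Rinv_0_lt_compat|now apply UHP_plus_R]. Qed.

Lemma is_qexp_affine t s f (c : nat -> C) (x D : R) : (0 < D)%R -> is_qexp t s f c ->
  is_qexp (t * D) s (fun z => f ((z + x) / D)) (fun m => qpow ((INR m - s) / (t * D)) x * c m).
Proof.
  intros HD H z Hz. eapply is_series_Cext; [|apply H, UHP_affine; eassumption]. intros m. cbv beta.
  rewrite div_R_scal, qpow_scal, qpow_Cplus by lra.
  replace ((INR m - s) / t * / D)%R with ((INR m - s) / (t * D))%R by (unfold Rdiv; rewrite Rinv_mult; ring).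
  ring.
Qed.

Lemma is_qexp_dilate M t s f (c : nat -> C) : (0 < M)%nat ->
  is_qexp (t * INR M) (s * INR M) f (dilate M c) <-> is_qexp t s f c.
Proof.
  intros HM. assert (INR M <> 0%R) by (apply not_0_INR; lia).
  assert (H' : forall z, is_series (fun m => dilate M c m * qpow ((INR m - s * INR M) / (t * INR M)) z) (f z) <->
    is_series (fun m => c m * qpow ((INR m - s) / t) z) (f z)).
  { intros z. rewrite <- (is_series_dilate M (fun m => c m * qpow ((INR m - s) / t) z)) by assumption.
    assert (E : forall m, dilate M (fun k => c k * qpow ((INR k - s) / t) z) m =
      dilate M c m * qpow ((INR m - s * INR M) / (t * INR M)) z).
    { apply (dilate_elim (fun m y => y = dilate M c m * qpow ((INR m - s * INR M) / (t * INR M)) z)); [assumption| |].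
      - intros n. rewrite dilate_mul, mult_INR by assumption. do 2 f_equal. unfold Rdiv. rewrite Rinv_mult.
        transitivity ((INR n - s) * / t * (INR M * / INR M))%R; [rewrite Rinv_r by assumption|]; ring.
      - intros n Hn. rewrite dilate_not_multiple by assumption. ring. }
    split; apply is_series_Cext; intros m; now rewrite E. }
  split; intros Hf z Hz; now apply H', Hf.
Qed.

Lemma abs_summable_of_is_series (c : nat -> C) (x y l : C) : (Cmod x < Cmod y)%R ->
  is_series (fun n => c n * y ^ n) l ->
  abs_summable (fun n => c n * x ^ n).
Proof.
  intros Hxy Hl. apply is_series_Csum, is_Clim_seq_bounded in Hl. destruct Hl as [M HM]. pose proof (Cmod_ge_0 x).
  apply abs_summable_le with (fun n => 2 * M * (Cmod x / Cmod y) ^ n)%R.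
  - intros n. assert (Hn : (Cmod (c n) * Cmod y ^ n <= 2 * M)%R).
    { rewrite <- Cmod_pow, <- Cmod_mult.
      replace (c n * y ^ n) with (Csum (fun n => c n * y ^ n) (S n) - Csum (fun n => c n * y ^ n) n) by (simpl; ring).
      eapply Rle_trans; [apply Cmod_minus_le|]. pose proof (HM (S n)). pose proof (HM n). lra. }
    rewrite Cmod_mult, Cmod_pow.
    replace (Cmod x ^ n)%R with (Cmod y ^ n * (Cmod x / Cmod y) ^ n)%R by (rewrite <- Rpow_mult_distr; f_equal; field;
      lra).
    rewrite <- Rmult_assoc. apply Rmult_le_compat_r; [|exact Hn].
    apply pow_le, Rmult_le_pos; [assumption|]. apply Rlt_le, Rinv_0_lt_compat. lra.
  - apply (ex_series_scal_l (2 * M)%R (fun n => (Cmod x / Cmod y) ^ n)%R), ex_series_geom.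
    rewrite Rabs_pos_eq; [apply Rlt_div_l; lra|]. apply Rmult_le_pos; [assumption|]. apply Rlt_le, Rinv_0_lt_compat.
    lra.
Qed.

Lemma ex_UHP_Cmod_qpow_1 r : (0 < r < 1)%R -> exists z, UHP z /\ Cmod (qpow 1 z) = r.
Proof.
  intros Hr. pose proof PI_RGT_0. exists ((0, - ln r / (2 * PI))%R : C). split.
  - unfold UHP; simpl. apply Rdiv_lt_0_compat; [|lra]. pose proof (ln_increasing r 1 ltac:(lra) ltac:(lra)) as E.
    rewrite ln_1 in E. lra.
  - rewrite Cmod_qpow; simpl. replace (- (2 * PI * 1 * (- ln r / (2 * PI))))%R with (ln r) by (field; lra).
    apply exp_ln. lra.
Qed.

Lemma is_qexp_1_qseries s f c : is_qexp 1 s f c <-> is_qseries (- s) f c.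
Proof.
  assert (E : forall z k, c k * qpow ((INR k - s) / 1) z = qpow (- s) z * (c k * qpow 1 z ^ k)).
  { intros z k. replace ((INR k - s) / 1)%R with (- s + INR k)%R by field. rewrite qpow_plus, qpow_INR. ring. }
  split.
  - intros H. assert (Hs : forall z, UHP z -> is_series (fun k => c k * qpow 1 z ^ k) (/ qpow (- s) z * f z)).
    { intros z Hz. pose proof (qpow_neq0 (- s) z). eapply is_series_Cext; [|apply is_series_Cscal, H, Hz].
      intros k. cbv beta. rewrite E. field. assumption. }
    split.
    + intros x Hx. destruct (ex_Cmod_between x Hx) as [y Hy]. pose proof (Cmod_ge_0 x).
      destruct (ex_UHP_Cmod_qpow_1 (Cmod y) ltac:(lra)) as (z & Hz & Ez).
      apply (abs_summable_of_is_series c x (qpow 1 z) _ ltac:(lra) (Hs z Hz)).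
    + intros z Hz. unfold CPSeries. rewrite (CSeries_unique _ _ (Hs z Hz)). field. apply qpow_neq0.
  - intros [Hc H] z Hz. eapply is_series_Cext; [intros k; symmetry; apply E|]. rewrite H by assumption.
    apply is_series_Cscal, CSeries_correct, Hc. now apply Cmod_qpow_1_lt_1.
Qed.

Lemma is_qexp_qseries M s f c : (0 < M)%nat -> is_qexp (INR M) s f (dilate M c) <-> is_qseries (- s / INR M) f c.
Proof.
  intros HM. assert (INR M <> 0%R) by (apply not_0_INR; lia).
  replace (- s / INR M)%R with (- (s / INR M))%R by (field; assumption).
  rewrite <- is_qexp_1_qseries, <- (is_qexp_dilate M 1) by assumption.
  now replace (s / INR M * INR M)%R with s by (field; assumption); rewrite Rmult_1_l.
Qed.

Lemma mdet_upper_triangular a b d : mdet (Mat a b 0 d) = (a * d)%Z.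
Proof. unfold mdet; cbn [ma mb mc md]. ring. Qed.

Lemma slash2_upper_triangular a b d f z : (0 < a)%Z -> (0 < d)%Z ->
  slash 2 (Mat a b 0 d) f z = RtoC (IZR a) / RtoC (IZR d) * f ((RtoC (IZR a) * z + RtoC (IZR b)) / RtoC (IZR d)).
Proof.
  intros Ha Hd. assert (RtoC (IZR d) <> 0) by (apply RtoC_neq0, not_0_IZR; lia).
  rewrite slash2E, mdet_upper_triangular, mult_IZR, RtoC_mult by (rewrite mdet_upper_triangular; nia).
  unfold aut, mact. cbn [ma mb mc md]. rewrite Cmult_0_l, !Cplus_0_l. field. assumption.
Qed.

Lemma odd_cusp_decomposition g : mdet g = 1%Z -> Z.Odd (mc g) ->
  exists G k, in_GammaStar2 G /\ mdet G = 2%Z /\ msmul 2 g = mmul G (Mat 1 k 0 2).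
Proof.
  intros Hg [u Hu]. set (k := (md g mod 2)%Z). exists (mmul g (Mat 2 (- k) 0 1)), k.
  assert (Hdet : mdet (mmul g (Mat 2 (- k) 0 1)) = 2%Z).
  { rewrite mdet_mmul, Hg. unfold mdet; cbn [ma mb mc md]. ring. }
  split; [|split; [exact Hdet|]].
  - right. split; [exact Hdet|]. unfold mmul; cbn [ma mb mc md].
    split; [exists (ma g); ring|]. split; [exists (mc g); ring|].
    exists (md g / 2 - k * u)%Z. rewrite Hu. unfold k. pose proof (Z.div_mod (md g) 2 ltac:(lia)). lia.
  - destruct g as [p q t s]. unfold msmul, mmul; cbn [ma mb mc md]. apply mat_eq; ring.
Qed.

Lemma mero_at_cusps_qexp r (eps : R) N f c : Z.Odd r -> (eps * eps = 1)%R -> T_invariant r f -> slash_eigen W2 eps f ->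
  is_qexp 4 (INR N) f c -> mero_at_cusps 2 f.
Proof.
  intros Hr He HT HW Hf g Hg. pose proof (slash_eigen_GammaStar2 r eps f Hr He HT HW) as Hchi.
  destruct (Z.Even_or_Odd (mc g)) as [Hc|Hc].
  - exists 4%nat, N, (fun m => chi r eps g * c m). split; [lia|]. intros z Hz.
    rewrite (Hchi g (or_introl (conj Hg Hc)) z Hz). replace (INR 4) with 4%R by (simpl; ring). now apply is_qexp_scal.
  - destruct (odd_cusp_decomposition g Hg Hc) as (G & k & HG & HdG & E).
    exists 8%nat, N, (fun m => chi r eps G * / 2 * (qpow ((INR m - INR N) / (4 * 2)) (IZR k) * c m)).
    split; [lia|]. intros z Hz. rewrite <- (slash2_msmul 2) by (lia || assumption).
    rewrite E, slash2_mmul by (rewrite ?HdG, ?mdet_upper_triangular; lia || assumption).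
    rewrite (slash2_ext _ _ (fun w => chi r eps G * f w)) by ((rewrite mdet_upper_triangular;
      lia) || assumption || now apply Hchi).
    rewrite slash2_scal, slash2_upper_triangular, Cmult_1_l by (rewrite ?mdet_upper_triangular; lia).
    replace (INR 8) with (4 * 2)%R by (simpl; ring).
    replace (chi r eps G * (1 / 2 * f ((z + IZR k) / 2))) with (chi r eps G * / 2 * f ((z + IZR k) / 2)) by field.
    apply (is_qexp_scal _ _ _ (fun z => f ((z + IZR k) / 2))); [|assumption].
    apply (is_qexp_affine 4 (INR N) f c (IZR k) 2); [lra|assumption].
Qed.

Lemma qcoef_dilate (d L : Z) (c : nat -> C) m : (0 < d)%Z -> (1 <= L)%Z -> c O = 1 ->
  (forall k : nat, (1 <= k)%nat -> (4 * Z.of_nat k - d < L)%Z -> c k = 0) ->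
  qcoef d (- d mod 4) L (fun n => c (Z.to_nat ((n + d) / 4))) (Z.of_nat m - d) = dilate 4 c m.
Proof.
  intros Hd HL Hc0 Hc. symmetry. revert m.
  apply (dilate_elim (fun m y => y = qcoef d (- d mod 4) L (fun n => c (Z.to_nat ((n + d) / 4))) (Z.of_nat m - d)));
    [lia| |]; intros k; unfold qcoef.
  - destruct (Z.eqb_spec (Z.of_nat (4 * k) - d) (- d)) as [E|E]; [replace k with O by lia; exact Hc0|].
    replace ((Z.of_nat (4 * k) - d) mod 4)%Z with (- d mod 4)%Z.
    2:{ replace (Z.of_nat (4 * k) - d)%Z with (- d + Z.of_nat k * 4)%Z by lia. now rewrite Z.mod_add. }
    rewrite Z.eqb_refl, Bool.andb_true_r.
    replace (Z.of_nat (4 * k) - d + d)%Z with (Z.of_nat k * 4)%Z by lia. rewrite Z.div_mul, Nat2Z.id by lia.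
    destruct (Z.leb_spec L (Z.of_nat (4 * k) - d)); [reflexivity|]. apply Hc; lia.
  - intros Hk. assert (Z.of_nat k mod 4 <> 0)%Z.
    { change 4%Z with (Z.of_nat 4). rewrite <- Nat2Z.inj_mod. lia. }
    rewrite (proj2 (Z.eqb_neq _ _)) by (intros E; apply H; now replace (Z.of_nat k) with 0%Z by lia).
    rewrite (proj2 (Z.eqb_neq ((Z.of_nat k - d) mod 4) _)); [now rewrite Bool.andb_false_r|].
    intros E. apply H. replace (Z.of_nat k) with ((Z.of_nat k - d) - - d)%Z by ring.
    now rewrite Zminus_mod, E, Z.sub_diag.
Qed.

Lemma Zodd_opp d : Z.Odd d -> Z.Odd (- d).
Proof. intros [k ->]. exists (- k - 1)%Z. ring. Qed.

Lemma is_form_of_monic_qseries (eps : R) (d L : Z) f (j : nat) : (eps * eps = 1)%R -> (0 < d)%Z -> Z.Odd d ->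
  (1 <= L)%Z ->
  (L <= 4 * (Z.of_nat j + 1) - d)%Z -> is_monic_qseries (- IZR d / 4) j f -> slash_eigen W2 eps f ->
  exists a, is_form d (- d mod 4) L (chi (- d) eps) f a.
Proof.
  intros He Hd Hodd HL Hj (c & Hf & Hc0 & Hc) HW. exists (fun n => c (Z.to_nat ((n + d) / 4))).
  pose proof (Zodd_opp d Hodd) as Hr.
  assert (HT : T_invariant (- d) f) by (apply (is_qseries_T_invariant _ f c); now rewrite opp_IZR).
  assert (Hq : is_qexp 4 (IZR d) f (dilate 4 c)).
  { replace 4%R with (INR 4) by (simpl; ring). apply is_qexp_qseries; [lia|].
    replace (INR 4) with 4%R by (simpl; ring). assumption. }
  replace (IZR d) with (INR (Z.to_nat d)) in Hq by (rewrite INR_IZR_INZ, Z2Nat.id by lia; reflexivity).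
  split; [split; [|split]|].
  - intros z. now apply (is_qseries_ex_derive (- IZR d / 4) f c).
  - intros g Hg. now apply slash_eigen_GammaStar2.
  - now apply (mero_at_cusps_qexp (- d) eps (Z.to_nat d) f (dilate 4 c)).
  - exists (Z.to_nat d). rewrite Z2Nat.id by lia. split.
    + intros n Hn. unfold qcoef. now rewrite (proj2 (Z.eqb_neq _ _)), (proj2 (Z.leb_gt _ _)) by lia.
    + intros z Hz. eapply is_series_Cext; [|exact (Hq z Hz)]. intros m. cbv beta.
      rewrite <- (qcoef_dilate d L c); try assumption.
      * reflexivity.
      * intros k Hk1 Hk2. apply Hc. lia.
Qed.

Lemma ex_form (eps rho : R) (d L : Z) f0 (j : nat) : (eps * eps = 1)%R -> (0 < d)%Z -> Z.Odd d -> (1 <= L)%Z ->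
  (L <= 4 * (Z.of_nat j + 1) - d)%Z -> is_monic_qseries rho 0 f0 -> slash_eigen W2 eps f0 ->
    (rho - INR j = - IZR d / 4)%R ->
  exists f a, is_form d (- d mod 4) L (chi (- d) eps) f a.
Proof.
  intros He Hd Hodd HL Hj Hf0 HW0 Hrho. destruct (ex_monic_qseries_W2 rho eps f0 Hf0 HW0 j) as (f & Hf & HW).
  exists f. rewrite Hrho in Hf. now apply (is_form_of_monic_qseries eps d L f j).
Qed.

Lemma Zodd_mod_4 d : (d mod 4 = 1 \/ d mod 4 = 3)%Z -> Z.Odd d.
Proof. intros H. pose proof (Z.div_mod d 4). destruct H; [exists (2 * (d / 4))%Z|exists (2 * (d / 4) + 1)%Z]; lia. Qed.

Lemma Zopp_mod_4 d r : (d mod 4 = r)%Z -> (0 < r)%Z -> (- d mod 4 = 4 - r)%Z.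
Proof. intros H Hr. rewrite Z.mod_opp_l_nz by lia. lia. Qed.

Lemma is_form_nubarE (eps : R) d L f a : (d mod 4 = 1)%Z ->
  is_form d 3 L (nubar eps) f a = is_form d (- d mod 4) L (chi (- d) eps) f a.
Proof. intros H. unfold chi. now rewrite (Zopp_mod_4 d 1 H). Qed.

Lemma is_form_nuE (eps : R) d L f a : (d mod 4 = 3)%Z ->
  is_form d 1 L (nu eps) f a = is_form d (- d mod 4) L (chi (- d) eps) f a.
Proof. intros H. unfold chi. now rewrite (Zopp_mod_4 d 3 H). Qed.

Lemma IZR_div_mod_4 d : IZR d = (4 * IZR (d / 4) + IZR (d mod 4))%R.
Proof. rewrite <- mult_IZR, <- plus_IZR. f_equal. apply Z.div_mod. lia. Qed.

Lemma ex_form_nubar (eps : R) d : (eps * eps = 1)%R -> (0 < d)%Z -> (d mod 4 = 1)%Z ->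
  exists f a, is_form d 3 1 (nubar eps) f a.
Proof.
  intros He Hd Hd4. pose proof (Z.div_mod d 4).
  destruct (ex_form eps (- (1 / 4)) d 1 (quarter_form eps) (Z.to_nat (d / 4))) as (f & a & Hf); try (lia || assumption).
  - apply Zodd_mod_4. lia.
  - apply quarter_form_monic.
  - now apply quarter_form_W2.
  - rewrite INR_IZR_INZ, Z2Nat.id, (IZR_div_mod_4 d), Hd4 by lia. field.
  - exists f, a. now rewrite is_form_nubarE.
Qed.

Lemma ex_form_nu_plus d : (0 < d)%Z -> (d mod 4 = 3)%Z -> exists f a, is_form d 1 1 (nu 1) f a.
Proof.
  intros Hd Hd4. pose proof (Z.div_mod d 4).
  destruct (ex_form 1 (- (3 / 4)) d 1 three_quarter_form (Z.to_nat (d / 4))) as (f & a & Hf); try (lia || lra).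
  - apply Zodd_mod_4. lia.
  - apply three_quarter_form_monic.
  - apply three_quarter_form_W2.
  - rewrite INR_IZR_INZ, Z2Nat.id, (IZR_div_mod_4 d), Hd4 by lia. field.
  - exists f, a. now rewrite is_form_nuE.
Qed.

Lemma ex_form_nu_minus d : (0 < d)%Z -> (d mod 4 = 3)%Z -> exists f a, is_form d 1 5 (nu (-1)) f a.
Proof.
  intros Hd Hd4. pose proof (Z.div_mod d 4).
  destruct (ex_form (-1) (1 / 4) d 5 h2 (Z.to_nat (d / 4 + 1))) as (f & a & Hf); try (lia || lra).
  - apply Zodd_mod_4. lia.
  - apply h2_monic.
  - apply h2_W2.
  - rewrite INR_IZR_INZ, Z2Nat.id, plus_IZR, (IZR_div_mod_4 d), Hd4 by lia. field.
  - exists f, a. now rewrite is_form_nuE.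
Qed.

(** * Vanishing and uniqueness *)

Definition residue_part (N m : nat) (a : nat -> C) (n : nat) : C :=
  if ((Z.of_nat n - Z.of_nat m) mod Z.of_nat N =? 0)%Z then a n else 0.

Lemma Cmod_residue_part_le N m a n : (Cmod (residue_part N m a n) <= Cmod (a n))%R.
Proof. unfold residue_part. destruct (_ =? _)%Z; [lra|]. rewrite Cmod_0. apply Cmod_ge_0. Qed.

Lemma abs_summable_residue_part N m a : abs_summable a -> abs_summable (residue_part N m a).
Proof. apply abs_summable_le, Cmod_residue_part_le. Qed.

Lemma is_Clim_seq_residue_part m a : abs_summable a -> is_Clim_seq (fun N => CSeries (residue_part (S N) m a)) (a m).
Proof.
  intros Ha. replace (a m) with (CSeries (fun n => if (n =? m)%nat then a n else 0)).
  2:{ rewrite (CSeries_fin _ (S m)), (Csum_single _ m), Nat.eqb_refl; [reflexivity|lia| |];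
        intros k Hk; [intros Hkm|]; now rewrite (proj2 (Nat.eqb_neq _ _)) by lia. }
  apply (is_Clim_seq_CSeries_dominated _ _ (fun n => Cmod (a n))); [intros; apply Cmod_residue_part_le|exact Ha|].
  intros n. apply (is_Clim_seq_ext_loc (fun _ => if (n =? m)%nat then a n else 0) _ _ (n + m));
    [|apply is_Clim_seq_const].
  intros N HN. unfold residue_part. destruct (Nat.eqb_spec n m) as [->|Hne].
  - now rewrite Z.sub_diag, Z.mod_0_l by lia.
  - rewrite (proj2 (Z.eqb_neq _ _)); [reflexivity|]. intros E. apply Z.mod_divide in E; [|lia].
    destruct E as [t Ht]. assert (t = 0 \/ 1 <= Z.abs t)%Z as [->|Ht'] by lia; [lia|]. nia.
Qed.

Lemma Csum_CSeries_residue_part N m a : (0 < N)%nat -> abs_summable a ->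
  Csum (fun l => CSeries (fun n => qpow (IZR (Z.of_nat n - Z.of_nat m) / INR N) (INR l) * a n)) N =
  INR N * CSeries (residue_part N m a).
Proof.
  intros HN Ha. rewrite <- CSeries_scal by now apply abs_summable_residue_part. symmetry. apply CSeries_unique.
  apply is_series_Cext with
    (fun n => Csum (fun l => qpow (IZR (Z.of_nat n - Z.of_nat m) / INR N) (INR l) * a n) N).
  - intros n. rewrite (Csum_ext _ (fun l => a n * qpow (IZR (Z.of_nat n - Z.of_nat m) / INR N) (INR l))) by (intros;
      ring).
    rewrite Csum_scal, Csum_roots_of_unity by assumption. unfold residue_part. destruct (_ =? _)%Z; ring.
  - apply (is_series_Csum_switch (fun l n => qpow (IZR (Z.of_nat n - Z.of_nat m) / INR N) (INR l) * a n)).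
    intros l. apply CSeries_correct. revert Ha. apply abs_summable_le. intros n. rewrite Cmod_mult, Cmod_qpow_R. lra.
Qed.

(* Cauchy's estimate, averaging over roots of unity instead of integrating over the circle. *)
Lemma Cmod_CPSeries_coef_le (c : nat -> C) (x : C) (B : R) (m : nat) : abs_summable (fun n => c n * x ^ n) ->
  (forall s : R, (Cmod (CPSeries c (x * qpow s 1)) <= B)%R) -> (Cmod (c m * x ^ m)%C <= B)%R.
Proof.
  intros Hc HB. refine (is_Clim_seq_Cmod_le _ _ B _ (is_Clim_seq_residue_part m _ Hc)). intros N.
  assert (HN : (0 < INR (S N))%R) by (apply lt_0_INR; lia).
  apply Rmult_le_reg_l with (INR (S N)); [assumption|].
  rewrite <- (Cmod_INR (S N)) at 1. rewrite <- Cmod_mult, <- Csum_CSeries_residue_part by (lia || assumption).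
  eapply Rle_trans; [apply (Cmod_Csum_le _ (fun _ => B))|apply Req_le; rewrite sum_cte; ring].
  intros l _.
  rewrite (CSeries_ext _ (fun n => qpow (- (INR m / INR (S N))) (INR l) * (c n * (x * qpow (INR l / INR (S N)) 1) ^
    n))).
  - rewrite CSeries_scal, Cmod_mult, Cmod_qpow_R, Rmult_1_l; [apply HB|].
    revert Hc. apply abs_summable_le. intros n. rewrite !Cmod_mult, !Cmod_pow, Cmod_mult, Cmod_qpow_R, Rmult_1_r. lra.
  - intros n. rewrite Cpow_mult_l, <- qpow_mult_INR, minus_IZR, <- !INR_IZR_INZ, !qpow_R.
    replace ((INR n - INR m) / INR (S N) * INR l)%R with (- (INR m / INR (S N)) * INR l +
      INR l / INR (S N) * INR n * 1)%R
      by (field; lra).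
    rewrite <- !qpow_R.
    rewrite Rmult_plus_distr_l, RtoC_plus, Cmult_plus_distr_r, cexp_plus, <- !qpow_R. ring.
Qed.

Lemma is_qseries_coef_le rho f c y B m : is_qseries rho f c -> (0 < y)%R ->
  (forall z, Im z = y -> (Cmod (f z) <= B)%R) -> (Cmod (c m) * exp (- (2 * PI * (rho + INR m) * y)) <= B)%R.
Proof.
  intros [Hc Hf] Hy HB. set (z := ((0, y) : C)). assert (Hz : UHP z) by exact Hy.
  apply (Rmult_le_reg_l (exp (2 * PI * rho * y))); [apply exp_pos|].
  replace (_ * (_ * _))%R with (Cmod (c m * qpow 1 z ^ m)).
  2:{ rewrite Cmod_mult, Cmod_pow, Cmod_qpow, <- exp_INR_mult. simpl Im.
      replace (- (2 * PI * (rho + INR m) * y))%R with (- (2 * PI * rho * y) + INR m * - (2 * PI * 1 * y))%R by ring.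
      rewrite exp_plus, exp_Ropp. pose proof (exp_pos (2 * PI * rho * y)). field. lra. }
  apply Cmod_CPSeries_coef_le; [now apply Hc, Cmod_qpow_1_lt_1|]. intros s.
  replace (qpow 1 z * qpow s 1) with (qpow 1 (z + s)) by (rewrite qpow_Cplus, !(qpow_R _ s), qpow_R; do 4 f_equal;
    ring).
  assert (Hs : Im (z + s) = y) by (change (y + 0 = y)%R; ring).
  specialize (HB (z + s) Hs). rewrite Hf, Cmod_mult, Cmod_qpow, Hs in HB by now apply UHP_plus_R.
  apply (Rmult_le_compat_l (exp (2 * PI * rho * y))) in HB; [|apply Rlt_le, exp_pos].
  rewrite <- Rmult_assoc, <- exp_plus, Rplus_opp_r, exp_0, Rmult_1_l in HB. exact HB.
Qed.

Lemma is_qseries_Cmod_le rho f c y B z : is_qseries rho f c -> (0 < y < Im z)%R ->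
  (forall z', Im z' = y -> (Cmod (f z') <= B)%R) ->
  (Cmod (f z) <= B * (exp (- (2 * PI * rho * (Im z - y))) / (1 - exp (- (2 * PI * (Im z - y))))))%R.
Proof.
  intros Hf Hy HB. pose proof PI_RGT_0. assert (Hz : UHP z) by (unfold UHP; lra).
  rewrite (proj2 Hf z Hz), Cmod_mult, Cmod_qpow.
  set (h := (Im z - y)%R). set (t := exp (- (2 * PI * h))).
  assert (Ht : (Rabs t < 1)%R).
  { rewrite Rabs_pos_eq by apply Rlt_le, exp_pos. unfold t. rewrite <- exp_0. apply exp_increasing. unfold h. nra. }
  assert (HE : (Cmod (CPSeries c (qpow 1 z)) <= B * exp (2 * PI * rho * y) * / (1 - t))%R).
  { rewrite <- (Series_geom t Ht), <- Series_scal_l. apply Cmod_CSeries_le.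
    2:{ apply (ex_series_scal_l (B * exp (2 * PI * rho * y))%R (fun n => t ^ n)%R). now apply ex_series_geom. }
    intros m. pose proof (is_qseries_coef_le rho f c y B m Hf ltac:(lra) HB) as Q.
    rewrite Cmod_mult, Cmod_pow, Cmod_qpow, <- exp_INR_mult. unfold t. rewrite <- exp_INR_mult.
    apply (Rmult_le_compat_r (exp (2 * PI * rho * y) * exp (INR m * - (2 * PI * h)))) in Q.
    2:{ apply Rlt_le, Rmult_lt_0_compat; apply exp_pos. }
    rewrite Rmult_assoc in Q. rewrite (Rmult_assoc B). eapply Rle_trans; [|exact Q]. apply Req_le. f_equal.
    rewrite <- !exp_plus. f_equal. unfold h. ring. }
  apply (Rmult_le_compat_l (exp (- (2 * PI * rho * Im z)))) in HE; [|apply Rlt_le, exp_pos].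
  eapply Rle_trans; [exact HE|]. apply Req_le. unfold Rdiv.
  replace (exp (- (2 * PI * rho * h))) with (exp (- (2 * PI * rho * Im z)) * exp (2 * PI * rho * y))%R
    by (rewrite <- exp_plus; f_equal; unfold h; ring). ring.
Qed.

Lemma pow_mult_exp_opp_le (a y : R) (w : nat) : (0 < a)%R -> (0 <= y)%R ->
  (y ^ w * exp (- (a * y)) <= (INR w / a) ^ w)%R.
Proof.
  intros Ha Hy. destruct (Nat.eq_dec w 0) as [->|Hw].
  - simpl. rewrite Rmult_1_l, <- exp_0. apply exp_le_compat.
    pose proof (Rmult_le_pos a y ltac:(lra) Hy). lra.
  - assert (HwR : (0 < INR w)%R) by (apply lt_0_INR; lia).
    replace (- (a * y))%R with (INR w * - (a * y / INR w))%R by (field; lra).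
    rewrite exp_INR_mult, <- Rpow_mult_distr. pose proof (exp_pos (a * y / INR w)) as He.
    pose proof (exp_ineq1_le (a * y / INR w)) as Q. apply pow_incr. rewrite exp_Ropp. split.
    + apply Rmult_le_pos; [assumption|]. now apply Rlt_le, Rinv_0_lt_compat.
    + apply Rle_div_l; [assumption|]. replace y with (INR w / a * (a * y / INR w))%R at 1 by (field; lra).
      apply Rmult_le_compat_l; [|lra]. apply Rlt_le, Rdiv_lt_0_compat; assumption.
Qed.

Lemma is_qseries_bounded rho f c (y0 : R) (w : nat) : is_qseries rho f c -> (0 < rho)%R -> (0 < y0)%R ->
  exists M, forall z, (y0 <= Im z)%R -> (Im z ^ w * Cmod (f z) <= M)%R.
Proof.
  intros [Hc Hf] Hrho Hy0. pose proof PI_RGT_0. set (x := qpow 1 ((0, y0) : C)).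
  assert (Hx : abs_summable (fun n => c n * x ^ n)) by now apply Hc, Cmod_qpow_1_lt_1.
  exists ((INR w / (2 * PI * rho)) ^ w * l1norm (fun n => c n * x ^ n)%C)%R. intros z Hz.
  rewrite Hf, Cmod_mult, Cmod_qpow, <- Rmult_assoc by (unfold UHP; lra). apply Rmult_le_compat.
  - apply Rmult_le_pos; [apply pow_le; lra|apply Rlt_le, exp_pos].
  - apply Cmod_ge_0.
  - apply pow_mult_exp_opp_le; [nra|lra].
  - apply Cmod_CSeries_le; [|exact Hx]. intros n. rewrite !Cmod_mult, !Cmod_pow.
    apply Rmult_le_compat_l; [apply Cmod_ge_0|]. apply pow_incr. split; [apply Cmod_ge_0|].
    unfold x. rewrite !Cmod_qpow. apply exp_le_compat. simpl. nra.
Qed.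

Lemma ex_nearest_integer (x : R) : exists n : Z, (Rabs (x + IZR n) <= 1 / 2)%R.
Proof.
  exists (- up (x - 1 / 2))%Z. destruct (archimed (x - 1 / 2)). rewrite opp_IZR. apply Rabs_le. lra.
Qed.

Lemma Im_W2 z : UHP z -> Im (- / (2 * z)) = (Im z / (2 * Cmod z ^ 2))%R.
Proof.
  intros Hz. rewrite Im_neg_inv by (apply UHP_neq0, UHP_scal; [lra|assumption]).
  rewrite Im_scal_R, Cmod_mult, Cmod_R, Rabs_pos_eq by lra. field. apply Rgt_not_eq, Cmod_gt_0. now apply UHP_neq0.
Qed.

Lemma Im_W2_ge z : UHP z -> (Rabs (Re z) <= 1 / 2)%R -> (Im z <= 49 / 100)%R ->
  (101 / 100 * Im z <= Im (- / (2 * z)))%R.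
Proof.
  intros Hz HR HI. rewrite Im_W2 by assumption. pose proof Hz as Hy. unfold UHP in Hy.
  assert (Hm : (0 < Cmod z ^ 2)%R) by (apply pow_lt, Cmod_gt_0; now apply UHP_neq0).
  apply (Rle_div_r (101 / 100 * Im z) (Im z) (2 * Cmod z ^ 2)); [lra|]. apply Rabs_le_between in HR. rewrite Cmod2_alt.
  assert (Re z ^ 2 <= 1 / 4)%R by nra. assert (Im z ^ 2 <= 2401 / 10000)%R by nra.
  pose proof (Rmult_le_pos (Im z) (1 - 101 / 100 * (2 * (Re z ^ 2 + Im z ^ 2))) ltac:(lra) ltac:(lra)). lra.
Qed.

Lemma Fricke_fundamental_domain (T : Type) (phi : C -> T) :
  (forall z (n : Z), UHP z -> phi (z + IZR n) = phi z) -> (forall z, UHP z -> phi (- / (2 * z)) = phi z) ->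
  forall z, UHP z -> exists z', (49 / 100 <= Im z')%R /\ phi z' = phi z.
Proof.
  intros HT HW.
  assert (H : forall n z, UHP z -> (49 / 100 <= (101 / 100) ^ n * Im z)%R ->
    exists z', (49 / 100 <= Im z')%R /\ phi z' = phi z).
  { induction n as [|n IH]; intros z Hz Hn; [exists z; simpl in Hn; split; [lra|reflexivity]|].
    destruct (Rle_lt_dec (49 / 100) (Im z)) as [H|H]; [now exists z|].
    destruct (ex_nearest_integer (Re z)) as [k Hk]. set (z1 := z + IZR k).
    assert (Hz1 : UHP z1) by now apply UHP_plus_R.
    assert (HI : Im z1 = Im z) by (change (Im z + 0 = Im z)%R; ring).
    pose proof (Im_W2_ge z1 Hz1 Hk ltac:(lra)) as HG. rewrite HI in HG.
    destruct (IH (- / (2 * z1)) (UHP_W2 z1 Hz1)) as (z' & Hz' & E).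
    - simpl in Hn. apply (Rmult_le_compat_l ((101 / 100) ^ n)) in HG; [lra|apply pow_le; lra].
    - exists z'. split; [assumption|]. rewrite E, HW by assumption. now apply HT. }
  intros z Hz. unfold UHP in Hz.
  destruct (Pow_x_infinity (101 / 100) ltac:(rewrite Rabs_pos_eq; lra) (49 / 100 / Im z)) as [n Hn].
  specialize (Hn n (Nat.le_refl _)). rewrite Rabs_pos_eq in Hn by (apply pow_le; lra).
  apply (H n z Hz). apply Rge_le in Hn. apply Rle_div_l in Hn; lra.
Qed.

Lemma pow_1_plus_div_le_exp n x : (0 <= x)%R -> ((1 + x / INR (S n)) ^ S n <= exp x)%R.
Proof.
  intros Hx. assert (0 < INR (S n))%R by (apply lt_0_INR; lia).
  replace (exp x) with (exp (INR (S n) * (x / INR (S n)))) by (f_equal; field; lra). rewrite exp_INR_mult.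
  apply pow_incr. split; [|apply exp_ineq1_le].
  apply Rplus_le_le_0_compat; [lra|]. apply Rmult_le_pos; [assumption|]. now apply Rlt_le, Rinv_0_lt_compat.
Qed.

Lemma exp_opp_le (x y : R) (n : nat) : (0 <= x)%R -> (0 < y)%R -> (/ y <= (1 + x / INR (S n)) ^ S n)%R ->
  (exp (- x) <= y)%R.
Proof.
  intros Hx Hy H. rewrite exp_Ropp, <- (Rinv_inv y). apply Rinv_le_contravar; [now apply Rinv_0_lt_compat|].
  eapply Rle_trans; [exact H|]. now apply pow_1_plus_div_le_exp.
Qed.

Lemma contraction_factor_le (w : nat) (rho y : R) : (1 <= w)%nat -> (3 / 4 * INR w <= rho)%R -> (49 / 100 <= y)%R ->
  (2 ^ w * (exp (- (PI * rho * y)) / (1 - exp (- (PI * y)))) <= 14 / 15)%R.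
Proof.
  intros Hw Hrho Hy. pose proof PI2_3_2. apply (le_INR 1) in Hw as HwR. simpl in HwR.
  assert (Hnum : (2 * exp (- (3 / 4 * (PI * y))) <= 7 / 10)%R).
  { assert (exp (- (3 / 4 * (PI * y))) <= exp (- (11025 / 10000)))%R by (apply exp_le_compat; nra).
    assert (exp (- (11025 / 10000)) <= 35 / 100)%R by (apply (exp_opp_le _ _ 15); simpl; lra). lra. }
  assert (Hden : (3 / 4 <= 1 - exp (- (PI * y)))%R).
  { assert (exp (- (PI * y)) <= exp (- (147 / 100)))%R by (apply exp_le_compat; nra).
    assert (exp (- (147 / 100)) <= 1 / 4)%R by (apply (exp_opp_le _ _ 15); simpl; lra). lra. }
  pose proof (exp_pos (- (3 / 4 * (PI * y)))) as He.
  assert (Hpow : (2 ^ w * exp (- (PI * rho * y)) <= 7 / 10)%R).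
  { apply Rle_trans with ((2 * exp (- (3 / 4 * (PI * y)))) ^ w)%R.
    - rewrite Rpow_mult_distr, <- exp_INR_mult. apply Rmult_le_compat_l; [apply pow_le; lra|].
      apply exp_le_compat. assert (0 < PI * y)%R by nra. nra.
    - destruct w as [|w]; [lia|].
      assert ((2 * exp (- (3 / 4 * (PI * y)))) ^ w <= 1)%R by (rewrite <- (pow1 w); apply pow_incr; lra).
      assert (0 <= (2 * exp (- (3 / 4 * (PI * y)))) ^ w)%R by (apply pow_le; lra). simpl pow. nra. }
  unfold Rdiv at 1. rewrite <- Rmult_assoc. apply Rle_div_l; lra.
Qed.

(* [y^w |F|] is invariant under the Fricke group, hence bounded by its supremum over [y >= 49/100]; there Cauchy's
   estimates on the line of height [y/2] improve any bound by the factor [14/15]. *)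
Section Vanishing.

Variables (w : nat) (rho : R) (F : C -> C) (c : nat -> C).
Hypothesis Hw : (1 <= w)%nat.
Hypothesis Hrho : (3 / 4 * INR w <= rho)%R.
Hypothesis HF : is_qseries rho F c.
Hypothesis HFW : forall z, UHP z -> Cmod (F (- / (2 * z))) = ((2 * Cmod z ^ 2) ^ w * Cmod (F z))%R.

Let phi (z : C) : R := (Im z ^ w * Cmod (F z))%R.

Let phi_dominated z : UHP z -> exists z', (49 / 100 <= Im z')%R /\ phi z' = phi z.
Proof.
  apply Fricke_fundamental_domain; unfold phi; clear z.
  - intros z n Hz. rewrite !(proj2 HF) by (try apply UHP_plus_R; assumption).
    rewrite qpow_1_period, !Cmod_mult, !Cmod_qpow. change (Im (z + IZR n)) with (Im z + 0)%R. now rewrite Rplus_0_r.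
  - intros z Hz. rewrite HFW, Im_W2 by assumption. unfold Rdiv. rewrite Rpow_mult_distr, pow_inv. field.
    apply pow_nonzero. pose proof (proj1 (Cmod_gt_0 z) (UHP_neq0 z Hz)). nra.
Qed.

Let phi_bounded : exists M, forall z, UHP z -> (phi z <= M)%R.
Proof.
  apply (le_INR 1) in Hw as HwR. simpl in HwR.
  destruct (is_qseries_bounded rho F c (49 / 100) w HF ltac:(lra) ltac:(lra)) as [M HM].
  exists M. intros z Hz. destruct (phi_dominated z Hz) as (z' & Hz' & <-). now apply HM.
Qed.

Let phi_contract M : (forall z, UHP z -> (phi z <= M)%R) -> forall z, UHP z -> (phi z <= 14 / 15 * M)%R.
Proof.
  intros HM z0 Hz0. assert (HM0 : (0 <= M)%R).
  { eapply Rle_trans; [|apply (HM z0 Hz0)].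
    apply Rmult_le_pos; [apply pow_le; unfold UHP in Hz0; lra|apply Cmod_ge_0]. }
  destruct (phi_dominated z0 Hz0) as (z & Hy & <-). unfold phi. set (y := Im z) in *.
  assert (Hyw : (0 < (y / 2) ^ w)%R) by (apply pow_lt; lra).
  pose proof (is_qseries_Cmod_le rho F c (y / 2) (M / (y / 2) ^ w) z HF ltac:(fold y; lra)) as Q. fold y in Q.
  apply (Rmult_le_compat_l (y ^ w)) in Q; [|apply pow_le; lra|].
  - eapply Rle_trans; [exact Q|]. pose proof (contraction_factor_le w rho y Hw Hrho Hy) as K.
    replace (2 * PI * rho * (y - y / 2))%R with (PI * rho * y)%R by field.
    replace (2 * PI * (y - y / 2))%R with (PI * y)%R by field.
    set (e := (exp (- (PI * rho * y)) / (1 - exp (- (PI * y))))%R) in *.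
    replace (y ^ w * (M / (y / 2) ^ w * e))%R with (2 ^ w * e * M)%R; [now apply Rmult_le_compat_r|].
    replace (y ^ w)%R with (2 ^ w * (y / 2) ^ w)%R by (rewrite <- Rpow_mult_distr; f_equal; field). field. lra.
  - intros z' Hz'. apply Rle_div_r; [assumption|]. specialize (HM z' ltac:(unfold UHP; lra)).
    unfold phi in HM. rewrite Hz' in HM. lra.
Qed.

Lemma is_qseries_eq_0 z : UHP z -> F z = 0.
Proof.
  intros Hz. destruct phi_bounded as [M HM].
  assert (HMn : forall n z, UHP z -> (phi z <= (14 / 15) ^ n * M)%R).
  { induction n as [|n IH]; intros y Hy; [simpl; rewrite Rmult_1_l; now apply HM|].
    simpl pow. rewrite Rmult_assoc. now apply phi_contract. }
  assert (HL : is_lim_seq (fun n => (14 / 15) ^ n * M)%R 0).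
  { replace (Finite 0) with (Rbar_mult 0 M) by (simpl; f_equal; ring).
    apply (is_lim_seq_scal_r (fun n => (14 / 15) ^ n)%R M 0). apply is_lim_seq_geom. rewrite Rabs_pos_eq; lra. }
  assert (HP : (phi z <= 0)%R).
  { apply (is_lim_seq_le (fun _ => phi z) (fun n => (14 / 15) ^ n * M)%R (phi z) 0); [intros n;
      now apply HMn| |exact HL].
    apply is_lim_seq_const. }
  apply Cmod_eq_0. pose proof (Cmod_ge_0 (F z)). unfold phi in HP. unfold UHP in Hz.
  pose proof (pow_lt (Im z) w Hz). nra.
Qed.

End Vanishing.

Lemma is_qseries_W2_eq_0 rho (eps : R) F c : is_qseries rho F c -> (3 / 4 <= rho)%R -> (eps * eps = 1)%R ->
  slash_eigen W2 eps F -> forall z, UHP z -> F z = 0.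
Proof.
  intros HF Hr He HW. apply (is_qseries_eq_0 1 rho F c); [lia|simpl; lra|assumption|].
  intros z Hz. rewrite (proj1 (slash_eigen_W2 _ _) HW), !Cmod_mult, !Cmod_R, (Rabs_pos_eq 2) by (assumption || lra).
  replace (Rabs eps) with 1%R; [simpl; ring|]. rewrite <- Rabs_R1. apply Rsqr_eq_abs_0. unfold Rsqr. lra.
Qed.

Lemma is_qseries_drop rho f (a : nat -> C) : is_qseries rho f a -> a O = 0 -> is_qseries (rho + 1) f (fun n => a (S n)).
Proof.
  intros [Ha Hf] H0.
  assert (Hs : forall x : C, x <> 0 -> (Cmod x < 1)%R -> abs_summable (fun n => a (S n) * x ^ n)).
  { intros x Hx0 Hx. apply abs_summable_ext with (fun n => / x * (a (1 + n)%nat * x ^ (1 + n))).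
    - intros n. change (1 + n)%nat with (S n). rewrite Cpow_S. field. assumption.
    - now apply abs_summable_scal, (abs_summable_incr_n (fun n => a n * x ^ n)), Ha. }
  split.
  - intros x Hx. destruct (ex_Cmod_between x Hx) as [y Hy]. apply (abs_summable_pow_le _ x y); [lra|].
    apply Hs; [|lra]. apply Cmod_gt_0. pose proof (Cmod_ge_0 x). lra.
  - intros z Hz. pose proof (Cmod_qpow_1_lt_1 z Hz) as Hq. rewrite Hf, qpow_plus, <- Cmult_assoc by assumption.
    f_equal. unfold CPSeries. rewrite (CSeries_incr_1 (fun n => a n * qpow 1 z ^ n)) by now apply Ha.
    rewrite H0, Cmult_0_l, Cplus_0_l, <- CSeries_scal by (apply Hs; [apply qpow_neq0|assumption]).
    apply CSeries_ext. intros n. rewrite Cpow_S. ring.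
Qed.

Lemma sqr_eq_h2_sqr (eps : R) f c : (eps * eps = 1)%R -> is_qseries (1 / 4) f c -> slash_eigen W2 eps f ->
  forall z, UHP z -> f z * f z = c O * c O * (h2 z * h2 z).
Proof.
  intros He Hf HW. destruct h2_monic as (ch & Hh & Hh0 & _).
  set (G z := f z * f z + - (c O * c O) * (h2 z * h2 z)).
  assert (HG : is_qseries (1 / 4 + 1 / 4) G (fun n => CPS_mult c c n + - (c O * c O) * CPS_mult ch ch n)).
  { apply is_qseries_plus; [now apply is_qseries_mult|]. now apply is_qseries_scal, is_qseries_mult. }
  apply is_qseries_drop in HG; [|rewrite !CPS_mult_0, Hh0; ring].
  assert (HG0 : forall z, UHP z -> G z = 0).
  { apply (is_qseries_eq_0 2 (1 / 4 + 1 / 4 + 1) G _ ltac:(lia) ltac:(simpl; lra) HG). intros z Hz.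
    replace (G (- / (2 * z))) with ((2 * (z * z)) * (2 * (z * z)) * G z).
    - rewrite !Cmod_mult, Cmod_R, Rabs_pos_eq by lra. simpl. ring.
    - unfold G. rewrite (proj1 (slash_eigen_W2 _ _) HW), (proj1 (slash_eigen_W2 _ _) h2_W2), RtoC_m1 by assumption.
      transitivity (4 * z ^ 4 * ((RtoC eps * RtoC eps) * (f z * f z) - c O * c O * (h2 z * h2 z))); [|ring].
      rewrite <- RtoC_mult, He. ring. }
  intros z Hz. apply Cminus_diag_uniq. rewrite <- (HG0 z Hz). unfold G. ring.
Qed.

Definition W2_fixed_point : C := (0, / sqrt 2)%R.

Lemma UHP_W2_fixed_point : UHP W2_fixed_point.
Proof. unfold UHP; simpl. apply Rinv_0_lt_compat, sqrt_lt_R0. lra. Qed.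

Lemma W2_fixed_point_sqr : 2 * W2_fixed_point * W2_fixed_point = - (1).
Proof.
  pose proof (sqrt_lt_R0 2 ltac:(lra)) as Hs. unfold W2_fixed_point, Cmult, RtoC, Copp; simpl. f_equal; [|ring].
  transitivity (- (2 / (sqrt 2 * sqrt 2)))%R; [field; lra|]. rewrite sqrt_sqrt by lra. field.
Qed.

Lemma slash_eigen_W2_fixed_point f : slash_eigen W2 1%R f -> f W2_fixed_point = 0.
Proof.
  intros HW. pose proof (proj1 (slash_eigen_W2 _ _) HW _ UHP_W2_fixed_point) as E.
  pose proof (UHP_neq0 _ UHP_W2_fixed_point). rewrite W2_fixed_point_sqr in E.
  replace (- / (2 * W2_fixed_point)) with W2_fixed_point in E.
  - transitivity (/ 2 * (f W2_fixed_point - 1 * - (1) * f W2_fixed_point)); [field|]. rewrite <- E. ring.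
  - apply (Cmult_reg_l (2 * W2_fixed_point)); [apply Cmult_neq_0; [apply RtoC_neq0; lra|assumption]|].
    rewrite W2_fixed_point_sqr. field. assumption.
Qed.

(* The sign of [W2] is opposite to that of [h2], which has no zeros, so [f] vanishes at the fixed point of [W2] while
   [f^2] is proportional to [h2^2]. *)
Lemma is_qseries_quarter_W2_eq_0 f c : is_qseries (1 / 4) f c -> slash_eigen W2 1%R f -> forall z, UHP z -> f z = 0.
Proof.
  intros Hf HW. pose proof (sqr_eq_h2_sqr 1 f c ltac:(lra) Hf HW) as E.
  pose proof (E _ UHP_W2_fixed_point) as E0. rewrite slash_eigen_W2_fixed_point in E0 by assumption.
  pose proof (h2_neq0 _ UHP_W2_fixed_point) as Hh.
  assert (Hc : c O * c O = 0).
  { apply (Cmult_reg_l (h2 W2_fixed_point * h2 W2_fixed_point)); [now apply Cmult_neq_0|].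
    rewrite (Cmult_comm _ (c O * c O)), <- E0. ring. }
  intros z Hz. specialize (E z Hz). rewrite Hc, Cmult_0_l in E.
  destruct (excluded_middle_informative (f z = 0)) as [|Hn]; [assumption|]. now destruct (Cmult_neq_0 _ _ Hn Hn).
Qed.

Lemma in_GammaStar2_W2 : in_GammaStar2 W2.
Proof.
  right. unfold mdet, W2; cbn [ma mb mc md].
  split; [reflexivity|]. split; [now exists 0%Z|]. split; [now exists 1%Z|now exists 0%Z].
Qed.

Lemma weakly_holomorphic_W2 r (eps : R) f : Z.Odd r -> weakly_holomorphic 2 in_GammaStar2 (chi r eps) f ->
  slash_eigen W2 eps f.
Proof.
  intros Hr (_ & H & _) z Hz. rewrite (H W2 in_GammaStar2_W2 z Hz), chiE by assumption.
  change (mdet W2 =? 1)%Z with false. cbv iota. change (mc W2 / 2 * (ma W2 / 2 + md W2 / 2))%Z with 0%Z.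
  rewrite Z.mul_0_r. change (ipow 0) with (RtoC 1). ring.
Qed.

Lemma is_qexp_enlarge_order t f (c : Z -> C) N K : (forall n : Z, (n < - Z.of_nat N)%Z -> c n = 0) ->
  is_qexp t (INR N) f (fun m => c (Z.of_nat m - Z.of_nat N)%Z) <->
  is_qexp t (INR (K + N)) f (fun m => c (Z.of_nat m - Z.of_nat (K + N))%Z).
Proof.
  intros Hc. rewrite (is_qexp_incr_n t (INR (K + N)) f _ K) by (intros m Hm; apply Hc; lia).
  replace (INR (K + N) - INR K)%R with (INR N) by (rewrite plus_INR; ring).
  split; apply is_qexp_ext; try reflexivity; intros m; f_equal; lia.
Qed.

Lemma has_qexp_ext t f g (c e : Z -> C) : (forall z, UHP z -> f z = g z) -> (forall n, c n = e n) ->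
  has_qexp t f c -> has_qexp t g e.
Proof.
  intros Ef Ec [N [Hc Hf]]. exists N. split; [intros n Hn; rewrite <- Ec; now apply Hc|].
  revert Hf. apply is_qexp_ext; [exact Ef|]. intros m. apply Ec.
Qed.

Lemma has_qexp_plus t f g (c e : Z -> C) : has_qexp t f c -> has_qexp t g e ->
  has_qexp t (fun z => f z + g z) (fun n => c n + e n).
Proof.
  intros [N [Hc Hf]] [M [He Hg]]. apply (is_qexp_enlarge_order t f c N M Hc) in Hf.
  apply (is_qexp_enlarge_order t g e M N He) in Hg.
  rewrite Nat.add_comm in Hg. exists (M + N)%nat. split.
  - intros n Hn. rewrite Hc, He by lia. ring.
  - exact (is_qexp_plus _ _ _ _ _ _ Hf Hg).
Qed.

Lemma has_qexp_scal t (s : C) f (c : Z -> C) : has_qexp t f c -> has_qexp t (fun z => s * f z) (fun n => s * c n).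
Proof.
  intros [N [Hc Hf]]. exists N. split; [intros n Hn; rewrite Hc by assumption; ring|].
  exact (is_qexp_scal _ _ s _ _ Hf).
Qed.

Lemma has_qexp_qseries M f (c : Z -> C) (L : nat) : (0 < M)%nat -> has_qexp (INR M) f c ->
  (forall n : Z, (n < Z.of_nat L)%Z -> c n = 0) ->
  (forall n : Z, (n mod Z.of_nat M <> Z.of_nat L mod Z.of_nat M)%Z -> c n = 0) ->
  is_qseries (INR L / INR M) f (fun k => c (Z.of_nat L + Z.of_nat M * Z.of_nat k)%Z).
Proof.
  intros HM [N [_ Hf]] HL Hs. change (is_qexp (INR M) (INR N) f (fun m => c (Z.of_nat m - Z.of_nat N)%Z)) in Hf.
  rewrite (is_qexp_incr_n _ _ f _ (N + L)) in Hf by (intros m Hm; apply HL; lia).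
  replace (INR L) with (- (INR N - INR (N + L)))%R by (rewrite plus_INR; ring). apply is_qexp_qseries; [assumption|].
  revert Hf. apply is_qexp_ext; [reflexivity|].
  apply (dilate_elim (fun m y => c (Z.of_nat (N + L + m) - Z.of_nat N)%Z = y)); [assumption| |].
  - intros n. f_equal. lia.
  - intros n Hn. apply Hs. intros E. apply Hn.
    assert (Y : (Z.of_nat n mod Z.of_nat M = 0)%Z).
    { replace (Z.of_nat n) with ((Z.of_nat (N + L + n) - Z.of_nat N) - Z.of_nat L)%Z by lia.
      now rewrite Zminus_mod, E, Z.sub_diag. }
    rewrite <- Nat2Z.inj_mod in Y. lia.
Qed.

Lemma qcoef_not_mod d r L a n : (- d mod 4 = r)%Z -> (n mod 4 <> r)%Z -> qcoef d r L a n = 0.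
Proof.
  intros Hr Hn. unfold qcoef. rewrite (proj2 (Z.eqb_neq n (- d))) by congruence.
  rewrite (proj2 (Z.eqb_neq (n mod 4) r)) by assumption. now rewrite Bool.andb_false_r.
Qed.

Lemma qcoef_lt d r L a n : (n < L)%Z -> qcoef d r L a n = if (n =? - d)%Z then 1 else 0.
Proof.
  intros Hn. unfold qcoef. destruct (n =? - d)%Z; [reflexivity|]. now rewrite (proj2 (Z.leb_gt _ _)) by lia.
Qed.

(* [M] is the first exponent [>= L] that can occur. *)
Lemma is_form_unique (eps : R) d L (M : nat) : Z.Odd d -> (Z.of_nat M mod 4 = - d mod 4)%Z ->
  (forall n, (L <= n < Z.of_nat M)%Z -> (n mod 4 <> - d mod 4)%Z) ->
  (forall F c, is_qseries (INR M / 4) F c -> slash_eigen W2 eps F -> forall z, UHP z -> F z = 0) ->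
  forall f g a b, is_form d (- d mod 4) L (chi (- d) eps) f a -> is_form d (- d mod 4) L (chi (- d) eps) g b ->
  forall z, UHP z -> g z = f z.
Proof.
  intros Hd HM Hgap Hvanish f g a b [Wf Qf] [Wg Qg] z Hz.
  pose proof (Zodd_opp d Hd) as Hr.
  pose proof (has_qexp_plus 4 _ _ _ _ Qg (has_qexp_scal 4 (- (1)) _ _ Qf)) as Q.
  replace 4%R with (INR 4) in Q by (simpl; ring).
  apply (has_qexp_qseries 4 _ _ M) in Q; [|lia| |].
  - apply Cminus_diag_uniq. replace (INR 4) with 4%R in Q by (simpl; ring).
    rewrite <- (Hvanish _ _ Q) with (z := z); [ring| |assumption].
    apply slash_eigen_plus_scal; [reflexivity| |]; eapply weakly_holomorphic_W2; eassumption.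
  - intros n Hn. destruct (Z_lt_le_dec n L) as [Hlt|Hge].
    + rewrite !qcoef_lt by assumption. ring.
    + rewrite !qcoef_not_mod by (reflexivity || now apply Hgap). ring.
  - intros n Hn. change (Z.of_nat 4) with 4%Z in Hn. rewrite HM in Hn.
    rewrite !qcoef_not_mod by (reflexivity || assumption). ring.
Qed.

(** * Hecke operators *)

Lemma mdet_Hecke_translation_gt_0 P (b : Z) : (0 < P)%nat -> (0 < mdet (Mat 1 b 0 (Z.of_nat P)))%Z.
Proof. intros HP. rewrite mdet_upper_triangular. lia. Qed.

Lemma mdet_Hecke_dilation_gt_0 P : (0 < P)%nat -> (0 < mdet (Mat (Z.of_nat P) 0 0 1))%Z.
Proof. intros HP. rewrite mdet_upper_triangular. lia. Qed.

Definition hecke_U (t : Z) (P : nat) (f : C -> C) (z : C) : C :=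
  Csum (fun l => slash 2 (Mat 1 (t * Z.of_nat l) 0 (Z.of_nat P)) f z) P.

Lemma hecke_pE t P f z : (0 < P)%nat ->
  hecke_p 2 t (Z.of_nat P) f z = hecke_U t P f z + slash 2 (Mat (Z.of_nat P) 0 0 1) f z.
Proof.
  intros HP. unfold hecke_p. replace (INR 2 / 2 - 1)%R with 0%R by (simpl; field).
  rewrite Rpower_O, Cmult_1_l by (apply (IZR_lt 0); lia). f_equal.
  rewrite sum_n_Csum, Nat2Z.id. unfold hecke_U. f_equal. lia.
Qed.

Definition dilate_Z (p : Z) (c : Z -> C) (n : Z) : C := if (n mod p =? 0)%Z then c (n / p)%Z else 0.

Lemma dilate_Z_mul p c n : p <> 0%Z -> dilate_Z p c (p * n) = c n.
Proof. intros Hp. unfold dilate_Z. now rewrite Z.mul_comm, Z.mod_mul, Z.div_mul, Z.eqb_refl. Qed.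

Lemma dilate_Z_elim (Q : Z -> C -> Prop) p c : p <> 0%Z -> (forall n, Q (p * n)%Z (c n)) ->
  (forall n, (n mod p <> 0)%Z -> Q n 0) -> forall n, Q n (dilate_Z p c n).
Proof.
  intros Hp H1 H0 n. unfold dilate_Z. destruct (Z.eqb_spec (n mod p) 0) as [E|E]; [|now apply H0].
  pose proof (Z.div_mod n p Hp) as D. rewrite E, Z.add_0_r in D. rewrite D at 1. apply H1.
Qed.

Lemma dilate_shift P N (c : Z -> C) m : (0 < P)%nat ->
  dilate P (fun k => c (Z.of_nat k - Z.of_nat N)%Z) m = dilate_Z (Z.of_nat P) c (Z.of_nat m - Z.of_nat (P * N)).
Proof.
  intros HP. revert m. apply (dilate_elim (fun m y => y = dilate_Z (Z.of_nat P) c (Z.of_nat m - Z.of_nat (P * N))));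
    [assumption| |].
  - intros k. replace (Z.of_nat (P * k) - Z.of_nat (P * N))%Z with (Z.of_nat P * (Z.of_nat k - Z.of_nat N))%Z by lia.
    rewrite dilate_Z_mul by lia. reflexivity.
  - intros m Hm. unfold dilate_Z. rewrite (proj2 (Z.eqb_neq _ _)); [reflexivity|]. intros E. apply Hm.
    replace (Z.of_nat m - Z.of_nat (P * N))%Z with (Z.of_nat m + - Z.of_nat N * Z.of_nat P)%Z in E by lia.
    rewrite Z.mod_add, <- Nat2Z.inj_mod in E by lia. lia.
Qed.

Lemma Csum_hecke_U_coef (t : Z) P N (c : Z -> C) m : (0 < t)%Z -> (0 < P)%nat ->
  Csum (fun l => / INR P * (qpow ((INR m - INR (P * N)) / (IZR t * INR P)) (IZR (t * Z.of_nat l)) *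
    c (Z.of_nat m - Z.of_nat (P * N))%Z)) P =
  dilate P (fun k => c (Z.of_nat P * (Z.of_nat k - Z.of_nat N))%Z) m.
Proof.
  intros Ht HP. assert (IZR t <> 0%R) by (apply not_0_IZR; lia). assert (HPR : INR P <> 0%R) by (apply not_0_INR; lia).
  rewrite (dilate_shift P N (fun n => c (Z.of_nat P * n)%Z)) by assumption.
  set (n := (Z.of_nat m - Z.of_nat (P * N))%Z).
  rewrite (Csum_ext _ (fun l => / INR P * c n * qpow (IZR n / INR P) (INR l))).
  - rewrite Csum_scal, Csum_roots_of_unity by assumption. unfold dilate_Z.
    destruct (Z.eqb_spec (n mod Z.of_nat P) 0) as [E|E]; [|ring].
    pose proof (Z.div_mod n (Z.of_nat P) ltac:(lia)) as D. rewrite E, Z.add_0_r in D. rewrite <- D.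
    field. now apply RtoC_neq0.
  - intros l _. replace (INR m - INR (P * N))%R with (IZR n) by (unfold n; now rewrite minus_IZR, <- !INR_IZR_INZ).
    replace (qpow (IZR n / (IZR t * INR P)) (IZR (t * Z.of_nat l))) with (qpow (IZR n / INR P) (INR l)); [ring|].
    rewrite !qpow_R, mult_IZR, <- INR_IZR_INZ. do 4 f_equal. field. split; assumption.
Qed.

Lemma has_qexp_hecke_U t P f c : (0 < t)%Z -> (0 < P)%nat -> has_qexp (IZR t) f c ->
  has_qexp (IZR t) (hecke_U t P f) (fun n => c (Z.of_nat P * n)%Z).
Proof.
  intros Ht HP [N [Hc Hf]]. apply (is_qexp_enlarge_order (IZR t) f c N (P * N - N) Hc) in Hf.
  replace (P * N - N + N)%nat with (P * N)%nat in Hf by nia.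
  exists N. split; [intros n Hn; apply Hc; nia|]. apply (is_qexp_dilate P); [assumption|].
  replace (INR N * INR P)%R with (INR (P * N)) by (rewrite mult_INR; ring).
  assert (Hl : forall l : nat, is_qexp (IZR t * INR P) (INR (P * N)) (slash 2 (Mat 1 (t * Z.of_nat l) 0 (Z.of_nat P)) f)
    (fun m => / INR P * (qpow ((INR m - INR (P * N)) / (IZR t * INR P)) (IZR (t * Z.of_nat l)) *
      c (Z.of_nat m - Z.of_nat (P * N))%Z))).
  { intros l. eapply is_qexp_ext; [|reflexivity|apply is_qexp_scal, is_qexp_affine, Hf; now apply lt_0_INR].
    intros z Hz. cbv beta. rewrite slash2_upper_triangular, <- INR_IZR_INZ by lia.
    rewrite Cmult_1_l. unfold Cdiv at 2. now rewrite Cmult_1_l. }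
  eapply is_qexp_ext; [reflexivity| |exact (is_qexp_Csum _ _ _ _ P Hl)]. intros m.
  exact (Csum_hecke_U_coef t P N c m Ht HP).
Qed.

Lemma has_qexp_hecke_V t P f c : (0 < P)%nat -> has_qexp t f c ->
  has_qexp t (slash 2 (Mat (Z.of_nat P) 0 0 1) f) (fun n => INR P * dilate_Z (Z.of_nat P) c n).
Proof.
  intros HP [N [Hc Hf]]. change (is_qexp t (INR N) f (fun m => c (Z.of_nat m - Z.of_nat N)%Z)) in Hf.
  assert (HPR : INR P <> 0%R) by (apply not_0_INR; lia). exists (P * N)%nat. split.
  - intros n Hn. unfold dilate_Z. destruct (_ =? _)%Z; [|ring]. rewrite Hc; [ring|]. apply Z.div_lt_upper_bound; lia.
  - assert (HG : is_qexp (t * / INR P) (INR N) (fun z => f (INR P * z)) (fun k => c (Z.of_nat k - Z.of_nat N)%Z)).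
    { eapply is_qexp_ext; [| |refine (is_qexp_affine t (INR N) f _ 0 (/ INR P) _ Hf);
        now apply Rinv_0_lt_compat, lt_0_INR].
      - intros z Hz. cbv beta. f_equal. rewrite Cplus_0_r, RtoC_inv by assumption. field. now apply RtoC_neq0.
      - intros k. cbv beta. rewrite qpow_at_0. ring. }
    apply (is_qexp_dilate P), (is_qexp_scal _ _ (INR P)) in HG; [|assumption].
    replace (t * / INR P * INR P)%R with t in HG by (field; assumption).
    replace (INR N * INR P)%R with (INR (P * N)) in HG by (rewrite mult_INR; ring).
    revert HG. apply is_qexp_ext.
    + intros z Hz. rewrite slash2_upper_triangular, <- INR_IZR_INZ by lia.
      replace ((INR P * z + 0) / 1) with (INR P * z) by field. field.
    + intros m. now rewrite dilate_shift.
Qed.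

Definition hecke_coef (p : Z) (c : Z -> C) (n : Z) : C := c (p * n)%Z + IZR p * dilate_Z p c n.

Lemma has_qexp_hecke_p t P f c : (0 < t)%Z -> (0 < P)%nat -> has_qexp (IZR t) f c ->
  has_qexp (IZR t) (hecke_p 2 t (Z.of_nat P) f) (hecke_coef (Z.of_nat P) c).
Proof.
  intros Ht HP Hf. eapply has_qexp_ext; [| |exact (has_qexp_plus _ _ _ _ _ (has_qexp_hecke_U t P f c Ht HP Hf)
    (has_qexp_hecke_V (IZR t) P f c HP Hf))].
  - intros z Hz. symmetry. now apply hecke_pE.
  - intros n. unfold hecke_coef. now rewrite <- INR_IZR_INZ.
Qed.

Lemma ex_opp_inverse_mod p a : prime p -> ~ (p | a)%Z -> exists x, (0 < x < p)%Z /\ (p | a * x + 1)%Z.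
Proof.
  intros Hp Ha. pose proof (prime_ge_2 p Hp).
  destruct (rel_prime_bezout _ _ (rel_prime_sym _ _ (prime_rel_prime p Hp a Ha))) as [u v Huv].
  assert (Hx : (p | a * (- u mod p) + 1)%Z).
  { exists (v - a * (- u / p))%Z. pose proof (Z.div_mod (- u) p ltac:(lia)) as D.
    replace (- u mod p)%Z with (- u - p * (- u / p))%Z by lia.
    transitivity (u * a + v * p - u * a - a * p * (- u / p))%Z; [rewrite Huv|]; ring. }
  exists (- u mod p)%Z. split; [|assumption]. pose proof (Z.mod_pos_bound (- u) p ltac:(lia)).
  assert (- u mod p <> 0)%Z; [|lia]. intros E. rewrite E, Z.mul_0_r in Hx. apply Z.divide_pos_le in Hx; lia.
Qed.

Lemma ex_opp_inverse_involution (P : nat) (a : Z) : prime (Z.of_nat P) -> ~ (Z.of_nat P | a)%Z ->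
  exists sg : nat -> nat, sg O = O /\ (forall l, (l < P)%nat -> (sg l < P)%nat /\ sg (sg l) = l) /\
    forall l, (0 < l < P)%nat -> (Z.of_nat P | a * Z.of_nat l * Z.of_nat (sg l) + 1)%Z.
Proof.
  intros Hp Ha. set (p := Z.of_nat P) in *. pose proof (prime_ge_2 p Hp).
  assert (Hal : forall l, (0 < l < P)%nat -> ~ (p | a * Z.of_nat l)%Z).
  { intros l Hl D. apply prime_mult in D; [|assumption]. destruct D as [D|D]; [now apply Ha|].
    apply Z.divide_pos_le in D; lia. }
  set (Q l x := (0 < x < P)%nat /\ (p | a * Z.of_nat l * Z.of_nat x + 1)%Z).
  set (sg l := if (l =? 0)%nat then O else epsilon (inhabits O) (Q l)).
  assert (Hsg : forall l, (0 < l < P)%nat -> Q l (sg l)).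
  { intros l Hl. unfold sg. rewrite (proj2 (Nat.eqb_neq _ _)) by lia. apply epsilon_spec.
    destruct (ex_opp_inverse_mod p _ Hp (Hal l Hl)) as (x & Hx & D). exists (Z.to_nat x). split; [lia|].
    now rewrite Z2Nat.id by lia. }
  exists sg. split; [reflexivity|]. split; [|now intros l Hl; apply Hsg].
  intros [|l] Hl; [now split|]. destruct (Hsg (S l) ltac:(lia)) as [B D]. split; [lia|].
  destruct (Hsg _ B) as [B' D']. set (m := sg (S l)) in *. set (k := sg m) in *.
  assert (E : (p | Z.of_nat k - Z.of_nat (S l))%Z).
  { apply Gauss with (a * Z.of_nat m)%Z; [|apply prime_rel_prime; auto].
    replace (a * Z.of_nat m * (Z.of_nat k - Z.of_nat (S l)))%Z
      with ((a * Z.of_nat m * Z.of_nat k + 1) - (a * Z.of_nat (S l) * Z.of_nat m + 1))%Z by ring.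
    now apply Z.divide_sub_r. }
  destruct E as [t Ht]. unfold p in Ht. assert (t = 0)%Z by nia. subst t. lia.
Qed.

Lemma prime_not_divide_32 p : prime p -> p <> 2%Z -> ~ (p | 32)%Z.
Proof.
  intros Hp Hp2 D. assert (H2 : (p | 2)%Z).
  { change 32%Z with (2 * (2 * (2 * (2 * 2))))%Z in D.
    repeat (apply prime_mult in D; [destruct D as [D|D]; [assumption|]|assumption]).
    assumption. }
  pose proof (prime_ge_2 p Hp). apply Z.divide_pos_le in H2; lia.
Qed.

Lemma slash2_Csum m (F : nat -> C -> C) n z : (0 < mdet m)%Z ->
  slash 2 m (fun w => Csum (fun l => F l w) n) z = Csum (fun l => slash 2 m (F l) z) n.
Proof.
  intros Hm. rewrite slash2E by assumption. rewrite <- Csum_scal. apply Csum_ext. intros l _. now rewrite slash2E.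
Qed.

Lemma slash_exchange g g' m n (c : C) f z : (0 < mdet g)%Z -> (0 < mdet g')%Z -> (0 < mdet m)%Z -> (0 < mdet n)%Z ->
  mmul m g = mmul g' n -> slash_eigen g' c f -> UHP z -> slash 2 g (slash 2 m f) z = c * slash 2 n f z.
Proof.
  intros Hg Hg' Hm Hn E H Hz. rewrite <- slash2_mmul, E, slash2_mmul by assumption.
  now rewrite (slash2_ext n _ (fun w => c * f w)), slash2_scal by assumption.
Qed.

(* [[1, 4l], [0, P]] W2 = G [[1, 4l'], [0, P]] with [G] in the coset of [W2]. *)
Lemma slash_Hecke_translation_W2 r (eps : R) (P l l' : nat) f z : Z.Odd r -> (eps * eps = 1)%R -> T_invariant r f ->
  slash_eigen W2 eps f -> (0 < P)%nat -> (Z.of_nat P | 32 * Z.of_nat l * Z.of_nat l' + 1)%Z -> UHP z ->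
  slash 2 W2 (slash 2 (Mat 1 (4 * Z.of_nat l) 0 (Z.of_nat P)) f) z =
  RtoC eps * slash 2 (Mat 1 (4 * Z.of_nat l') 0 (Z.of_nat P)) f z.
Proof.
  intros Hr He HT HW HP [t Ht] Hz. set (a := Z.of_nat l) in *. set (a' := Z.of_nat l') in *. set (p := Z.of_nat P) in *.
  set (G := Mat (2 * (4 * a)) (- t) (2 * p) (2 * (- 4 * a'))).
  assert (HdG : mdet G = 2%Z).
  { unfold G, mdet; cbn [ma mb mc md]. transitivity (2 * (t * p) - 64 * a * a')%Z; [ring|]. rewrite <- Ht. ring. }
  assert (HG : slash_eigen G eps f).
  { assert (Hstar : in_GammaStar2 G) by (right; split; [exact HdG|]; split; [|split]; eexists; reflexivity).
    pose proof (slash_eigen_GammaStar2 r eps f Hr He HT HW G Hstar) as E. rewrite chiE, HdG in E by assumption.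
    change (2 =? 1)%Z with false in E. cbv iota in E. unfold G in E at 2 3 4. cbn [ma mc md] in E.
    rewrite !(Z.mul_comm 2), !Z.div_mul in E by lia.
    replace (ipow (r * (p * (4 * a + - 4 * a')))) with (RtoC 1) in E; [now rewrite Cmult_1_r in E|].
    symmetry. replace (r * (p * (4 * a + - 4 * a')))%Z with (r * p * (a - a') * 4)%Z by ring.
    apply (ipow_eq_mod _ 0). now rewrite Z.mod_mul by lia. }
  apply (slash_exchange W2 G); try assumption; try (now apply mdet_Hecke_translation_gt_0); [reflexivity|lia|].
  unfold mmul, G, W2; cbn [ma mb mc md]. apply mat_eq; try ring.
  transitivity (32 * a * a' - t * p)%Z; [rewrite <- Ht|]; ring.
Qed.

Lemma hecke_p_W2 r (eps : R) P f : Z.Odd r -> (eps * eps = 1)%R -> prime (Z.of_nat P) -> Z.of_nat P <> 2%Z ->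
  T_invariant r f -> slash_eigen W2 eps f -> slash_eigen W2 eps (hecke_p 2 4 (Z.of_nat P) f).
Proof.
  intros Hr He Hp Hp2 HT HW z Hz. pose proof (prime_ge_2 _ Hp). assert (HP : (0 < P)%nat) by lia.
  set (A l := Mat 1 (4 * Z.of_nat l) 0 (Z.of_nat P)). set (D := Mat (Z.of_nat P) 0 0 1).
  destruct (ex_opp_inverse_involution P 32 Hp (prime_not_divide_32 _ Hp Hp2)) as (sg & Hsg0 & Hsg & Hinv).
  assert (E0 : slash 2 W2 (slash 2 (A O) f) z = RtoC eps * slash 2 D f z).
  { apply (slash_exchange W2 W2); try assumption; try reflexivity.
    - now apply mdet_Hecke_translation_gt_0.
    - now apply mdet_Hecke_dilation_gt_0.
    - unfold mmul, A, D, W2; cbn [ma mb mc md]. apply mat_eq; ring. }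
  assert (ED : slash 2 W2 (slash 2 D f) z = RtoC eps * slash 2 (A O) f z).
  { apply (slash_exchange W2 W2); try assumption; try reflexivity.
    - now apply mdet_Hecke_dilation_gt_0.
    - now apply mdet_Hecke_translation_gt_0.
    - unfold mmul, A, D, W2; cbn [ma mb mc md]. apply mat_eq; ring. }
  assert (E : forall w, hecke_p 2 4 (Z.of_nat P) f w = Csum (fun l => slash 2 (A l) f w) P + slash 2 D f w)
    by (intros; now apply hecke_pE).
  rewrite (slash2_ext W2 _ _ z ltac:(reflexivity) Hz (fun w _ => E w)), slash2_plus, E by reflexivity.
  rewrite (slash2_Csum W2 (fun l => slash 2 (A l) f)) by reflexivity.
  rewrite <- (Csum_involution (fun l => slash 2 (A l) f z) sg P Hsg).
  destruct P as [|P']; [lia|]. rewrite !Csum_S_l, Hsg0. fold (A O).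
  rewrite (Csum_ext _ (fun l => RtoC eps * slash 2 (A (sg (S l))) f z)), Csum_scal.
  - rewrite E0, ED. ring.
  - intros l Hl. apply (slash_Hecke_translation_W2 r); try assumption. apply Hinv. lia.
Qed.

Fixpoint hecke_pow_coef (p : Z) (c : Z -> C) (n : nat) : Z -> C :=
  match n with
  | O => c
  | S k => fun m => c (p ^ Z.of_nat (S k) * m)%Z + IZR p * dilate_Z p (hecke_pow_coef p c k) m
  end.

Lemma hecke_pow_coef_S p c n m : hecke_pow_coef p c (S n) m =
  c (p ^ Z.of_nat (S n) * m)%Z + IZR p * dilate_Z p (hecke_pow_coef p c n) m.
Proof. reflexivity. Qed.

(* With [U : c(n) -> c(pn)] and [V : c(n) -> c(n/p)] the definition reads [T(p^(n+1)) = U^(n+1) + p V T(p^n)], and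
   the recurrence of the Hecke operators follows from [U V = 1]. *)
Lemma hecke_coef_pow_coef p c n m : (0 < p)%Z ->
  hecke_coef p (hecke_pow_coef p c (S n)) m = hecke_pow_coef p c (S (S n)) m + IZR p * hecke_pow_coef p c n m.
Proof.
  intros Hp. unfold hecke_coef. rewrite (hecke_pow_coef_S p c (S n)), hecke_pow_coef_S, dilate_Z_mul by lia.
  replace (p ^ Z.of_nat (S (S n)) * m)%Z with (p ^ Z.of_nat (S n) * (p * m))%Z; [ring|].
  rewrite (Nat2Z.inj_succ (S n)), Z.pow_succ_r by lia. ring.
Qed.

Lemma hecke_pow_coef_1 p c m : hecke_pow_coef p c 1 m = hecke_coef p c m.
Proof. unfold hecke_coef. now rewrite hecke_pow_coef_S, Z.pow_1_r. Qed.

Lemma hecke_pow_coef_at_1 p c n : (1 < p)%Z -> hecke_pow_coef p c n 1 = c (p ^ Z.of_nat n)%Z.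
Proof.
  intros Hp. destruct n as [|n]; [reflexivity|]. rewrite hecke_pow_coef_S. unfold dilate_Z.
  rewrite Z.mod_1_l, Z.mul_1_r by lia. simpl. ring.
Qed.

Lemma Zodd_mul a b : Z.Odd a -> Z.Odd b -> Z.Odd (a * b).
Proof. intros [k ->] [j ->]. exists (2 * k * j + k + j)%Z. ring. Qed.

Lemma Zodd_pow p (n : nat) : Z.Odd p -> Z.Odd (p ^ Z.of_nat n).
Proof.
  intros Hp. induction n as [|n IH]; [now exists 0%Z|]. rewrite Nat2Z.inj_succ, Z.pow_succ_r by lia. now apply Zodd_mul.
Qed.

Lemma Zmul_odd_mod_4_cancel q m r : Z.Odd q -> ((q * m) mod 4 = r mod 4)%Z -> (m mod 4 = (r * q) mod 4)%Z.
Proof.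
  intros [k Hk] H. rewrite <- Zmult_mod_idemp_l, <- H, Zmult_mod_idemp_l.
  replace (q * m * q)%Z with (m + (k * k + k) * m * 4)%Z by (subst q; ring). symmetry. apply Z.mod_add. lia.
Qed.

Lemma hecke_pow_coef_support p r (c : Z -> C) n : Z.Odd p -> (forall k : Z, (k mod 4 <> r mod 4)%Z -> c k = 0) ->
  forall m, (m mod 4 <> (r * p ^ Z.of_nat n) mod 4)%Z -> hecke_pow_coef p c n m = 0.
Proof.
  intros Hp Hc. assert (p <> 0%Z) by (destruct Hp; lia). induction n as [|n IH]; intros m Hm.
  - apply Hc. now rewrite Z.pow_0_r, Z.mul_1_r in Hm.
  - rewrite hecke_pow_coef_S, Hc by (intros E; now apply Hm, Zmul_odd_mod_4_cancel; [apply Zodd_pow|]).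
    replace (dilate_Z p (hecke_pow_coef p c n) m) with (RtoC 0); [ring|]. symmetry. revert m Hm.
    refine (dilate_Z_elim (fun m y => (m mod 4 <> (r * p ^ Z.of_nat (S n)) mod 4)%Z ->
      y = 0) p _ _ _ _); [assumption| |reflexivity].
    intros k Hk. apply IH. intros E. apply Hk.
    rewrite <- Zmult_mod_idemp_r, E, Zmult_mod_idemp_r, Nat2Z.inj_succ, Z.pow_succ_r by lia. f_equal. ring.
Qed.

Lemma hecke_pow_coef_nonpos p (c : Z -> C) n : (1 < p)%Z ->
  (forall k : Z, (k <= 0)%Z -> c k = if (k =? - (1))%Z then 1 else 0) -> forall m, (m <= 0)%Z ->
  hecke_pow_coef p c n m = if (m =? - p ^ Z.of_nat n)%Z then RtoC (IZR (p ^ Z.of_nat n)) else 0.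
Proof.
  intros Hp Hc. induction n as [|n IH]; intros m Hm; [now apply Hc|].
  rewrite hecke_pow_coef_S, Nat2Z.inj_succ, Z.pow_succ_r by lia.
  assert (Hq : (0 < p ^ Z.of_nat n)%Z) by (apply Z.pow_pos_nonneg; lia). set (q := (p ^ Z.of_nat n)%Z) in *.
  pose proof (Z.mul_le_mono_nonneg 2 p 1 q ltac:(lia) ltac:(lia) ltac:(lia) ltac:(lia)) as Hpq.
  assert (Hne : (p * q * m <> - (1))%Z) by (destruct (Z.eq_dec m 0) as [->|]; nia).
  rewrite Hc, (proj2 (Z.eqb_neq _ _) Hne), Cplus_0_l by nia. clear Hne Hpq.
  revert m Hm. refine (dilate_Z_elim (fun m y => (m <= 0)%Z -> IZR p * y = if (m =? -
    (p * q))%Z then RtoC (IZR (p * q)) else 0)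
    p _ _ _ _); [lia| |].
  - intros k Hk. rewrite IH by nia. destruct (Z.eqb_spec k (- q)) as [->|Hne].
    + rewrite (proj2 (Z.eqb_eq _ _)) by ring. now rewrite mult_IZR, RtoC_mult.
    + rewrite (proj2 (Z.eqb_neq _ _)) by nia. ring.
  - intros m Hm _. rewrite (proj2 (Z.eqb_neq _ _)); [ring|]. intros E. apply Hm. rewrite E.
    replace (- (p * q))%Z with (- q * p)%Z by ring. apply Z.mod_mul. lia.
Qed.

Lemma has_qexp_T_invariant r f c : has_qexp 4 f c -> (forall n : Z, (n mod 4 <> r mod 4)%Z -> c n = 0) ->
  T_invariant r f.
Proof.
  intros [N [_ H]] Hc z Hz. pose proof (H (z + 1) (UHP_plus_R z 1 Hz)) as H1.
  apply (is_series_Cunique _ _ _ H1). eapply is_series_Cext; [|apply is_series_Cscal, H, Hz].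
  intros m. cbv beta. set (n := (Z.of_nat m - Z.of_nat N)%Z).
  destruct (Z.eq_dec (n mod 4) (r mod 4)) as [E|E]; [|rewrite Hc by exact E; ring].
  rewrite qpow_Cplus, <- (ipow_eq_mod _ _ E), ipowE.
  replace (IZR n) with (INR m - INR N)%R by (unfold n; now rewrite minus_IZR, <- !INR_IZR_INZ). ring.
Qed.

Lemma slash_eigen_ext m (c : C) f g : (0 < mdet m)%Z -> (forall z, UHP z -> f z = g z) -> slash_eigen m c f ->
  slash_eigen m c g.
Proof. intros Hm E H z Hz. rewrite <- E, (slash2_ext m g f) by (assumption || now symmetry; apply E). now apply H. Qed.

Lemma prime_odd p : prime p -> p <> 2%Z -> Z.Odd p.
Proof.
  intros Hp Hp2. destruct (Z.Even_or_Odd p) as [[k Hk]|H]; [exfalso|exact H]. pose proof (prime_ge_2 p Hp).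
  assert (D : (2 | p)%Z) by (exists k; lia). apply prime_divisors in D; [lia|assumption].
Qed.

Section HeckePowers.

Variables (p r : Z) (eps : R) (f : C -> C) (c : Z -> C).
Hypothesis p_prime : prime p.
Hypothesis p_neq_2 : p <> 2%Z.
Hypothesis r_odd : Z.Odd r.
Hypothesis eps_sqr : (eps * eps = 1)%R.
Hypothesis f_qexp : has_qexp 4 f c.
Hypothesis c_support : forall n : Z, (n mod 4 <> r mod 4)%Z -> c n = 0.
Hypothesis f_W2 : slash_eigen W2 eps f.

Let hecke_step n g : has_qexp 4 g (hecke_pow_coef p c n) -> slash_eigen W2 eps g ->
  has_qexp 4 (hecke_p 2 4 p g) (hecke_coef p (hecke_pow_coef p c n)) /\ slash_eigen W2 eps (hecke_p 2 4 p g).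
Proof.
  intros Hg HW. pose proof (prime_ge_2 p p_prime). pose proof (prime_odd p p_prime p_neq_2) as Hodd.
  rewrite <- (Z2Nat.id p) in * by lia. set (P := Z.to_nat p) in *.
  split; [apply (has_qexp_hecke_p 4); lia || assumption|].
  apply (hecke_p_W2 (r * Z.of_nat P ^ Z.of_nat n)); try assumption.
  - apply Zodd_mul; [assumption|]. now apply Zodd_pow.
  - apply (has_qexp_T_invariant _ _ _ Hg). now apply hecke_pow_coef_support.
Qed.

Let hecke_pn_SS n z : hecke_pn 2 4 p (S (S n)) f z =
  hecke_p 2 4 p (hecke_pn 2 4 p (S n) f) z + - IZR p * hecke_pn 2 4 p n f z.
Proof.
  pose proof (prime_ge_2 p p_prime). cbn [hecke_pn]. replace (INR 2 - 1)%R with 1%R by (simpl; ring).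
  rewrite Rpower_1 by (apply (IZR_lt 0); lia). ring.
Qed.

Let hecke_pn_two_steps n :
  (has_qexp 4 (hecke_pn 2 4 p n f) (hecke_pow_coef p c n) /\ slash_eigen W2 eps (hecke_pn 2 4 p n f)) /\
  (has_qexp 4 (hecke_pn 2 4 p (S n) f) (hecke_pow_coef p c (S n)) /\ slash_eigen W2 eps (hecke_pn 2 4 p (S n) f)).
Proof.
  induction n as [|n [[Hq0 HW0] [Hq1 HW1]]].
  - destruct (hecke_step O f f_qexp f_W2) as [Hq HW]. split; (split; [|assumption]); [assumption|].
    revert Hq. apply has_qexp_ext; [reflexivity|]. intros m. symmetry. apply hecke_pow_coef_1.
  - destruct (hecke_step (S n) _ Hq1 HW1) as [Hq HW]. split; [now split|]. split.
    + eapply has_qexp_ext; [| |exact (has_qexp_plus _ _ _ _ _ Hq (has_qexp_scal _ (- IZR p) _ _ Hq0))].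
      * intros z _. symmetry. apply hecke_pn_SS.
      * intros m. cbv beta. pose proof (prime_ge_2 p p_prime). rewrite hecke_coef_pow_coef by (lia). ring.
    + eapply slash_eigen_ext; [reflexivity| |exact (slash_eigen_plus_scal W2 eps (- IZR p) _ _ eq_refl HW HW0)].
      intros z _. symmetry. apply hecke_pn_SS.
Qed.

Lemma has_qexp_hecke_pn n : has_qexp 4 (hecke_pn 2 4 p n f) (hecke_pow_coef p c n).
Proof. apply hecke_pn_two_steps. Qed.

Lemma hecke_pn_W2 n : slash_eigen W2 eps (hecke_pn 2 4 p n f).
Proof. apply hecke_pn_two_steps. Qed.

End HeckePowers.

Lemma is_qseries_quarters_W2_eq_0 (eps : R) (M : nat) : (eps * eps = 1)%R -> (3 <= M)%nat -> forall F c,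
  is_qseries (INR M / 4) F c -> slash_eigen W2 eps F -> forall z, UHP z -> F z = 0.
Proof.
  intros He HM F c HF HW. apply (is_qseries_W2_eq_0 (INR M / 4) eps F c HF); [|assumption|assumption].
  apply (le_INR 3) in HM. simpl in HM. lra.
Qed.

Lemma unique_form_nubar (eps : R) d : (eps * eps = 1)%R -> (0 < d)%Z -> (d mod 4 = 1)%Z ->
  unique_on_UHP (fun f => exists a, is_form d 3 1 (nubar eps) f a).
Proof.
  intros He Hd Hd4. destruct (ex_form_nubar eps d He Hd Hd4) as (f & a & Hf). exists f. split; [now exists a|].
  intros g [b Hg]. rewrite is_form_nubarE in Hf, Hg by assumption. pose proof (Zopp_mod_4 d 1 Hd4 eq_refl) as Hr.
  revert f g a b Hf Hg. apply (is_form_unique eps d 1 3).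
  - apply Zodd_mod_4. now left.
  - now rewrite Hr.
  - intros n Hn. rewrite Hr, Z.mod_small by lia. lia.
  - apply is_qseries_quarters_W2_eq_0; lia || assumption.
Qed.

Lemma unique_form_nu_plus d : (0 < d)%Z -> (d mod 4 = 3)%Z -> unique_on_UHP (fun f => exists a, is_form d 1 1 (nu 1) f
  a).
Proof.
  intros Hd Hd4. destruct (ex_form_nu_plus d Hd Hd4) as (f & a & Hf). exists f. split; [now exists a|].
  intros g [b Hg]. rewrite is_form_nuE in Hf, Hg by assumption. pose proof (Zopp_mod_4 d 3 Hd4 eq_refl) as Hr.
  revert f g a b Hf Hg. apply (is_form_unique 1 d 1 1).
  - apply Zodd_mod_4. now right.
  - now rewrite Hr.
  - lia.
  - apply is_qseries_quarter_W2_eq_0.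
Qed.

Lemma unique_form_nu_minus d : (0 < d)%Z -> (d mod 4 = 3)%Z ->
  unique_on_UHP (fun f => exists a, is_form d 1 5 (nu (-1)) f a).
Proof.
  intros Hd Hd4. destruct (ex_form_nu_minus d Hd Hd4) as (f & a & Hf). exists f. split; [now exists a|].
  intros g [b Hg]. rewrite is_form_nuE in Hf, Hg by assumption. pose proof (Zopp_mod_4 d 3 Hd4 eq_refl) as Hr.
  revert f g a b Hf Hg. apply (is_form_unique (-1) d 5 5).
  - apply Zodd_mod_4. now right.
  - now rewrite Hr.
  - lia.
  - apply is_qseries_quarters_W2_eq_0; lia || ring.
Qed.

(* The principal parts of [f1 | T(p^n)] and [p^n g] cancel. *)
Section HeckeDifference.

Variables (p : Z) (n : nat) (eps : R) (f1 g : C -> C) (a1 b : Z -> C) (L : Z).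
Hypothesis p_prime : prime p.
Hypothesis p_neq_2 : p <> 2%Z.
Hypothesis eps_sqr : (eps * eps = 1)%R.
Hypothesis L_ge_1 : (1 <= L)%Z.

Let d := (p ^ Z.of_nat n)%Z.

Hypothesis f1_form : is_form 1 3 1 (nubar eps) f1 a1.
Hypothesis g_form : is_form d (- d mod 4) L (chi (- d) eps) g b.

Let difference (z : C) : C := hecke_pn 2 4 p n f1 z + - IZR d * g z.

Let difference_coef (m : Z) : C := hecke_pow_coef p (qcoef 1 3 1 a1) n m + - IZR d * qcoef d (- d mod 4) L b m.

Let f1_W2 : slash_eigen W2 eps f1.
Proof.
  apply (weakly_holomorphic_W2 (-1)); [now exists (-1)%Z|]. rewrite is_form_nubarE in f1_form by reflexivity.
  apply f1_form.
Qed.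

Let f1_support m : (m mod 4 <> -1 mod 4)%Z -> qcoef 1 3 1 a1 m = 0.
Proof. now apply qcoef_not_mod. Qed.

Lemma hecke_difference_W2 : slash_eigen W2 eps difference.
Proof.
  apply slash_eigen_plus_scal; [reflexivity| |].
  - apply (hecke_pn_W2 p (-1) eps f1 (qcoef 1 3 1 a1)); try assumption; [now exists (-1)%Z|apply f1_form].
  - apply (weakly_holomorphic_W2 (- d)); [|apply g_form].
    now apply Zodd_opp, Zodd_pow, prime_odd.
Qed.

Let difference_support m : (m mod 4 <> - d mod 4)%Z -> difference_coef m = 0.
Proof.
  intros Hm. unfold difference_coef.
  rewrite (hecke_pow_coef_support p (-1)), qcoef_not_mod by (reflexivity || assumption ||
    now apply prime_odd || (replace (-1 * p ^ Z.of_nat n)%Z with (- d)%Z by (unfold d; ring); assumption)).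
  ring.
Qed.

Let difference_nonpos m : (m <= 0)%Z -> difference_coef m = 0.
Proof.
  intros Hm. pose proof (prime_ge_2 p p_prime). unfold difference_coef.
  rewrite hecke_pow_coef_nonpos, qcoef_lt by (lia || (intros k Hk; apply qcoef_lt; lia)).
  fold d. destruct (_ =? _)%Z; ring.
Qed.

Lemma hecke_difference_qseries (M : nat) : (Z.of_nat M mod 4 = - d mod 4)%Z -> (M <= 4)%nat ->
  is_qseries (INR M / 4) difference (fun k => difference_coef (Z.of_nat M + 4 * Z.of_nat k)%Z).
Proof.
  intros HM HM4. replace 4%R with (INR 4) by (simpl; ring).
  apply (has_qexp_qseries 4 difference difference_coef M); [lia| | |].
  - replace (INR 4) with 4%R by (simpl; ring). apply has_qexp_plus; [|apply has_qexp_scal, g_form].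
    apply (has_qexp_hecke_pn p (-1) eps); try assumption; [now exists (-1)%Z|apply f1_form].
  - intros m Hm. destruct (Z_lt_le_dec 0 m) as [H|H]; [|now apply difference_nonpos].
    apply difference_support. rewrite <- HM. intros E. pose proof (Z.div_mod (Z.of_nat M) 4).
    pose proof (Z.div_mod m 4). lia.
  - intros m Hm. apply difference_support. now rewrite <- HM.
Qed.

Lemma hecke_pn_eq_form (M : nat) : (Z.of_nat M mod 4 = - d mod 4)%Z -> (M <= 4)%nat ->
  (forall F c, is_qseries (INR M / 4) F c -> slash_eigen W2 eps F -> forall z, UHP z -> F z = 0) ->
  forall z, UHP z -> hecke_pn 2 4 p n f1 z = IZR d * g z.
Proof.
  intros HM HM4 Hvanish z Hz. apply Cminus_diag_uniq.
  rewrite <- (Hvanish _ _ (hecke_difference_qseries M HM HM4) hecke_difference_W2 z Hz). unfold difference. ring.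
Qed.

End HeckeDifference.

Lemma hecke_pn_nubar (eps : R) p n f1 a1 g b : prime p -> p <> 2%Z -> (eps * eps = 1)%R ->
  ((p ^ Z.of_nat n) mod 4 = 1)%Z ->
  is_form 1 3 1 (nubar eps) f1 a1 -> is_form (p ^ Z.of_nat n) 3 1 (nubar eps) g b ->
  forall z, UHP z -> hecke_pn 2 4 p n f1 z = RtoC (IZR (p ^ Z.of_nat n)) * g z.
Proof.
  intros Hp Hp2 He Hd Hf1 Hg. rewrite is_form_nubarE in Hg by assumption.
  apply (hecke_pn_eq_form p n eps f1 g a1 b 1 Hp Hp2 He ltac:(lia) Hf1 Hg 3); [now rewrite (Zopp_mod_4 _ 1)|lia|].
  apply is_qseries_quarters_W2_eq_0; lia || assumption.
Qed.

Lemma hecke_pn_nu_plus p n f1 a1 g b : prime p -> p <> 2%Z -> ((p ^ Z.of_nat n) mod 4 = 3)%Z ->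
  is_form 1 3 1 (nubar 1) f1 a1 -> is_form (p ^ Z.of_nat n) 1 1 (nu 1) g b ->
  forall z, UHP z -> hecke_pn 2 4 p n f1 z = RtoC (IZR (p ^ Z.of_nat n)) * g z.
Proof.
  intros Hp Hp2 Hd Hf1 Hg. rewrite is_form_nuE in Hg by assumption.
  apply (hecke_pn_eq_form p n 1 f1 g a1 b 1 Hp Hp2 ltac:(ring) ltac:(lia) Hf1 Hg 1);
    [now rewrite (Zopp_mod_4 _ 3)|lia|].
  apply is_qseries_quarter_W2_eq_0.
Qed.

(* The difference now starts with [a1 (p^n) q^(1/4)], as does [a1 (p^n) h2]. *)
Lemma hecke_pn_nu_minus p n f1 a1 g b : prime p -> p <> 2%Z -> ((p ^ Z.of_nat n) mod 4 = 3)%Z ->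
  is_form 1 3 1 (nubar (-1)) f1 a1 -> is_form (p ^ Z.of_nat n) 1 5 (nu (-1)) g b ->
  forall z, UHP z -> hecke_pn 2 4 p n f1 z = RtoC (IZR (p ^ Z.of_nat n)) * g z + a1 (p ^ Z.of_nat n)%Z * h2 z.
Proof.
  intros Hp Hp2 Hd Hf1 Hg. rewrite is_form_nuE in Hg by assumption. pose proof (prime_ge_2 p Hp).
  assert (He : (-1 * -1 = 1)%R) by ring.
  assert (Hpos : (0 < p ^ Z.of_nat n)%Z) by (apply Z.pow_pos_nonneg; lia).
  pose proof (hecke_difference_W2 p n (-1) f1 g a1 b 5 Hp Hp2 He Hf1 Hg) as HW.
  pose proof (hecke_difference_qseries p n (-1) f1 g a1 b 5 Hp Hp2 He ltac:(lia) Hf1 Hg 1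
    ltac:(now rewrite (Zopp_mod_4 _ 3)) ltac:(lia)) as HQ.
  destruct h2_monic as (c & Hh & Hc & _). set (d := (p ^ Z.of_nat n)%Z) in *.
  apply (is_qseries_eq _ (INR 1 / 4)) in Hh; [|simpl; field].
  pose proof (is_qseries_plus _ _ _ _ _ HQ (is_qseries_scal _ (- a1 d) _ _ Hh)) as H'.
  apply is_qseries_drop in H'.
  - intros z Hz. apply Cminus_diag_uniq.
    rewrite <- (is_qseries_W2_eq_0 _ (-1) _ _ H' ltac:(simpl; lra) He) with (z := z).
    + ring.
    + apply slash_eigen_plus_scal; [reflexivity|exact HW|exact h2_W2].
    + assumption.
  - rewrite Hc, Z.mul_0_r, hecke_pow_coef_at_1, (qcoef_lt d) by (simpl; lia). fold d.
    rewrite (proj2 (Z.eqb_neq _ _)) by (simpl; lia). unfold qcoef.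
    rewrite (proj2 (Z.eqb_neq _ _)), Hd, (proj2 (Z.leb_le _ _)) by lia. simpl. ring.
Qed.

Lemma Zodd_pow_mod_4 p (n : nat) : Z.Odd p -> ((p ^ Z.of_nat n) mod 4 = 1 \/ (p ^ Z.of_nat n) mod 4 = 3)%Z.
Proof.
  intros Hp. destruct (Zodd_pow p n Hp) as [k ->]. pose proof (Z.div_mod (2 * k + 1) 4).
  pose proof (Z.mod_pos_bound (2 * k + 1) 4). lia.
Qed.

Theorem theorem4p1 :
  (* (a) *)
  (forall d : Z, (0 < d)%Z -> (d mod 4 = 1)%Z ->
     unique_on_UHP (fun f => exists a, is_form d 3 1 (nubar 1) f a) /\
     unique_on_UHP (fun f => exists a, is_form d 3 1 (nubar (-1)) f a)) /\
  (* (b) *)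
  (forall d : Z, (0 < d)%Z -> (d mod 4 = 3)%Z ->
     unique_on_UHP (fun f => exists a, is_form d 1 1 (nu 1) f a) /\
     unique_on_UHP (fun f => exists a, is_form d 1 5 (nu (-1)) f a)) /\
  (* (c) *)
  (forall (p : Z) (n : nat), prime p -> p <> 2%Z -> (1 <= n)%nat ->
     (forall f1 a1 g b, is_fplus 1 f1 a1 -> is_fplus (p ^ Z.of_nat n) g b ->
        forall z, UHP z ->
          hecke_pn 2 4 p n f1 z = (RtoC (IZR (p ^ Z.of_nat n)) * g z)%C) /\
     (((p ^ Z.of_nat n) mod 4 = 1)%Z ->
        forall f1 a1 g b, is_fminus 1 f1 a1 -> is_fminus (p ^ Z.of_nat n) g b ->
        forall z, UHP z ->
          hecke_pn 2 4 p n f1 z = (RtoC (IZR (p ^ Z.of_nat n)) * g z)%C) /\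
     (((p ^ Z.of_nat n) mod 4 = 3)%Z ->
        forall f1 a1 g b, is_fminus 1 f1 a1 -> is_fminus (p ^ Z.of_nat n) g b ->
        forall z, UHP z ->
          hecke_pn 2 4 p n f1 z =
          (RtoC (IZR (p ^ Z.of_nat n)) * g z + a1 (p ^ Z.of_nat n)%Z * h2 z)%C)).
Proof.
  split; [|split].
  - intros d Hd Hd4. split; apply unique_form_nubar; assumption || ring.
  - intros d Hd Hd4. split; [now apply unique_form_nu_plus|now apply unique_form_nu_minus].
  - intros p n Hp Hp2 _. unfold is_fplus, is_fminus. change (1 mod 4 =? 1)%Z with true. cbv iota.
    split; [|split; intros Hd; rewrite Hd].
    + intros f1 a1 g b Hf1 Hg. destruct (Zodd_pow_mod_4 p n (prime_odd p Hp Hp2)) as [Hd|Hd]; rewrite Hd in Hg.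
      * now apply (hecke_pn_nubar 1 p n f1 a1 g b); try ring.
      * now apply (hecke_pn_nu_plus p n f1 a1 g b).
    + intros f1 a1 g b. apply hecke_pn_nubar; assumption || ring.
    + intros f1 a1 g b. now apply hecke_pn_nu_minus.
Qed.
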